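(* Fix a circulation $\gamma\neq 0$, an integer $\ell\ge 0$, and $\alpha\in(0,1)$. For any integer $m\ge 2$ set $$\Omega_{0,\pm} := \frac{\gamma}{2\pi}\left(1\pm\frac{1}{\sqrt m}\right).$$ For each choice of sign $\pm$ there exists a real-analytic curve $$\mathscr{C}^{m,\pm}_{\mathrm{rot}}=\{(\mathbf U^\varepsilon_\pm,\mathscr V^\varepsilon_\pm,\Omega^\varepsilon_\pm): |\varepsilon|\ll 1\}$$ of $m$-fold symmetric rotating hollow vortex solutions (with circulation $\gamma$, vortex core $\mathscr V^\varepsilon_\pm$, relative velocity $\mathbf U^\varepsilon_\pm$ and angular velocity $\Omega^\varepsilon_\pm$) bifurcating from the trivial circular solution in the sense that $$\mathbf U^0_\pm=\frac{\gamma}{2\pi}\frac{\boldsymbol\xi^\perp}{|\boldsymbol\xi|^2}-\Omega_{0,\pm}\boldsymbol\xi^\perp,\qquad \mathscr V^0_\pm=B_1,\qquad \Omega^0_\pm=\Omega_{0,\pm}.$$ The vortex boundary $\Gamma^\varepsilon_\pm=\partial\mathscr V^\varepsilon_\pm$ is the image of the unit circle $\mathbb T\subset\mathbb C$ under a mapping $f^\varepsilon_\pm\in C^{\ell+1+\alpha}$ and is even about the real axis (the $\xi$-axis). Moreover, as $\varepsilon\to0$, $$f^\varepsilon_\pm(e^{i\theta})=e^{i\theta}+\varepsilon e^{i(1-m)\theta}-\varepsilon^2(\sqrt m\pm1)^2e^{i(1-2m)\theta}+O(\varepsilon^3)\quad\text{in }C^{\ell+1+\alpha},$$ $$\Omega^\varepsilon_\pm=\Omega_{0,\pm}\pm\varepsilon^2\gamma\,\frac{(\sqrt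 m\pm1)^3(\sqrt m\pm3)}{4\pi\sqrt m}+O(\varepsilon^4).$$
   Context: Identify $\mathbb R^2\cong\mathbb C$, and write $(x,y)^\perp=(-y,x)$, $\nabla^\perp=(-\partial_y,\partial_x)$; $B_1$ is the open unit disk centered at $0$. A (single) rotating hollow vortex with circulation $\gamma\in\mathbb R$ and angular velocity $\Omega\in\mathbb R$ consists of a bounded region $\mathscr V\subset\mathbb R^2$ (the vortex core) whose boundary $\Gamma=\partial\mathscr V$ is a Jordan curve, together with a relative velocity field $\mathbf U$ and a pressure $P$ defined on the closure of the fluid domain $\mathscr D:=\mathbb R^2\setminus\overline{\mathscr V}$, satisfying classically (all functions of $\boldsymbol\xi$) $$\mathbf U\cdot\nabla\mathbf U+2\Omega\mathbf U^\perp-\Omega^2\boldsymbol\xi=-\nabla P,\qquad \nabla\cdot\mathbf U=0,\qquad \nabla^\perp\cdot\mathbf U=-2\Omega\qquad\text{in }\mathscr D,$$ $$\int_\Gamma\mathbf t\cdot\mathbf U\,ds=\gamma-2\Omega|\mathscr V|,\qquad \mathbf n\cdot\mathbf U=0\ \text{ on }\Gamma,\qquad P\ \text{is constant on }\Gamma.$$ Here $\mathbf t,\mathbf n$ are unit tangent and normal vectors, $\Gamma$ is oriented counterclockwise, and $|\mathscr V|$ is the area of $\mathscr V$. (This is the steady problem in the frame rotating with angular velocity $\Omega$; the velocity in the lab frame is $\mathbf U+\Omega\boldsymbol\xi^\perp$, and $\gamma$ is its circulation.) The solution is $m$-fold symmetric if the fluid domain $\mathscr D$ and the relative velocity $\mathbf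 U$ are invariant under rotations by $2\pi/m$ radians about the origin (that is, $\mathbf U(R\boldsymbol\xi)=R\,\mathbf U(\boldsymbol\xi)$ with $R$ the rotation by $2\pi/m$). The mapping $f^\varepsilon_\pm$ is the boundary trace of a conformal mapping from $\{|\zeta|>1\}$ onto the fluid domain $\mathscr D^\varepsilon_\pm=\mathbb C\setminus\overline{\mathscr V^\varepsilon_\pm}$, such that $f^\varepsilon_\pm(\zeta)-\zeta$ vanishes at infinity. Real-analyticity of the curve means that, near $\varepsilon=0$, the maps $\varepsilon\mapsto\Omega^\varepsilon_\pm\in\mathbb R$, $\varepsilon\mapsto f^\varepsilon_\pm|_{\mathbb T}\in C^{\ell+1+\alpha}(\mathbb T;\mathbb C)$ and $\varepsilon\mapsto(\mathbf U^\varepsilon_\pm\circ f^\varepsilon_\pm)|_{\mathbb T}\in C^{\ell+\alpha}(\mathbb T;\mathbb R^2)$ are real-analytic. *)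

(* Defs.v *)
From HB Require Import structures.
From mathcomp Require Import all_boot all_order all_algebra.
From mathcomp Require Import all_classical all_reals all_analysis.
From mathcomp Require Export complex.
Import Order.TTheory GRing.Theory Num.Theory.
Import numFieldNormedType.Exports.

Set Implicit Arguments.
Unset Strict Implicit.
Unset Printing Implicit Defensive.

Local Open Scope classical_set_scope.
Local Open Scope ring_scope.

Section Plane.
Variable R : realType.
Implicit Types (x y : R * R) (A V : set (R * R)) (z : R[i]).

Definition dotp x y : R := x.1 * y.1 + x.2 * y.2.

Definition perp x : R * R := (- x.2, x.1).

Definition rotation (a : R) x : R * R :=
  (cos a * x.1 - sin a * x.2, sin a * x.1 + cos a * x.2).

Definition unit_disk : set (R * R) := [set x | dotp x x < 1].

Definition plane_of z : R * R := (complex.Re z, complex.Im z).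

Definition unit_circle (t : R) : R * R := (cos t, sin t).

Definition expi (t : R) : R[i] := (cos t +i* sin t)%C.

Definition frontier A : set (R * R) := closure A `\` interior A.

Definition fluid_domain V : set (R * R) := ~` closure V.

Definition area A : \bar R :=
  (@lebesgue_measure R \x @lebesgue_measure R)%E A.

Definition pdx (W : normedModType R) (g : R * R -> W) x : W := 'D_(1, 0) g x.
Definition pdy (W : normedModType R) (g : R * R -> W) x : W := 'D_(0, 1) g x.

Definition gradient (P : R * R -> R) x : R * R := (pdx P x, pdy P x).

Definition divergence (U : R * R -> R * R) x : R := (pdx U x).1 + (pdy U x).2.

Definition curl (U : R * R -> R * R) x : R := - (pdy U x).1 + (pdx U x).2.

Definition advection (U : R * R -> R * R) x : R * R :=
  (U x).1 *: pdx U x + (U x).2 *: pdy U x.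

(* To be used on open sets [A] only. *)
Definition C1_on (W : normedModType R) A (g : R * R -> W) : Prop :=
  forall x, A x ->
    differentiable g x /\ {for x, continuous (pdx g)} /\
    {for x, continuous (pdy g)}.

End Plane.

Section HollowVortex.
Variable R : realType.
Implicit Types (V : set (R * R)) (U : R * R -> R * R) (P : R * R -> R).

(* A regular C^1 parametrization of the boundary of [V] as a Jordan curve;
   the last clause says that [V] lies on the left of the curve, i.e. that the
   curve runs counterclockwise. *)
Definition ccw_parametrization V (p : R -> R * R) : Prop :=
  [/\ forall t, p (t + 2 * pi) = p t,
      forall t, derivable p t 1,
      continuous (derive1 p)
    & forall t, derive1 p t != 0] /\
  [/\ set_inj `[0, 2 * pi[ p,
      range p = frontier V
    & forall t, \forall s \near 0^'+, V (p t + s *: perp (derive1 p t))].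

(* With a parametrization p of the boundary, t ds = p' dt, and n is parallel
   to perp p'. *)
Definition rotating_hollow_vortex (gamma Omega : R) V U P : Prop :=
  let D := fluid_domain V in
  [/\ open V, connected V, V !=set0 & bounded_set V] /\
  [/\ C1_on D U, {within closure D, continuous U},
      C1_on D P & {within closure D, continuous P}] /\
  (forall x, D x ->
    [/\ advection U x + (2 * Omega) *: perp (U x) - Omega ^+ 2 *: x
          = - gradient P x,
        divergence U x = 0
      & curl U x = - (2 * Omega)]) /\
  (exists p, ccw_parametrization V p /\
     (\int[lebesgue_measure]_(t in `[0, (2 * pi)])
         dotp (derive1 p t) (U (p t)))%R
       = gamma - 2 * Omega * fine (area V) /\
     forall t, dotp (perp (derive1 p t)) (U (p t)) = 0) /\
  exists c, forall x, frontier V x -> P x = c.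

Definition mfold_symmetric (m : nat) V U : Prop :=
  let rho := rotation (2 * pi / m%:R) in
  rho @` fluid_domain V = fluid_domain V /\
  forall x, closure (fluid_domain V) x -> U (rho x) = rho (U x).

Definition even_about_real_axis (G : set (R * R)) : Prop :=
  forall x, G x -> G (x.1, - x.2).

End HollowVortex.

Section ExteriorConformalMap.
Variable R : realType.
Implicit Types F : R[i] -> R[i].

(* [derivable] over the field R[i] is complex differentiability.  [F] is
   required to extend continuously to the unit circle, so that its values
   there are its boundary trace. *)
Definition exterior_conformal_map F (D : set (R * R)) : Prop :=
  let E := [set z : R[i] | 1 < `|z|] in
  [/\ forall z, E z -> derivable (F : R[i]^o -> R[i]^o) z 1,
      set_inj E F,
      [set plane_of (F z) | z in E] = D,
      {within [set z : R[i]^o | 1 <= `|z|],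
         continuous (F : R[i]^o -> R[i]^o)}
    & forall e : R, 0 < e ->
        exists M : R, forall z, M%:C%C < `|z| -> `|F z - z| < e%:C%C].

Definition boundary_trace F (t : R) : R * R := plane_of (F (expi t)).

End ExteriorConformalMap.

Section Hoelder.
Variable R : realType.
Implicit Types g : R -> R * R.

(* A function on the unit circle is represented by the 2 pi-periodic function
   of the angle.  The norm on R * R is the maximum norm, which is equivalent
   to the Euclidean one. *)

Definition sup_norm g : \bar R := ereal_sup [set `|g t|%:E | t in setT].

Definition holder_seminorm (a : R) g : \bar R :=
  ereal_sup [set (`|g st.1 - g st.2| / `|st.1 - st.2| `^ a)%:E
            | st in [set st : R * R | st.1 != st.2]].

Definition holder_norm (k : nat) (a : R) g : \bar R :=
  (\sum_(j < k.+1) sup_norm (derive1n j g) + holder_seminorm a (derive1n k g))%E.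

Definition holder_space (k : nat) (a : R) : set (R -> R * R) :=
  [set g | [/\ forall t, g (t + 2 * pi) = g t,
               forall j t, (j < k)%N -> derivable (derive1n j g) t 1
             & (holder_norm k a g < +oo)%E]].

(* Real-analyticity at [e0] of a map into the space [X] normed by [N]: the map
   is near [e0] the sum in [X] of a power series, whose coefficients are
   bounded geometrically (positive radius of convergence). *)
Definition real_analytic_at (E : lmodType R) (X : set E) (N : E -> \bar R)
    (f : R -> E) (e0 : R) : Prop :=
  exists (c : nat -> E) (r M : R),
    [/\ 0 < r,
        forall n, X (c n) /\ (N (c n) * (r ^+ n)%:E <= M%:E)%E
      & forall e, `|e - e0| < r -> X (f e) /\
          N (f e - \sum_(n < k) (e - e0) ^+ n *: c n) @[k --> \oo] --> 0%E].

Definition holder_analytic_at (k : nat) (a : R) : (R -> R -> R * R) -> R -> Prop :=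
  @real_analytic_at (R -> R * R) (holder_space k a) (holder_norm k a).

Definition scalar_analytic_at : (R -> R) -> R -> Prop :=
  @real_analytic_at R^o setT (fun x => `|x|%:E).

End Hoelder.

(* Main.v *)
From HB Require Import structures.
Require Import Defs.
From mathcomp Require Import all_boot all_order all_algebra.
From mathcomp Require Import all_classical all_reals all_analysis.
From mathcomp Require Import ring lra zify.
Import Order.TTheory GRing.Theory Num.Theory.
Import numFieldNormedType.Exports.
Local Open Scope classical_set_scope.
Local Open Scope ring_scope.
Set Implicit Arguments.
Unset Strict Implicit.
Unset Printing Implicit Defensive.

(** Put [gamma = 2 pi kappa] and [Omega = kappa omega], and let [F] map the
    exterior of the unit disk onto the fluid domain.  With [m]-fold symmetry
    the boundary trace is [zeta (1 + g)], where [g] is a series in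
    [x = e zeta^-m] and its conjugate in which only monomials
    [x^i (conj x)^j] with [i > j] occur.  The conjugate of the lab velocity is
    holomorphic outside and decays, and kinematics and circulation determine
    it: on the circle the relative velocity is
    [i kappa zeta conj(1/F') (1 - omega M)], where [M] is the real function left
    of [F' conj(1 + g)] when a series in negative powers of [zeta] is subtracted
    ([velocity_circle]).  It is tangent by its form; the mean of [M] is twice the
    area over [2 pi] ([area_core_mean]), so that it has the right circulation; and
    in the fluid the momentum equation is the vector identity for the gradient of
    the kinetic energy ([flow_equations]).  Only the pressure condition
    remains: [(1 - omega M)^2 |1/F'|^2 - omega^2 |1 + g|^2] is constant on the
    circle.

    Linearized at the circular vortex, with [omega = 1 + tau + delta], this
    expression multiplies the mode [zeta^(-m n)] by [tau^2 m n - 1], up to sign.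
    At [tau^2 m = 1], that is [tau = sg / sqrt m], the factor is [n - 1].  Hence
    the mode [n = 1] may be prescribed as [x] itself, the modes [n >= 2] are
    solved by division by [n - 1], and the equation of the mode [n = 1]
    determines [delta], since the derivative of [tau^2] with respect to [tau] is
    not zero.

    The resulting fixed-point problem for the coefficients is causal: every
    coefficient depends on coefficients of lower degree only.  It therefore has a
    formal solution ([solution_fixed]).  The iterates stay in a ball of a
    weighted l^1 norm, a Banach algebra in which the division by [n - 1] gains
    the derivative that the nonlinearity loses, and so does the solution
    ([in_ball_solution]): no inverse function theorem is needed.  Everything is
    then a convergent double series in [x] and [conj x].  The formal identity
    becomes Bernoulli's law by evaluation ([bernoulli], [defect_diag]), a series
    with geometric weights is analytic in the amplitude with values in every
    Hoelder space ([holder_analytic_powers]), and the remainders of the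
    expansions are tails of these series ([holder_remainder],
    [shape_omega_low]).

    Geometrically, [F] is a perturbation of the identity by a map with small
    Lipschitz constant, which extends to a homeomorphism of the plane when
    [1/zeta] is continued inside the disk by [conj zeta].  The core is the image
    of the disk, and its topology, the injectivity of the boundary curve and
    the side on which the core lies are read off from this homeomorphism.  The
    area is computed by slicing ([area_core]): the upper half of the boundary
    is a graph, because small sine series are dominated by the sine. *)

(** * Double arrays and the Cauchy product *)

Section Cauchy.
Variable K : comNzRingType.
Implicit Types a b c u v : nat -> nat -> K.

Definition cauchy a b : nat -> nat -> K := fun i j =>
  \sum_(k < i.+1) \sum_(l < j.+1) a k l * b (i - k)%N (j - l)%N.

Definition flip (T : Type) (a : nat -> nat -> T) : nat -> nat -> T :=
  fun i j => a j i.

Definition cnst (x : K) : nat -> nat -> K :=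
  fun i j => if (i == 0)%N && (j == 0)%N then x else 0.

Definition square_sum u (N : nat) : K := \sum_(i < N) \sum_(j < N) u i j.

Lemma cauchyC a b : cauchy a b = cauchy b a.
Proof.
apply/funext => i; apply/funext => j; rewrite /cauchy.
rewrite (reindex_inj rev_ord_inj); apply: eq_bigr => k _.
rewrite (reindex_inj rev_ord_inj); apply: eq_bigr => l _ /=.
have hk := ltn_ord k; have hl := ltn_ord l.
rewrite mulrC !subSS; congr (b _ _ * a _ _); by rewrite ?subKn // -ltnS.
Qed.

Lemma flip_cauchy a b : flip (cauchy a b) = cauchy (flip a) (flip b).
Proof.
by apply/funext => i; apply/funext => j; rewrite /flip /cauchy exchange_big.
Qed.

Lemma cauchyDl a b c : cauchy (a + b) c = cauchy a c + cauchy b c.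
Proof.
apply/funext => i; apply/funext => j; rewrite /cauchy /= !fctE -big_split.
apply: eq_bigr => k _; rewrite -big_split; apply: eq_bigr => l _.
by rewrite mulrDl.
Qed.

Lemma cauchyDr a b c : cauchy a (b + c) = cauchy a b + cauchy a c.
Proof. by rewrite ![cauchy a _]cauchyC cauchyDl. Qed.

Lemma cauchy_cnstl x a i j : cauchy (cnst x) a i j = x * a i j.
Proof.
rewrite /cauchy big_ord_recl big_ord_recl /= /cnst /= !subn0.
rewrite big1 ?addr0 => [|l _]; last by rewrite mul0r.
rewrite big1 ?addr0 // => k _.
by rewrite big1 // => l _; rewrite mul0r.
Qed.

Lemma sum_triangle (F : nat -> nat -> K) N :
  \sum_(i < N) \sum_(k < i.+1) F k (i - k)%N =
  \sum_(k < N) \sum_(i < N) if (k + i < N)%N then F k i else 0.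
Proof.
elim: N => [|N IH]; first by rewrite !big_ord0.
rewrite big_ord_recr /= IH.
transitivity (\sum_(k < N.+1) \sum_(i < N.+1)
   ((if (k + i < N)%N then F k i else 0) +
    (if (k + i == N)%N then F k i else 0))); last first.
  apply: eq_bigr => k _; apply: eq_bigr => i _; rewrite ltnS [in RHS]leq_eqVlt.
  by case: eqVneq => [->|]; rewrite ?ltnn ?add0r ?addr0.
under [RHS]eq_bigr do rewrite big_split; rewrite big_split /=; congr (_ + _).
  rewrite [RHS]big_ord_recr /= [X in _ = _ + X]big1 ?addr0; last first.
    by move=> i _; rewrite ltnNge leq_addr.
  by apply: eq_bigr => k _; rewrite big_ord_recr /= ltnNge leq_addl addr0.
apply: eq_bigr => k _; rewrite -big_mkcond (big_pred1 (inord (N - k))) /=.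
  by rewrite inordK // ltnS leq_subr.
move=> i /=; apply/eqP/eqP => [h|->].
  by apply/val_inj; rewrite /= inordK ?ltnS ?leq_subr //; lia.
by rewrite inordK ?ltnS ?leq_subr // subnKC // -ltnS.
Qed.

(** The Cauchy product keeps, among the terms of the product of two square
    sums, those whose indices stay in the square. *)
Lemma square_sum_cauchy a b N :
  square_sum (cauchy a b) N = \sum_(k < N) \sum_(i < N) \sum_(l < N)
    \sum_(j < N) if (k + i < N)%N && (l + j < N)%N then a k l * b i j else 0.
Proof.
rewrite /square_sum /cauchy.
under eq_bigr do rewrite exchange_big /=.
rewrite (sum_triangle (fun k i => \sum_(j < N) \sum_(l < j.+1)
  a k l * b i (j - l)%N)).
apply: eq_bigr => k _; apply: eq_bigr => i _; case: ifP => _ /=; last first.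
  by rewrite big1 // => l _; rewrite big1.
by rewrite (sum_triangle (fun l j => a k l * b i j)).
Qed.

Lemma square_sumM a b N :
  square_sum a N * square_sum b N =
  \sum_(k < N) \sum_(i < N) \sum_(l < N) \sum_(j < N) a k l * b i j.
Proof.
rewrite /square_sum mulr_suml; apply: eq_bigr => k _.
rewrite mulr_sumr; apply: eq_bigr => i _.
rewrite mulr_suml; apply: eq_bigr => l _.
by rewrite mulr_sumr.
Qed.

Lemma square_sumD a b N :
  square_sum (a + b) N = square_sum a N + square_sum b N.
Proof.
by rewrite /square_sum -big_split; apply: eq_bigr => i _; rewrite -big_split.
Qed.

Lemma square_sumZ x a N :
  square_sum (fun i j => x * a i j) N = x * square_sum a N.
Proof.
by rewrite /square_sum mulr_sumr; apply: eq_bigr => i _; rewrite mulr_sumr.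
Qed.

Lemma square_sum_flip a N : square_sum (flip a) N = square_sum a N.
Proof. by rewrite /square_sum exchange_big. Qed.

End Cauchy.

Section RealArrays.
Variable R : realType.
Implicit Types a b c : nat -> nat -> R.

(** The weighted l^1 norm, as a bound on all the square partial sums. *)
Definition norm_bound (r : R) a (M : R) :=
  forall N, square_sum (fun i j => `|a i j| * r ^+ (i + j)) N <= M.

Lemma square_sum_le a b N : (forall i j, a i j <= b i j) ->
  square_sum a N <= square_sum b N.
Proof. by move=> h; apply: ler_sum => i _; apply: ler_sum. Qed.

Lemma square_sum_ge0 a N : (forall i j, 0 <= a i j) -> 0 <= square_sum a N.
Proof. by move=> h; apply: sumr_ge0 => i _; apply: sumr_ge0. Qed.

Lemma square_sum_mono a N M : (forall i j, 0 <= a i j) -> (N <= M)%N ->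
  square_sum a N <= square_sum a M.
Proof.
move=> h /subnK <-; elim: (M - N)%N => [|p IH]; first by rewrite add0n.
rewrite (le_trans IH) // addSn /square_sum big_ord_recr /= ler_wpDr //.
  exact: sumr_ge0.
by apply: ler_sum => i _; rewrite big_ord_recr /= lerDl.
Qed.

Variable r : R.
Hypothesis r0 : 0 < r.

Lemma norm_bound_ge0 a M : norm_bound r a M -> 0 <= M.
Proof. by move=> /(_ 0%N); rewrite /square_sum big_ord0. Qed.

Lemma norm_bound_le a b M M' : norm_bound r b M' -> M' <= M ->
  (forall i j, `|a i j| <= `|b i j|) -> norm_bound r a M.
Proof.
move=> h hM ab N; apply: le_trans hM; apply: le_trans (h N).
by apply: square_sum_le => i j; rewrite ler_wpM2r // exprn_ge0 // ltW.
Qed.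

Lemma norm_boundD a b M M' : norm_bound r a M -> norm_bound r b M' ->
  norm_bound r (a + b) (M + M').
Proof.
move=> ha hb N; apply: le_trans (lerD (ha N) (hb N)); rewrite -square_sumD.
apply: square_sum_le => i j; rewrite !fctE -mulrDl.
by rewrite ler_wpM2r ?ler_normD // exprn_ge0 // ltW.
Qed.

Lemma norm_boundN a M : norm_bound r a M -> norm_bound r (- a) M.
Proof.
by move=> ha N; under [X in square_sum X]eq_fun2 do rewrite !fctE normrN.
Qed.

Lemma norm_boundZ x a M : norm_bound r a M -> norm_bound r (x *: a) (`|x| * M).
Proof.
move=> ha N; apply: le_trans (ler_wpM2l (normr_ge0 x) (ha N)).
rewrite -square_sumZ; apply: square_sum_le => i j.
by rewrite !fctE normrM mulrA.
Qed.

Lemma norm_bound_flip a M : norm_bound r a M -> norm_bound r (flip a) M.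
Proof.
move=> ha N; apply: le_trans (ha N); rewrite -[leLHS]square_sum_flip.
by apply: square_sum_le => i j; rewrite /flip addnC.
Qed.

Lemma norm_bound_cnst x : norm_bound r (cnst x) `|x|.
Proof.
case=> [|N]; first by rewrite /square_sum big_ord0.
rewrite /square_sum big_ord_recl big_ord_recl /= /cnst /= expr0 mulr1.
rewrite big1 ?addr0 => [|i _]; last by rewrite normr0 mul0r.
by rewrite big1 ?addr0 // => i _; rewrite big1 // => j _; rewrite normr0 mul0r.
Qed.

Lemma norm_bound_cauchy a b M M' : norm_bound r a M -> norm_bound r b M' ->
  norm_bound r (cauchy a b) (M * M').
Proof.
move=> ha hb N.
pose u i j := `|a i j| * r ^+ (i + j); pose v i j := `|b i j| * r ^+ (i + j).
have u0 i j : 0 <= u i j by rewrite mulr_ge0 // exprn_ge0 // ltW.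
have v0 i j : 0 <= v i j by rewrite mulr_ge0 // exprn_ge0 // ltW.
apply: (@le_trans _ _ (square_sum u N * square_sum v N)); last first.
  by rewrite ler_pM ?square_sum_ge0.
apply: (@le_trans _ _ (square_sum (cauchy u v) N)); last first.
  rewrite square_sum_cauchy square_sumM.
  do 4! (apply: ler_sum => ? _).
  by case: ifP => // _; rewrite mulr_ge0.
apply: square_sum_le => i j; rewrite /cauchy.
apply: le_trans (ler_wpM2r _ (ler_norm_sum _ _ _)) _.
  by rewrite exprn_ge0 // ltW.
rewrite mulr_suml; apply: ler_sum => k _.
apply: le_trans (ler_wpM2r _ (ler_norm_sum _ _ _)) _.
  by rewrite exprn_ge0 // ltW.
rewrite mulr_suml; apply: ler_sum => l _; rewrite normrM.
have -> : (i + j = (k + l) + ((i - k) + (j - l)))%N.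
  by have := ltn_ord k; have := ltn_ord l; lia.
by rewrite exprD mulrACA.
Qed.

End RealArrays.

(** * The hollow vortex as a fixed point of formal series *)

Section Agreement.
Variable R : realType.
Implicit Types a b : nat -> nat -> R.

(** Vanishing below degree [p] is recorded together with the agreement below
    degree [n], because a Cauchy product with a factor of positive order gains
    one degree of agreement: this gain makes the iteration causal. *)
Definition agree (p n : nat) a b := forall i j,
  ((i + j < p)%N -> a i j = 0 /\ b i j = 0) /\ ((i + j < n)%N -> a i j = b i j).

Lemma agree_le p n p' n' a b : agree p n a b -> (p' <= p)%N -> (n' <= n)%N ->
  agree p' n' a b.
Proof.
by move=> h pp nn i j; have [h1 h2] := h i j; split=> k;
  [apply: h1; apply: leq_trans pp|apply: h2; apply: leq_trans nn].
Qed.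

Lemma agree_refl n a : agree 0 n a a.
Proof. by move=> i j; split. Qed.

Lemma agree_sym p n a b : agree p n a b -> agree p n b a.
Proof.
by move=> h i j; have [h1 h2] := h i j; split=> [/h1[-> ->]|/h2 ->].
Qed.

Lemma agree_trans p n a b c : agree p n a b -> agree p n b c -> agree p n a c.
Proof.
move=> h1 h2 i j; have [a1 a2] := h1 i j; have [b1 b2] := h2 i j.
by split=> h; [have [-> _] := a1 h; have [_ ->] := b1 h|rewrite a2 ?b2].
Qed.

Lemma agree_diag p n k a b : agree p n a b -> agree p k a a.
Proof. by move=> h i j; split=> // /(h i j).1[-> _]. Qed.

Lemma agree_init p n k a b : agree p k a b -> (n <= p)%N -> agree p n 0 b.
Proof.
move=> h np i j; split=> ij; first by have [_ ->] := (h i j).1 ij.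
by have [_ ->] := (h i j).1 (leq_trans ij np).
Qed.

Lemma agreeD p n a a' b b' : agree p n a a' -> agree p n b b' ->
  agree p n (a + b) (a' + b').
Proof.
move=> ha hb i j; have [a1 a2] := ha i j; have [b1 b2] := hb i j.
rewrite !fctE; split=> h; last by rewrite a2 ?b2.
by have [-> ->] := a1 h; have [-> ->] := b1 h; rewrite addr0.
Qed.

Lemma agreeN p n a a' : agree p n a a' -> agree p n (- a) (- a').
Proof.
move=> ha i j; have [a1 a2] := ha i j.
rewrite !fctE; split=> h; last by rewrite a2.
by have [-> ->] := a1 h; rewrite oppr0.
Qed.

Lemma agreeB p n a a' b b' : agree p n a a' -> agree p n b b' ->
  agree p n (a - b) (a' - b').
Proof. by move=> ha hb; apply: agreeD => //; apply: agreeN. Qed.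

Lemma agreeZ x p n a a' : agree p n a a' -> agree p n (x *: a) (x *: a').
Proof.
move=> ha i j; have [a1 a2] := ha i j.
split=> h; rewrite /= !fctE; last by rewrite a2.
by have [-> ->] := a1 h; rewrite scaler0.
Qed.

Lemma agree_flip p n a a' : agree p n a a' -> agree p n (flip a) (flip a').
Proof. by move=> ha i j; have := ha j i; rewrite addnC. Qed.

Lemma agree_cauchy p n q k u t a a' b b' :
  agree p n a a' -> agree q k b b' ->
  (u <= p + q)%N -> (t <= n + q)%N -> (t <= k + p)%N ->
  agree u t (cauchy a b) (cauchy a' b').
Proof.
move=> ha hb hu ht1 ht2 i j; split=> hij.
  split; rewrite /cauchy big1 // => x _; rewrite big1 // => y _;
  have hx := ltn_ord x; have hy := ltn_ord y;
  have [a1 _] := ha x y; have [b1 _] := hb (i - x)%N (j - y)%N;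
  (case: (ltnP (x + y) p) => [/a1[e1 e2]|hp]; first by rewrite ?e1 ?e2 mul0r);
  have /b1[e1 e2] : (i - x + (j - y) < q)%N by lia.
    by rewrite e1 mulr0.
  by rewrite e2 mulr0.
apply: eq_bigr => x _; apply: eq_bigr => y _.
have hx := ltn_ord x; have hy := ltn_ord y.
have [a1 a2] := ha x y; have [b1 b2] := hb (i - x)%N (j - y)%N.
case: (ltnP (x + y) p) => [/a1[-> ->]|hp]; first by rewrite !mul0r.
case: (ltnP (i - x + (j - y)) q) => [/b1[-> ->]|hq]; first by rewrite !mulr0.
by rewrite a2 ?b2 //; lia.
Qed.

End Agreement.

Section HollowSystem.
Variables (R : realType) (m : nat) (tau : R).
Implicit Types a b : nat -> nat -> R.

(** The derivation [zeta d/dzeta] on series in [e zeta^-m] and [e zeta^m]. *)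
Definition euler a : nat -> nat -> R :=
  fun i j => - (m%:R * (i%:R - j%:R)) * a i j.

(** Replaces the modes with [i > j] by the conjugates of the opposite ones. *)
Definition mirror a : nat -> nat -> R := fun i j => a (minn i j) (maxn i j).

Definition xvar : nat -> nat -> R :=
  fun i j => if (i == 1)%N && (j == 0)%N then 1 else 0.

(** The unknowns.  The first tail is the perturbation [g] without its leading
    term [x], the second one is the angular velocity minus its value at the
    circular vortex, and the third one is the remainder of [1 / (1 + a)] after
    [1 - a], where [1 + a] is the derivative of the exterior map. *)
Record series := Series {
  shape_tail : nat -> nat -> R;
  omega_tail : nat -> nat -> R;
  inverse_tail : nat -> nat -> R }.

Implicit Types s : series.

(** Here [zeta (1 + g)] is the boundary trace, [1 + a] is the derivative of the
    exterior map and [1 + k] is its inverse. *)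
Definition gser s := xvar + shape_tail s.
Definition hser s := euler (gser s).
Definition aser s := gser s + hser s.
Definition kser s := inverse_tail s - aser s.
Definition omser s := cnst (1 + tau) + omega_tail s.
Definition tdser s := cnst tau + omega_tail s.
Definition inverse_next s :=
  cauchy (aser s) (aser s) - cauchy (aser s) (inverse_tail s).
Definition pser s := gser s + flip (gser s).
(** Replacing the holomorphic half of [a conj(g)] by the conjugate of the other
    half makes this term of the mean flow real. *)
Definition sigser s := mirror (cauchy (aser s) (flip (gser s))).
Definition q2ser s :=
  cauchy (cauchy (tdser s) (omser s)) (2 *: sigser s) +
  cauchy (cauchy (omser s) (omser s))
         (cauchy (pser s + sigser s) (pser s + sigser s)).
Definition kkser s :=
  kser s + flip (kser s) + cauchy (kser s) (flip (kser s)).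
Definition k2ser s := inverse_next s + flip (inverse_next s) +
  cauchy (kser s) (flip (kser s)).
(** What Bernoulli's law leaves, up to a constant, after its linear part
    [- p - td^2 (h + conj h)]; it is at least quadratic in the unknowns. *)
Definition remser s :=
  cauchy (cauchy (tdser s) (tdser s)) (k2ser s) +
  cauchy (cauchy (tdser s) (omser s)) (2 *: cauchy (pser s) (kkser s)) +
  cauchy (q2ser s) (cauchy (cnst 1 + kser s) (flip (cnst 1 + kser s))) -
  cauchy (cauchy (omser s) (omser s)) (cauchy (gser s) (flip (gser s))).
Definition ddser s :=
  (2 * tau) *: omega_tail s + cauchy (omega_tail s) (omega_tail s).

(** On the mode [i - j = n] the linear part is multiplication by [n - 1].  It is
    divided out for [n >= 2]; the mode [n = 1], whose amplitude is normalized,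
    gives the equation for the angular velocity. *)
Definition step s : series := Series
  (fun i j => if (j.+2 <= i)%N then
     (i - j - 1)%:R^-1 * (cauchy (ddser s) (euler (shape_tail s)) - remser s) i j
   else 0)
  (fun i j => if (i == j) && (0 < j)%N then
     - (2 * tau)^-1 * (remser s j.+1 j / m%:R +
                       cauchy (omega_tail s) (omega_tail s) j j)
   else 0)
  (inverse_next s).

Lemma agree_euler p n a a' : agree p n a a' -> agree p n (euler a) (euler a').
Proof.
move=> ha i j; have [a1 a2] := ha i j; rewrite /euler.
by split=> h; [have [-> ->] := a1 h; rewrite mulr0|rewrite a2].
Qed.

Lemma agree_mirror p n a a' : agree p n a a' -> agree p n (mirror a) (mirror a').
Proof.
by move=> ha i j; have := ha (minn i j) (maxn i j); rewrite addn_min_max.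
Qed.

Lemma agree_xvar n : agree 1 n xvar xvar.
Proof. by move=> i j; split=> //; case: i => // -[|//] . Qed.

Definition agree_series n s s' :=
  [/\ agree 2 n (shape_tail s) (shape_tail s'),
      agree 2 n.-1 (omega_tail s) (omega_tail s')
    & agree 2 n (inverse_tail s) (inverse_tail s')].

(** The remainder has only products of two factors of positive order, and this
    produces the extra degree. *)
Lemma agree_remser n s s' : (0 < n)%N -> agree_series n s s' ->
  [/\ agree 2 n.+1 (inverse_next s) (inverse_next s'),
      agree 2 n.+1 (remser s) (remser s') &
      agree 2 n.+1 (cauchy (ddser s) (euler (shape_tail s)))
                   (cauchy (ddser s') (euler (shape_tail s')))].
Proof.
move=> n0 [hG hd hk].
have hg : agree 1 n (gser s) (gser s').
  by apply: agreeD; [exact: agree_xvar|apply: (agree_le hG)].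
have hgf := agree_flip hg.
have hh : agree 1 n (hser s) (hser s') by apply: agree_euler.
have ha : agree 1 n (aser s) (aser s') by apply: agreeD.
have hkk : agree 1 n (kser s) (kser s').
  by apply: agreeB ha; apply: (agree_le hk).
have hkf := agree_flip hkk.
have hkn : agree 2 n.+1 (inverse_next s) (inverse_next s').
  by apply: agreeB; [apply: (agree_cauchy ha ha)|apply: (agree_cauchy ha hk)]; lia.
have hom : agree 0 n.-1 (omser s) (omser s').
  by apply: agreeD; [exact: agree_refl|apply: (agree_le hd)].
have htd : agree 0 n.-1 (tdser s) (tdser s').
  by apply: agreeD; [exact: agree_refl|apply: (agree_le hd)].
have hp : agree 1 n (pser s) (pser s') by apply: agreeD.
have hsig : agree 2 n.+1 (sigser s) (sigser s').
  by apply: agree_mirror; apply: (agree_cauchy ha hgf); lia.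
have hps : agree 1 n (pser s + sigser s) (pser s' + sigser s').
  by apply: agreeD => //; apply: (agree_le hsig).
have mul0 a a' b b' : agree 0 n.-1 a a' -> agree 0 n.-1 b b' ->
    agree 0 n.-1 (cauchy a b) (cauchy a' b').
  by move=> h1 h2; apply: (agree_cauchy h1 h2); lia.
have mul2 a a' b b' : agree 0 n.-1 a a' -> agree 2 n.+1 b b' ->
    agree 2 n.+1 (cauchy a b) (cauchy a' b').
  by move=> h1 h2; apply: (agree_cauchy h1 h2); lia.
have mul11 a a' b b' : agree 1 n a a' -> agree 1 n b b' ->
    agree 2 n.+1 (cauchy a b) (cauchy a' b').
  by move=> h1 h2; apply: (agree_cauchy h1 h2); lia.
have hK : agree 1 n (kkser s) (kkser s').
  apply: agreeD; first exact: agreeD.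
  by apply: agree_le (mul11 _ _ _ _ hkk hkf) _ _.
have hK2 : agree 2 n.+1 (k2ser s) (k2ser s').
  apply: agreeD; last exact: mul11.
  by apply: agreeD => //; exact: agree_flip.
have hQ2 : agree 2 n.+1 (q2ser s) (q2ser s').
  apply: agreeD; first by apply: mul2; [exact: mul0|exact: agreeZ].
  by apply: mul2; [exact: mul0|exact: mul11].
have hk1 : agree 0 n (cnst 1 + kser s) (cnst 1 + kser s').
  by apply: agreeD; [exact: agree_refl|apply: (agree_le hkk)].
split => //.
  apply: agreeB; last by apply: mul2; [exact: mul0|exact: mul11].
  apply: agreeD.
    apply: agreeD; first by apply: mul2 => //; exact: mul0.
    by apply: mul2; [exact: mul0|apply/agreeZ/mul11].
  have hkk1 : agree 0 n (cauchy (cnst 1 + kser s) (flip (cnst 1 + kser s)))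
     (cauchy (cnst 1 + kser s') (flip (cnst 1 + kser s'))).
    by apply: (agree_cauchy hk1 (agree_flip hk1)); lia.
  by apply: (agree_cauchy hQ2 hkk1); lia.
have hdd : agree 2 n.-1 (ddser s) (ddser s').
  by apply: agreeD; [exact: agreeZ|apply: (agree_cauchy hd hd); lia].
by apply: (agree_cauchy hdd (agree_euler hG)); lia.
Qed.

(** Causality: every step determines one more degree. *)
Lemma agree_step n s s' : (0 < n)%N -> agree_series n s s' ->
  agree_series n.+1 (step s) (step s').
Proof.
move=> n0 hs; have [hk hR hdG] := agree_remser n0 hs.
have [_ hd _] := hs.
split=> //= i j.
  have [h1 h2] := agreeB hdG hR i j; split=> h; case: ifP => // hij; try lia.
  by rewrite h2.
split=> h; case: ifP => // /andP[/eqP hij j0]; try lia.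
have [_ ->] := hR j.+1 j; last by lia.
have hdd : agree 4 n.+1 (cauchy (omega_tail s) (omega_tail s))
    (cauchy (omega_tail s') (omega_tail s')).
  by apply: (agree_cauchy hd hd); lia.
by have [_ ->] := hdd j j; last by lia.
Qed.

Definition iterate_series N := iter N step (Series 0 0 0).

Lemma agree_series_le n n' s s' : agree_series n s s' -> (n' <= n)%N ->
  agree_series n' s s'.
Proof.
by move=> [h1 h2 h3] le; split; [apply: (agree_le h1)|apply: (agree_le h2)|
  apply: (agree_le h3)] => //; lia.
Qed.

Lemma agree_iterate_next N :
  agree_series N.+1 (iterate_series N) (iterate_series N.+1).
Proof.
elim: N => [|N IH]; last exact: agree_step.
have z n : agree n n (0 : nat -> nat -> R) 0 by move=> i j; split.
have [h1 h2 h3] : agree_series 2 (step (iterate_series 0)) (step (iterate_series 0)).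
  by apply: agree_step => //; split; apply: agree_le (z 2%N) _ _.
by split; [apply: agree_init h1 _|apply: agree_init h2 _|apply: agree_init h3 _].
Qed.

Lemma agree_iterate M N : (M <= N)%N ->
  agree_series M.+1 (iterate_series M) (iterate_series N).
Proof.
move=> /subnK <-; elim: (N - M)%N => [|k [h1 h2 h3]].
  have [h1 h2 h3] := agree_iterate_next M.
  by split; [apply: agree_diag h1|apply: agree_diag h2|apply: agree_diag h3].
have [] : agree_series M.+1 (iterate_series (k + M)) (iterate_series (k + M).+1).
  by apply: agree_series_le (agree_iterate_next _) _; lia.
move=> a1 a2 a3; rewrite addSn.
by split; [exact: agree_trans h1 a1|exact: agree_trans h2 a2|
  exact: agree_trans h3 a3].
Qed.

(** Each coefficient of the iterates is eventually constant. *)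
Definition solution : series := Series
  (fun i j => shape_tail (iterate_series (i + j)) i j)
  (fun i j => omega_tail (iterate_series (i + j).+1) i j)
  (fun i j => inverse_tail (iterate_series (i + j)) i j).

Lemma agree_solution N : agree_series N.+1 (iterate_series N) solution.
Proof.
have [n1 n2 n3] := agree_iterate_next N.
have e2 i j : omega_tail solution i j =
  omega_tail (iterate_series (i + j).+1) i j by [].
have e1 i j : shape_tail solution i j =
  shape_tail (iterate_series (i + j)) i j by [].
have e3 i j : inverse_tail solution i j =
  inverse_tail (iterate_series (i + j)) i j by [].
split=> i j; split=> h; rewrite ?e1 ?e2 ?e3.
- have [h1 _ _] := agree_iterate_next (i + j).
  by have [-> _] := (n1 i j).1 h; have [-> _] := (h1 i j).1 h.
- have le : (i + j <= N)%N by rewrite -ltnS.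
  by have [h2 _ _] := agree_iterate le; have [_ ->] := h2 i j.
- have [_ h1 _] := agree_iterate_next (i + j).+1.
  by have [-> _] := (n2 i j).1 h; have [-> _] := (h1 i j).1 h.
- by have [_ h2 _] := agree_iterate h; have [_ ->] := h2 i j.
- have [_ _ h1] := agree_iterate_next (i + j).
  by have [-> _] := (n3 i j).1 h; have [-> _] := (h1 i j).1 h.
- have le : (i + j <= N)%N by rewrite -ltnS.
  by have [_ _ h2] := agree_iterate le; have [_ ->] := h2 i j.
Qed.

Lemma agree_series_eq s s' : (forall n, agree_series n s s') -> s = s'.
Proof.
case: s s' => [a b c] [a' b' c'] h.
have h1 i j : a i j = a' i j.
  by have [/(_ i j)[_ e] _ _] := h (i + j).+1; exact: e.
have h2 i j : b i j = b' i j.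
  by have [_ /(_ i j)[_ e] _] := h (i + j).+2; exact: e.
have h3 i j : c i j = c' i j.
  by have [_ _ /(_ i j)[_ e]] := h (i + j).+1; exact: e.
by congr Series; apply/funext => i; apply/funext => j.
Qed.

Theorem solution_fixed : step solution = solution.
Proof.
apply: agree_series_eq => n; apply: (@agree_series_le n.+2); last by rewrite ltnW.
have [h1 h2 h3] := agree_step (ltn0Sn _) (agree_solution n).
have [k1 k2 k3] := agree_solution n.+1.
by split; [exact: agree_trans (agree_sym h1) k1|
  exact: agree_trans (agree_sym h2) k2|exact: agree_trans (agree_sym h3) k3].
Qed.

Definition ball_cst : R := m%:R + 4.
Definition ball_eta : R := (12 * m%:R)^-1.
Local Notation c := ball_cst.
Local Notation eta := ball_eta.

Section Bounds.
Variable r : R.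
Hypothesis r0 : 0 < r.

Lemma norm_bound_mirror a M : norm_bound r a M -> norm_bound r (mirror a) (2 * M).
Proof.
move=> ha.
have h : norm_bound r (fun i j => `|a i j|) M.
  by apply: (norm_bound_le r0 ha) => // i j; rewrite normr_id.
have := norm_boundD r0 h (norm_bound_flip h) => /(norm_bound_le r0); apply => //.
  by rewrite mulr_natl mulr2n.
move=> i j; rewrite !fctE /flip /mirror [leRHS]ger0_norm ?addr_ge0 //.
by case: leqP => _; rewrite ?lerDl ?lerDr.
Qed.

Lemma norm_bound_shift a M : norm_bound r a M ->
  norm_bound r (fun i j => a i.+1 j) (M / r).
Proof.
move=> ha N; rewrite ler_pdivlMr //; apply: le_trans (ha N.+1).
rewrite mulrC -square_sumZ /square_sum [leRHS]big_ord_recl ler_wpDl //.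
  by apply: sumr_ge0 => j _; rewrite mulr_ge0 // exprn_ge0 // ltW.
apply: ler_sum => i _; rewrite big_ord_recr ler_wpDr //=.
  by rewrite mulr_ge0 // exprn_ge0 // ltW.
by apply: ler_sum => j _; rewrite /bump /= add1n addSn exprS mulrCA.
Qed.

Hypothesis hm : (2 <= m)%N.
Hypothesis htau : tau ^+ 2 * m%:R = 1.

Lemma m_ge2 : 2 <= m%:R :> R. Proof. by rewrite ler_nat. Qed.

Lemma tau_le1 : `|tau| <= 1.
Proof.
have h := m_ge2; rewrite -(@expr_le1 _ 2) // -normrX ger0_norm ?sqr_ge0 //.
move: htau (sqr_ge0 tau); set q := tau ^+ 2 => ? ?; nra.
Qed.

Lemma tau_lower : 1 <= m%:R * `|tau|.
Proof.
have h := m_ge2; have h1 := tau_le1.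
have : `|tau| ^+ 2 * m%:R = 1 by rewrite -normrX ger0_norm ?sqr_ge0.
have := normr_ge0 tau; nra.
Qed.

(** One derivative is included in the norm of the shape, because the division by
    [i - j - 1] in the fixed-point map gives it back. *)
Definition in_ball s := [/\ norm_bound r (euler (shape_tail s)) r,
  norm_bound r (omega_tail s) eta, norm_bound r (inverse_tail s) r
  & forall i j, (i < j + 2)%N -> shape_tail s i j = 0].

(* With room to spare: the quadratic terms are bounded by explicit multiples of
   [(c r)^2], and this makes them at most [r]. *)
Hypothesis hr : 12000 * m%:R * c ^+ 2 * r <= 1.

Lemma radius_small : c * r <= 1.
Proof.
have h := m_ge2; have : 1 <= c by rewrite /ball_cst; lra.
move: r0 hr => rp hr' c1.
have : c <= 12000 * m%:R * c ^+ 2 by nra.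
nra.
Qed.

Lemma in_ball_small s : in_ball s ->
  [/\ norm_bound r (gser s) (c * r), norm_bound r (aser s) (c * r),
      norm_bound r (kser s) (c * r), norm_bound r (omser s) 3
    & norm_bound r (tdser s) 2] /\
  norm_bound r (hser s) (c * r).
Proof.
have hm2 := m_ge2; have ht := tau_le1.
move=> [hG hd hk sG].
have e1 : eta <= 1 by rewrite invf_le1; lra.
have nG : norm_bound r (shape_tail s) r.
  apply: (norm_bound_le r0 hG) => // i j; rewrite /euler normrM.
  case: (ltnP i (j + 2)) => [/sG ->|ij]; first by rewrite normr0 mulr0.
  rewrite ler_peMl // normrN ger0_norm.
    rewrite -natrB ?(leq_trans (leq_addr 2 j)) // -natrM ler1n muln_gt0.
    by rewrite (ltnW hm) subn_gt0 (leq_trans _ ij) // addn2 ltnS.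
  by rewrite mulr_ge0 // subr_ge0 ler_nat (leq_trans (leq_addr 2 j)).
have nx : norm_bound r xvar r.
  move=> N; apply: (@le_trans _ _ (square_sum (fun i j => `|xvar i j| * r ^+ (i + j)) N.+2)).
    apply: square_sum_mono; last by rewrite leqW // leqnSn.
    by move=> i j; rewrite mulr_ge0 // exprn_ge0 // ltW.
  rewrite /square_sum big_ord_recl big_ord_recl /= /xvar /= big1; last first.
    by move=> j _; rewrite normr0 mul0r.
  rewrite add0r big_ord_recl /= big1 ?addr0; last first.
    by move=> j _; rewrite normr0 mul0r.
  rewrite big1 ?addr0 ?normr1 ?mul1r ?expr1 // => i _.
  by rewrite big1 // => j _; rewrite normr0 mul0r.
have nex : norm_bound r (euler xvar) (m%:R * r).
  have := norm_boundZ m%:R nx => /(norm_bound_le r0); apply=> //.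
    by rewrite ger0_norm.
  move=> i j; rewrite /euler /xvar !fctE.
  case: ifP => [/andP[/eqP -> /eqP ->]|_]; last by rewrite !mulr0 normr0 scaler0 normr0.
  by rewrite subr0 mulr1 mulr1 normrN /GRing.scale /= mulr1.
have ng := norm_boundD r0 nx nG.
have nh : norm_bound r (hser s) (m%:R * r + r).
  have := norm_boundD r0 nex hG => /(norm_bound_le r0); apply=> // i j.
  by rewrite /hser /euler /gser !fctE mulrDr.
have na := norm_boundD r0 ng nh.
have nk := norm_boundD r0 hk (norm_boundN na).
have nom := norm_boundD r0 (norm_bound_cnst r (1 + tau)) hd.
have ntd := norm_boundD r0 (norm_bound_cnst r tau) hd.
have h1 : `|1 + tau| <= 2 by have := ler_normD 1 tau; rewrite normr1; lra.
have mr : 2 * r <= m%:R * r by rewrite ler_wpM2r // ltW.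
have rp := r0.
have cr : c * r = m%:R * r + 4 * r by rewrite /ball_cst; ring.
split; first split.
- by apply: (norm_bound_le r0 ng) => //; rewrite cr; lra.
- by apply: (norm_bound_le r0 na) => //; rewrite cr; lra.
- by apply: (norm_bound_le r0 nk) => //; rewrite cr; lra.
- by apply: (norm_bound_le r0 nom) => //; lra.
- by apply: (norm_bound_le r0 ntd) => //; lra.
- by apply: (norm_bound_le r0 nh) => //; rewrite cr; lra.
Qed.

Lemma norm_bound_remser s : in_ball s ->
  norm_bound r (remser s) (1000 * (c * r) ^+ 2) /\
  norm_bound r (inverse_next s) (2 * (c * r) ^+ 2).
Proof.
move=> hs; have [[ng na nk nom ntd] nh] := in_ball_small hs.
have [hG hd hk sG] := hs; have hm2 := m_ge2; have tt := radius_small.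
have rp := r0.
have t0 : 0 <= c * r by exact: norm_bound_ge0 ng.
have rt : r <= c * r by rewrite ler_peMl // ?ltW // /ball_cst; lra.
have nk' : norm_bound r (inverse_tail s) (c * r) by apply: (norm_bound_le r0 hk).
set t := c * r in ng na nk nh tt t0 nk' *.
have D := norm_boundD r0; have P := norm_bound_cauchy r0.
have F := @norm_bound_flip R r; have Z := @norm_boundZ R r.
have nn : norm_bound r (inverse_next s) (2 * t ^+ 2).
  have := D _ _ _ _ (P _ _ _ _ na na) (norm_boundN (P _ _ _ _ na nk')).
  by move=> /(norm_bound_le r0); apply=> //; rewrite -expr2; lra.
split => //.
have np := D _ _ _ _ ng (F _ _ ng).
have nsig := norm_bound_mirror (P _ _ _ _ na (F _ _ ng)).
have nps := D _ _ _ _ np nsig.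
have nkk := P _ _ _ _ nk (F _ _ nk).
have nK := D _ _ _ _ (D _ _ _ _ nk (F _ _ nk)) nkk.
have nK2 := D _ _ _ _ (D _ _ _ _ nn (F _ _ nn)) nkk.
have nQ2 := D _ _ _ _ (P _ _ _ _ (P _ _ _ _ ntd nom) (Z 2 _ _ nsig))
  (P _ _ _ _ (P _ _ _ _ nom nom) (P _ _ _ _ nps nps)).
have nk1 := D _ _ _ _ (norm_bound_cnst r 1) nk.
have n1 := P _ _ _ _ (P _ _ _ _ ntd ntd) nK2.
have n2 := P _ _ _ _ (P _ _ _ _ ntd nom) (Z 2 _ _ (P _ _ _ _ np nK)).
have n3 := P _ _ _ _ nQ2 (P _ _ _ _ nk1 (F _ _ nk1)).
have n4 := P _ _ _ _ (P _ _ _ _ nom nom) (P _ _ _ _ ng (F _ _ ng)).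
have n5 := D _ _ _ _ (D _ _ _ _ (D _ _ _ _ n1 n2) n3) (norm_boundN n4).
apply: (norm_bound_le r0 n5) => //.
rewrite normr1 (_ : `|2 : R| = 2) ?ger0_norm //.
have -> : 2 * 2 * (2 * t ^+ 2 + 2 * t ^+ 2 + t * t) +
  2 * 3 * (2 * ((t + t) * (t + t + t * t))) +
  (2 * 3 * (2 * (2 * (t * t))) +
   3 * 3 * ((t + t + 2 * (t * t)) * (t + t + 2 * (t * t)))) *
  ((1 + t) * (1 + t)) + 3 * 3 * (t * t) =
  t ^+ 2 * (53 + 24 * t + (24 + 36 * (1 + t) ^+ 2) * (1 + t) ^+ 2 + 24) by ring.
rewrite mulrC ler_wpM2r ?sqr_ge0 //.
have h2 : (1 + t) ^+ 2 <= 4 by nra.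
have h3 : 0 <= (1 + t) ^+ 2 by exact: sqr_ge0.
nra.
Qed.

Lemma in_ball_step s : in_ball s -> in_ball (step s).
Proof.
move=> hs; have [nR nk] := norm_bound_remser hs.
have [hG hd hk sG] := hs; have hm2 := m_ge2.
have small : (c * r) ^+ 2 * 12000 * m%:R <= r.
  rewrite exprMn (expr2 r) -[leRHS]mul1r.
  rewrite [leLHS](_ : _ = (12000 * m%:R * c ^+ 2 * r) * r); last by ring.
  by rewrite ler_wpM2r // ltW.
have rp := r0.
have T0 : 0 <= (c * r) ^+ 2 by exact: sqr_ge0.
have etaE : eta * 12 * m%:R = 1 by rewrite /ball_eta; field; lra.
have eta0 : 0 < eta by rewrite invr_gt0; lra.
have dd := norm_bound_cauchy r0 hd hd.
split => /=; last first.
- by move=> i j ij; rewrite ifF //; apply/negbTE; rewrite -leqNgt; clear -ij; lia.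
- by apply: (norm_bound_le r0 nk) => //; nra.
- have n1 := norm_boundD r0 (norm_boundZ m%:R^-1 (norm_bound_shift nR)) dd.
  have n2 := norm_boundZ (2 * tau)^-1 n1.
  have tl := tau_lower.
  have tn0 : 0 < `|tau| by have := normr_ge0 tau; nra.
  apply: (norm_bound_le r0 n2) => //.
    have -> : `|(2 * tau)^-1| = (2 * `|tau|)^-1.
      by rewrite normfV normrM (ger0_norm (ler0n _ 2)).
    have -> : `|m%:R^-1 : R| = m%:R^-1 by rewrite ger0_norm.
    rewrite mulrC ler_pdivrMr; last by rewrite mulr_gt0.
    have -> : m%:R^-1 * (1000 * (c * r) ^+ 2 / r) + eta * eta =
      (1000 * (c * r) ^+ 2 / r + m%:R * eta * eta) / m%:R by field; lra.
    rewrite ler_pdivrMr; last by lra.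
    have h1 : 1000 * (c * r) ^+ 2 / r <= eta.
      by rewrite ler_pdivrMr //; nra.
    have h2 : 12 * (m%:R * eta * eta) = eta.
      by transitivity ((eta * 12 * m%:R) * eta); [ring|rewrite etaE mul1r].
    have -> : eta * (2 * `|tau|) * m%:R = 2 * (m%:R * `|tau|) * eta by ring.
    have h3 : 2 * eta <= 2 * (m%:R * `|tau|) * eta.
      by rewrite ler_wpM2r ?(ltW eta0) //; move: tl; set q := _ * _ => tl; lra.
    by move: h1 h2 h3; set q1 := _ / r; set q2 := _ * eta * eta => *; lra.
  move=> i j; case: ifP => [/andP[/eqP -> _]|_]; last by rewrite normr0.
  by rewrite !fctE mulNr normrN [X in `|_ * (X + _)|]mulrC.
- have ndd := norm_boundD r0 (norm_boundZ (2 * tau) hd) dd.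
  have n1 := norm_boundD r0 (norm_bound_cauchy r0 ndd hG) (norm_boundN nR).
  have := norm_boundZ (2 * m%:R) n1 => /(norm_bound_le r0); apply=> //.
    have -> : `|2 * m%:R : R| = 2 * m%:R by rewrite ger0_norm // mulr_ge0.
    have -> : `|2 * tau| = 2 * `|tau| by rewrite normrM ger0_norm.
    have tl := tau_le1.
    have h1 : 2 * `|tau| * eta + eta * eta <= 3 * eta.
      have e1 : eta <= 1 by rewrite invf_le1; lra.
      have e2 : eta * eta <= eta by rewrite ler_piMr // ltW.
      have e3 : `|tau| * eta <= eta by rewrite ler_piMl // ltW.
      by rewrite -mulrA; move: e2 e3; set q1 := _ * _; set q2 := `|tau| * _ => *; lra.
    have h2 : (2 * `|tau| * eta + eta * eta) * r <= 3 * eta * r.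
      by rewrite ler_wpM2r // ltW.
    have h3 : 2 * m%:R * (3 * eta * r) = 2^-1 * r.
      by transitivity (2^-1 * (eta * 12 * m%:R) * r); [field|rewrite etaE mulr1].
    have h4 : 0 <= 2 * m%:R :> R by rewrite mulr_ge0.
    have h5 := ler_wpM2l h4 h2; rewrite h3 in h5.
    have h6 : 2 * m%:R * (1000 * (c * r) ^+ 2) = 6^-1 * ((c * r) ^+ 2 * 12000 * m%:R).
      by field.
    move: h5; rewrite mulrDr h6; move: small rp.
    by set q1 := _ * m%:R; set q2 := _ * (_ * r) => *; lra.
  move=> i j; rewrite /euler /=; case: ifP => ij; last by rewrite mulr0 normr0.
  rewrite [leRHS]normrM mulrA normrM ler_wpM2r //.
  have jj : 0 < (i - j - 1)%:R :> R by rewrite ltr0n; clear -ij; lia.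
  have e : i%:R - j%:R = (i - j - 1)%:R + 1 :> R.
    rewrite -natrB; last by clear -ij; lia.
    by rewrite natr1; congr _%:R; clear -ij; lia.
  have k1 : 1 <= (i - j - 1)%:R :> R by rewrite ler1n -(ltr0n R).
  rewrite e normrM normrN !ger0_norm ?invr_ge0 ?mulr_ge0 ?addr_ge0 //.
  rewrite ler_pdivrMr // (mulrC 2) -mulrA ler_wpM2l //.
  by move: (_%:R) k1 => q q1; lra.
Qed.

Lemma in_ball_iterate N : in_ball (iterate_series N).
Proof.
elim: N => [|N IH]; last exact: in_ball_step.
have hm2 := m_ge2; have rp := r0.
have z M : 0 <= M -> norm_bound r 0 M.
  move=> M0 N; rewrite /square_sum big1 // => i _; rewrite big1 // => j _.
  by rewrite normr0 mul0r.
split => //=; last by apply: z; exact: ltW.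
  rewrite (_ : euler _ = 0); first by apply: z; exact: ltW.
  by apply/funext => i; apply/funext => j; rewrite /euler mulr0.
by apply: z; rewrite invr_ge0 mulr_ge0.
Qed.

(** A bound on square partial sums only involves finitely many coefficients, so
    that it passes from the iterates to their coefficientwise limit. *)
Lemma in_ball_solution : in_ball solution.
Proof.
have key N (a b : nat -> nat -> R) M : agree 2 (N + N) a b -> norm_bound r a M ->
    square_sum (fun i j => `|b i j| * r ^+ (i + j)) N <= M.
  move=> hab ha; apply: le_trans (ha N); apply: ler_sum => i _; apply: ler_sum => j _.
  by have [_ ->] := hab i j; last by rewrite -addnS leq_add // ltnW.
split=> [N|N|N|i j ij].
- have [h _ _] := agree_solution (N + N); have [b _ _ _] := in_ball_iterate (N + N).
  by apply: key b; apply: agree_euler; apply: (agree_le h).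
- have [_ h _] := agree_solution (N + N); have [_ b _ _] := in_ball_iterate (N + N).
  by apply: key b; apply: (agree_le h).
- have [_ _ h] := agree_solution (N + N); have [_ _ b _] := in_ball_iterate (N + N).
  by apply: key b; apply: (agree_le h).
- by have [_ _ _ h] := in_ball_iterate (i + j); apply: h.
Qed.
End Bounds.

Lemma omega_tail_diag i j : (i != j) || (j == 0)%N -> omega_tail solution i j = 0.
Proof.
rewrite -solution_fixed /=; case: ifP => // /andP[-> h] /orP[//|/eqP j0].
by rewrite j0 in h.
Qed.

End HollowSystem.

(** * Absolutely summable double series of complex numbers *)

Local Notation cRe := complex.Re.
Local Notation cIm := complex.Im.
Local Notation normc := ComplexField.Normc.normc.

Section ComplexNorm.
Variable R : realType.
Implicit Types z w : R[i].

Lemma sqr_normc_sum z : normc z ^+ 2 = cRe z ^+ 2 + cIm z ^+ 2.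
Proof. by case: z => a b /=; rewrite sqr_sqrtr // addr_ge0 ?sqr_ge0. Qed.

Lemma normc_ge0 z : 0 <= normc z.
Proof. by case: z => a b; rewrite /= sqrtr_ge0. Qed.

Lemma normc_eq0 z : (normc z == 0) = (z == 0).
Proof.
by apply/eqP/eqP => [/ComplexField.Normc.eq0_normc //|->]; exact: ComplexField.Normc.normc0.
Qed.

Lemma normcr (x : R) : normc x%:C%C = `|x|.
Proof. by rewrite /= expr0n addr0 sqrtr_sqr. Qed.

Lemma abs_Re_le z : `|cRe z| <= normc z.
Proof.
rewrite -ler_sqr ?nnegrE ?normc_ge0 // sqr_normc_sum real_normK ?num_real //.
by rewrite lerDl sqr_ge0.
Qed.

Lemma abs_Im_le z : `|cIm z| <= normc z.
Proof.
rewrite -ler_sqr ?nnegrE ?normc_ge0 // sqr_normc_sum real_normK ?num_real //.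
by rewrite lerDr sqr_ge0.
Qed.

Lemma normc_le_sum z : normc z <= `|cRe z| + `|cIm z|.
Proof.
rewrite -ler_sqr ?nnegrE ?normc_ge0 ?addr_ge0 // sqr_normc_sum sqrrD.
by rewrite !real_normK ?num_real // addrAC lerDl mulrn_wge0 // mulr_ge0.
Qed.

Lemma normc_conj z : normc (z^*)%C = normc z.
Proof. by case: z => a b /=; rewrite sqrrN. Qed.

Lemma normcX z n : normc (z ^+ n) = normc z ^+ n.
Proof.
elim: n => [|n IH]; first by rewrite !expr0 ComplexField.Normc.normc1.
by rewrite !exprS ComplexField.Normc.normcM IH.
Qed.

Lemma normcN z : normc (- z) = normc z.
Proof. by case: z => a b /=; rewrite !sqrrN. Qed.

Lemma normcD z w : normc (z + w) <= normc z + normc w.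
Proof. exact: le_normcD. Qed.

Lemma normcB z w : normc (z - w) = normc (w - z).
Proof. by rewrite -opprB normcN. Qed.

Lemma ler_normc_sum I (s : seq I) (P : pred I) (F : I -> R[i]) :
  normc (\sum_(i <- s | P i) F i) <= \sum_(i <- s | P i) normc (F i).
Proof.
elim/big_ind2: _ => [|x1 x2 y1 y2 h1 h2|//]; first by rewrite ComplexField.Normc.normc0.
exact: le_trans (normcD _ _) (lerD h1 h2).
Qed.

Lemma mulr_conjc z : z * (z^*)%C = (normc z ^+ 2)%:C%C.
Proof.
by rewrite sqr_normc_sum; case: z => a b; simpc; congr (_ +i* _)%C; ring.
Qed.

End ComplexNorm.

Section RealSequences.
Variable R : realType.
Implicit Types f g : nat -> R.

Lemma cvgn_ge f (l c : R) : f @ \oo --> l -> (forall N, c <= f N) -> c <= l.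
Proof.
move=> h hc; rewrite -(cvg_lim _ h) //; apply: limr_ge; first exact: cvgP h.
exact: nearW.
Qed.

Lemma cvgn0D f g : f @ \oo --> 0 -> g @ \oo --> 0 ->
  (fun N => f N + g N) @ \oo --> 0.
Proof. by move=> hf hg; have := cvgD hf hg => /(_ _); rewrite addr0. Qed.

Lemma cvgn0M f (c : R) : f @ \oo --> 0 -> (fun N => c * f N) @ \oo --> 0.
Proof. by move=> hf; rewrite -(mulr0 c); apply: cvgMr. Qed.

Lemma cvgn0_le f g : g @ \oo --> 0 -> (forall N, 0 <= f N <= g N) ->
  f @ \oo --> 0.
Proof.
by move=> hg h; apply: (squeeze_cvgr _ (cvg_cst 0) hg); apply: nearW.
Qed.

End RealSequences.

Section ComplexSums.
Variable R : realType.
Implicit Types (a : nat -> nat -> R) (u v : nat -> nat -> R[i]).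

Lemma square_sum_Re u N :
  cRe (square_sum u N) = square_sum (fun i j => cRe (u i j)) N.
Proof.
have h (x y : R[i]) : cRe (x + y) = cRe x + cRe y by case: x y => ? ? [].
have h0 : cRe (0 : R[i]) = 0 by [].
by rewrite (big_morph _ h h0); apply: eq_bigr => i _; rewrite (big_morph _ h h0).
Qed.

Lemma square_sum_Im u N :
  cIm (square_sum u N) = square_sum (fun i j => cIm (u i j)) N.
Proof.
have h (x y : R[i]) : cIm (x + y) = cIm x + cIm y by case: x y => ? ? [].
have h0 : cIm (0 : R[i]) = 0 by [].
by rewrite (big_morph _ h h0); apply: eq_bigr => i _; rewrite (big_morph _ h h0).
Qed.

Definition summable_by u (M : R) :=
  forall N, square_sum (fun i j => normc (u i j)) N <= M.

Definition csum u : R[i] :=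
  ((limn (square_sum (fun i j => cRe (u i j)))) +i*
   (limn (square_sum (fun i j => cIm (u i j)))))%C.

Lemma square_sum_cvg a M : (forall N, square_sum (fun i j => `|a i j|) N <= M) ->
  cvgn (square_sum a).
Proof.
move=> h.
have mono b : (forall i j, 0 <= b i j) -> (forall i j, b i j <= 2 * `|a i j|) ->
    cvgn (square_sum b).
  move=> b0 ba; apply: nondecreasing_is_cvgn.
    by move=> p q pq; exact: square_sum_mono.
  exists (2 * M) => _ [N _ <-]; apply: le_trans (ler_wpM2l _ (h N)) => //.
  by rewrite -square_sumZ; apply: square_sum_le.
have -> : square_sum a =
    square_sum (fun i j => a i j + `|a i j|) + (- square_sum (fun i j => `|a i j|)).
  apply/funext => N; rewrite !fctE.
  have -> : (fun i j => a i j + `|a i j|) = a + (fun i j => `|a i j|) by [].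
  by rewrite square_sumD addrK.
apply: is_cvgD; last first.
  by apply: is_cvgN; apply: mono => // i j; rewrite ler_peMl // ler1n.
apply: mono => i j.
  by rewrite -lerBlDl sub0r -normrN; exact: ler_norm.
by rewrite mulr_natl mulr2n lerD2r ler_norm.
Qed.

Lemma csum_cvg u M : summable_by u M ->
  (fun N => normc (square_sum u N - csum u)) @ \oo --> 0.
Proof.
move=> h.
have h1 : cvgn (square_sum (fun i j => cRe (u i j))).
  apply: (@square_sum_cvg _ M) => N; apply: le_trans (h N).
  by apply: square_sum_le => i j; exact: abs_Re_le.
have h2 : cvgn (square_sum (fun i j => cIm (u i j))).
  apply: (@square_sum_cvg _ M) => N; apply: le_trans (h N).
  by apply: square_sum_le => i j; exact: abs_Im_le.
apply: (@squeeze_cvgr _ _ _ _ (fun=> 0) (fun N =>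
   `|square_sum (fun i j => cRe (u i j)) N - cRe (csum u)| +
   `|square_sum (fun i j => cIm (u i j)) N - cIm (csum u)|)); last 2 first.
- exact: cvg_cst.
- have key a : cvgn (square_sum a) ->
      (fun N => `|square_sum a N - limn (square_sum a)|) @ \oo --> 0.
    by move=> ha; apply/norm_cvg0P; apply/subr_cvg0.
  by have h3 := cvgD (key _ h1) (key _ h2); rewrite addr0 in h3; exact: h3.
apply: nearW => N; rewrite normc_ge0 /=; apply: le_trans (normc_le_sum _) _.
by rewrite -square_sum_Re -square_sum_Im; case: (square_sum u N).
Qed.

Lemma csum_unique u M l : summable_by u M ->
  (fun N => normc (square_sum u N - l)) @ \oo --> 0 -> csum u = l.
Proof.
move=> /csum_cvg h1 h2; apply/eqP; rewrite -subr_eq0 -normc_eq0.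
rewrite eq_le normc_ge0 andbT.
apply: (cvgn_ge (cvgn0D h1 h2)) => N; rewrite (normcB _ (csum u)).
by apply: le_trans (normcD _ _); rewrite subrKA.
Qed.

Lemma normc_csum_le u M : summable_by u M -> normc (csum u) <= M.
Proof.
move=> hu; have h1 := csum_cvg hu.
have h2 := csum_cvg hu; rewrite -subr_le0.
apply: (cvgn_ge h2) => N; rewrite lerBlDr.
have := normcD (square_sum u N) (csum u - square_sum u N).
rewrite [X in normc X]addrC subrK (normcB (csum u)) => h3; apply: le_trans h3 _.
rewrite addrC lerD2l; apply: le_trans (hu N); apply: le_trans (ler_normc_sum _ _ _) _.
by apply: ler_sum => i _; exact: ler_normc_sum.
Qed.

Lemma summable_by_le u v M M' : summable_by v M' -> M' <= M ->
  (forall i j, normc (u i j) <= normc (v i j)) -> summable_by u M.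
Proof.
move=> h hM uv N; apply: le_trans hM; apply: le_trans (h N).
exact: square_sum_le.
Qed.

Lemma summable_byD u v M M' : summable_by u M -> summable_by v M' ->
  summable_by (u + v) (M + M').
Proof.
move=> hu hv N; apply: le_trans (lerD (hu N) (hv N)); rewrite -square_sumD.
by apply: square_sum_le => i j; exact: normcD.
Qed.

Lemma summable_byZ z u M : summable_by u M ->
  summable_by (fun i j => z * u i j) (normc z * M).
Proof.
move=> hu N; apply: le_trans (ler_wpM2l (normc_ge0 z) (hu N)).
rewrite -square_sumZ.
by apply: square_sum_le => i j; rewrite ComplexField.Normc.normcM.
Qed.

Lemma csumD u v M M' : summable_by u M -> summable_by v M' ->
  csum (u + v) = csum u + csum v.
Proof.
move=> hu hv; apply: (csum_unique (summable_byD hu hv)).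
apply: (cvgn0_le (cvgn0D (csum_cvg hu) (csum_cvg hv))) => N.
rewrite normc_ge0 /= square_sumD opprD addrACA; exact: normcD.
Qed.

Lemma csumZ z u M : summable_by u M ->
  csum (fun i j => z * u i j) = z * csum u.
Proof.
move=> hu; apply: (csum_unique (summable_byZ z hu)).
apply: (cvgn0_le (cvgn0M (normc z) (csum_cvg hu))) => N.
by rewrite normc_ge0 /= square_sumZ -mulrBr ComplexField.Normc.normcM.
Qed.

Lemma csumN u M : summable_by u M -> csum (- u) = - csum u.
Proof.
move=> hu; rewrite -[RHS]mulN1r -(csumZ _ hu); congr csum.
by apply/funext => i; apply/funext => j; rewrite mulN1r.
Qed.

Lemma summable_byN u M : summable_by u M -> summable_by (- u) M.
Proof.
by move=> hu; apply: (summable_by_le hu) => // i j; rewrite !fctE normcN.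
Qed.

Lemma csumB u v M M' : summable_by u M -> summable_by v M' ->
  csum (u - v) = csum u - csum v.
Proof.
by move=> hu hv; rewrite (csumD hu (summable_byN hv)) (csumN hv).
Qed.

Lemma summable_by_conj u M : summable_by u M ->
  summable_by (fun i j => (u i j)^*%C) M.
Proof. by move=> hu; apply: (summable_by_le hu) => // i j; rewrite normc_conj. Qed.

Lemma csum_conj u M : summable_by u M ->
  csum (fun i j => (u i j)^*%C) = ((csum u)^*)%C.
Proof.
move=> hu; apply: (csum_unique (summable_by_conj hu)).
apply: (cvgn0_le (csum_cvg hu)) => N.
rewrite normc_ge0 /= -[leRHS]normc_conj rmorphB /= /square_sum rmorph_sum.
by under [X in normc (X - _)]eq_bigr do rewrite -rmorph_sum.
Qed.

Lemma summable_by_flip u M : summable_by u M -> summable_by (flip u) M.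
Proof.
move=> hu N; apply: le_trans (hu N).
by rewrite -[leLHS]square_sum_flip.
Qed.

Lemma csum_flip u M : summable_by u M -> csum (flip u) = csum u.
Proof.
move=> hu; apply: (csum_unique (summable_by_flip hu)).
by under eq_fun do rewrite square_sum_flip; exact: csum_cvg hu.
Qed.

Lemma summable_by_cauchy u v M M' : summable_by u M -> summable_by v M' ->
  summable_by (cauchy u v) (M * M').
Proof.
move=> hu hv N.
pose U i j := normc (u i j); pose V i j := normc (v i j).
apply: (@le_trans _ _ (square_sum U N * square_sum V N)); last first.
  by apply: ler_pM; rewrite ?square_sum_ge0 // => i j; exact: normc_ge0.
apply: (@le_trans _ _ (square_sum (cauchy U V) N)).
  apply: square_sum_le => i j; apply: le_trans (ler_normc_sum _ _ _) _.
  apply: ler_sum => k _; apply: le_trans (ler_normc_sum _ _ _) _.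
  by apply: ler_sum => l _; rewrite ComplexField.Normc.normcM.
rewrite square_sum_cauchy square_sumM; do 4! (apply: ler_sum => ? _).
by case: ifP => // _; rewrite mulr_ge0 // normc_ge0.
Qed.

(** The terms of the product of two square sums of side [2 N] that the Cauchy
    product omits are dominated by the products of norms outside the square of
    side [N], whose total tends to [0]. *)
Lemma csumM u v M M' : summable_by u M -> summable_by v M' ->
  csum (cauchy u v) = csum u * csum v.
Proof.
move=> hu hv; have huv := summable_by_cauchy hu hv.
pose U i j := normc (u i j); pose V i j := normc (v i j).
have U0 i j : 0 <= U i j by exact: normc_ge0.
have V0 i j : 0 <= V i j by exact: normc_ge0.
have double (f : nat -> R) (l : R) : f @ \oo --> l -> (fun N => f (N + N)%N) @ \oo --> l.
  move=> hf; apply: cvg_comp hf; apply/cvgnyPge => k; exists k => // n /= kn.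
  by rewrite (leq_trans kn) ?leq_addr.
have cvU : cvgn (square_sum U).
  apply: (@square_sum_cvg _ M) => N; apply: le_trans (hu N).
  by apply: square_sum_le => i j; rewrite ger0_norm.
have cvV : cvgn (square_sum V).
  apply: (@square_sum_cvg _ M') => N; apply: le_trans (hv N).
  by apply: square_sum_le => i j; rewrite ger0_norm.
have gap N : normc (square_sum (cauchy u v) (N + N) -
    square_sum u (N + N) * square_sum v (N + N)) <=
    square_sum U (N + N) * square_sum V (N + N) - square_sum U N * square_sum V N.
  have -> : square_sum U N * square_sum V N = \sum_(k < N + N) \sum_(i < N + N)
      \sum_(l < N + N) \sum_(j < N + N)
      if [&& k < N, i < N, l < N & j < N]%N then U k l * V i j else 0.
    have widen (F : nat -> R) :
        \sum_(k < N) F k = \sum_(k < N + N) if (k < N)%N then F k else 0.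
      rewrite -big_mkcond /= (big_ord_widen_cond (N + N) predT F) ?leq_addr //.
    rewrite square_sumM (widen (fun k => \sum_(i < N) \sum_(l < N) \sum_(j < N)
      U k l * V i j)); apply: eq_bigr => k _; case: ifP => kN /=; last first.
      by rewrite big1 // => i _; rewrite big1 // => l _; rewrite big1.
    rewrite (widen (fun i => \sum_(l < N) \sum_(j < N) U k l * V i j)).
    apply: eq_bigr => i _; case: ifP => iN /=; last first.
      by rewrite big1 // => l _; rewrite big1.
    rewrite (widen (fun l => \sum_(j < N) U k l * V i j)).
    apply: eq_bigr => l _; case: ifP => lN /=; last by rewrite big1.
    exact: (widen (fun j => U k l * V i j)).
  rewrite square_sum_cauchy !square_sumM.
  rewrite -!sumrB; apply: le_trans (ler_normc_sum _ _ _) _; apply: ler_sum => k _.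
  rewrite -!sumrB; apply: le_trans (ler_normc_sum _ _ _) _; apply: ler_sum => i _.
  rewrite -!sumrB; apply: le_trans (ler_normc_sum _ _ _) _; apply: ler_sum => l _.
  rewrite -!sumrB; apply: le_trans (ler_normc_sum _ _ _) _; apply: ler_sum => j _.
  have UV : normc (u k l * v i j) = U k l * V i j by exact: ComplexField.Normc.normcM.
  case: ifP => [_|h]; rewrite ?subrr ?sub0r ?normcN ?ComplexField.Normc.normc0 ?UV.
    by case: ifP => _; rewrite ?subrr ?subr0 ?mulr_ge0.
  rewrite ifF ?subr0 //; apply/negP => /and4P[h1 h2 h3 h4].
  by move/negP: h; apply; rewrite -!addnS !leq_add // ltnW.
have prod0 : (fun N => normc (square_sum u N * square_sum v N - csum u * csum v))
    @ \oo --> 0.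
  apply: (cvgn0_le (cvgn0D (cvgn0M M' (csum_cvg hu))
    (cvgn0M (normc (csum u)) (csum_cvg hv)))) => N.
  rewrite normc_ge0 /= (mulrC M').
  have -> : square_sum u N * square_sum v N - csum u * csum v =
    (square_sum u N - csum u) * square_sum v N +
    csum u * (square_sum v N - csum v) by ring.
  apply: le_trans (normcD _ _) _; rewrite !ComplexField.Normc.normcM lerD2r.
  rewrite ler_wpM2l ?normc_ge0 //; apply: le_trans (hv N).
  apply: le_trans (ler_normc_sum _ _ _) _.
  by apply: ler_sum => i _; exact: ler_normc_sum.
have gap0 : (fun N => square_sum U (N + N) * square_sum V (N + N) -
    square_sum U N * square_sum V N) @ \oo --> 0.
  have h : (fun N => square_sum U N * square_sum V N) @ \oo -->
      limn (square_sum U) * limn (square_sum V) by apply: cvgM.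
  rewrite -(subrr (limn (square_sum U) * limn (square_sum V))).
  by apply: cvgB => //; exact: double h.
have h1 := double _ _ (csum_cvg huv); have h2 := double _ _ prod0.
apply/eqP; rewrite -subr_eq0 -normc_eq0 eq_le normc_ge0 andbT.
apply: (cvgn_ge (cvgn0D (cvgn0D h1 gap0) h2)) => N; rewrite (normcB _ (csum (cauchy u v))).
set a := csum (cauchy u v); set b := square_sum (cauchy u v) (N + N).
set p := square_sum u (N + N) * square_sum v (N + N).
have -> : a - csum u * csum v = (a - b) + (b - p) + (p - csum u * csum v) by ring.
apply: le_trans (normcD _ _) _; rewrite lerD2r.
by apply: le_trans (normcD _ _) _; rewrite lerD2l; exact: gap.
Qed.

End ComplexSums.

(** * Power families and quantitative holomorphy *)

Section PowerFamilies.
Variable R : realType.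
Implicit Types (u v z : R[i]) (c : nat -> nat -> R[i]) (n : nat -> nat -> nat).

Lemma normcM z u : normc (z * u) = normc z * normc u.
Proof. exact: ComplexField.Normc.normcM. Qed.

Lemma absc_normc z : `|z| = (normc z)%:C%C.
Proof. by case: z. Qed.

Lemma normc_nat k : normc (k%:R : R[i]) = k%:R.
Proof. by rewrite -(rmorph_nat (real_complex R)) normcr ger0_norm. Qed.

Lemma normc_exp_le1 u k : normc u <= 1 -> normc (u ^+ k) <= 1.
Proof. by move=> h; rewrite normcX exprn_ile1 // normc_ge0. Qed.

Lemma exprn_lipschitz u v k : normc u <= 1 -> normc v <= 1 ->
  normc (u ^+ k - v ^+ k) <= k%:R * normc (u - v).
Proof.
move=> hu hv; elim: k => [|k IH].
  by rewrite !expr0 subrr ComplexField.Normc.normc0 mul0r.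
have -> : u ^+ k.+1 - v ^+ k.+1 = u * (u ^+ k - v ^+ k) + (u - v) * v ^+ k.
  by rewrite !exprS; ring.
apply: le_trans (normcD _ _) _; rewrite !normcM -natr1 mulrDl mul1r lerD //.
  by apply: le_trans IH; rewrite ler_piMl // normc_ge0.
by rewrite ler_piMr ?normc_ge0 // normc_exp_le1.
Qed.

Lemma exprn_quadratic u v k : normc u <= 1 -> normc v <= 1 ->
  normc (u ^+ k - v ^+ k - k%:R * v ^+ k.-1 * (u - v)) <=
  k%:R ^+ 2 * normc (u - v) ^+ 2.
Proof.
move=> hu hv; elim: k => [|k IH].
  by rewrite !expr0 subrr mul0r mul0r subr0 ComplexField.Normc.normc0 expr0n mul0r.
have -> : u ^+ k.+1 - v ^+ k.+1 - k.+1%:R * v ^+ k.+1.-1 * (u - v) =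
    u * (u ^+ k - v ^+ k - k%:R * v ^+ k.-1 * (u - v)) +
    k%:R * v ^+ k.-1 * (u - v) ^+ 2.
  case: k {IH} => [|k] /=; first by rewrite !expr0 !expr1; ring.
  by rewrite -[k.+2%:R]natr1 -[k.+1%:R]natr1 !exprS; ring.
apply: le_trans (normcD _ _) _; rewrite (normcM u) (normcM _ ((u - v) ^+ 2)) (normcM k%:R) normc_nat.
rewrite [normc ((u - v) ^+ 2)]normcX.
apply: (@le_trans _ _ ((k%:R ^+ 2 + k%:R) * normc (u - v) ^+ 2)).
  rewrite mulrDl lerD //.
    by apply: le_trans IH; rewrite ler_piMl // normc_ge0.
  by rewrite -mulrA ler_wpM2l // ler_piMl ?sqr_ge0 // normc_exp_le1.
rewrite ler_wpM2r ?sqr_ge0 // -natr1; have k0 := ler0n R k.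
by rewrite sqrrD1 -addrA lerD2l mulr2n -addrA lerDl addr_ge0.
Qed.

Definition weight_bound (w : nat -> nat -> R) c (L : nat) (M : R) :=
  forall N, square_sum (fun i j => normc (c i j) * (w i j) ^+ L) N <= M.

Definition hol c n u : R[i] := csum (fun i j => c i j * u ^+ n i j).

Definition wt n : nat -> nat -> R := fun i j => (n i j).+1%:R.

Lemma weight_ge1 n i j : 1 <= (n i j).+1%:R :> R.
Proof. by rewrite ler1n. Qed.

Lemma weight_bound_le (w : nat -> nat -> R) c L L' M : (forall i j, 1 <= w i j) ->
  weight_bound w c L' M -> (L <= L')%N -> weight_bound w c L M.
Proof.
move=> w1 h LL N; apply: le_trans (h N); apply: square_sum_le => i j.
by rewrite ler_wpM2l ?normc_ge0 // ler_weXn2l.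
Qed.

Lemma summable_hol c n M u : weight_bound (wt n) c 0 M -> normc u <= 1 ->
  summable_by (fun i j => c i j * u ^+ n i j) M.
Proof.
move=> h hu N; apply: le_trans (h N); apply: square_sum_le => i j.
by rewrite normcM expr0 ler_wpM2l ?normc_ge0 // normc_exp_le1.
Qed.

Lemma hol_le c n M u : weight_bound (wt n) c 0 M -> normc u <= 1 ->
  normc (hol c n u) <= M.
Proof. by move=> h hu; apply: normc_csum_le; exact: summable_hol. Qed.

Lemma hol_lipschitz c n M u v : weight_bound (wt n) c 1 M ->
  normc u <= 1 -> normc v <= 1 ->
  normc (hol c n u - hol c n v) <= M * normc (u - v).
Proof.
move=> h hu hv; have h0 := weight_bound_le (weight_ge1 n) h (leq0n 1).
rewrite /hol -(csumB (summable_hol h0 hu) (summable_hol h0 hv)).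
apply: normc_csum_le => N.
apply: le_trans (ler_wpM2r (normc_ge0 (u - v)) (h N)).
rewrite mulrC -square_sumZ; apply: square_sum_le => i j; rewrite !fctE -mulrBr.
rewrite normcM mulrCA ler_wpM2l ?normc_ge0 //.
rewrite [leRHS]mulrC expr1; apply: le_trans (exprn_lipschitz _ hu hv) _.
by rewrite ler_wpM2r ?normc_ge0 // ler_nat.
Qed.

Definition dcoef c n : nat -> nat -> R[i] := fun i j => (n i j)%:R * c i j.

Lemma weight_dcoef c n L M : weight_bound (wt n) c L.+1 M ->
  weight_bound (wt (fun i j => (n i j).-1)) (dcoef c n) L M.
Proof.
move=> h N; apply: le_trans (h N); apply: square_sum_le => i j.
rewrite /dcoef /wt normcM normc_nat (mulrC (n i j)%:R) -mulrA.
rewrite ler_wpM2l ?normc_ge0 // exprS; case: (n i j) => [|k] /=.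
  by rewrite mul0r mulr_ge0 // exprn_ge0.
rewrite ler_pM // ?exprn_ge0 // ?ler_nat //.
by rewrite lerXn2r ?nnegrE // ler_nat.
Qed.

(** Two factors of the weight pay for the second differences of the powers. *)
Lemma hol_quadratic c n M u v : weight_bound (wt n) c 2 M ->
  normc u <= 1 -> normc v <= 1 ->
  normc (hol c n u - hol c n v -
         hol (dcoef c n) (fun i j => (n i j).-1) v * (u - v)) <=
  M * normc (u - v) ^+ 2.
Proof.
move=> h hu hv; have h0 := weight_bound_le (weight_ge1 n) h (leq0n 2).
have h1 := weight_dcoef (weight_bound_le (weight_ge1 n) h (leqnSn 1)).
have su := summable_hol h0 hu; have sv := summable_hol h0 hv.
have s1 := summable_hol h1 hv.
rewrite mulrC /hol -(csumZ _ s1) -(csumB su sv).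
rewrite -(csumB (summable_byD su (summable_byN sv)) (summable_byZ (u - v) s1)).
apply: normc_csum_le => N.
apply: le_trans (ler_wpM2r (sqr_ge0 (normc (u - v))) (h N)).
rewrite mulrC -square_sumZ; apply: square_sum_le => i j.
have -> : ((fun i j => c i j * u ^+ n i j) - (fun i j => c i j * v ^+ n i j) -
    (fun i j => (u - v) * (dcoef c n i j * v ^+ (n i j).-1))) i j =
    c i j * (u ^+ n i j - v ^+ n i j - (n i j)%:R * v ^+ (n i j).-1 * (u - v)).
  by rewrite !fctE /dcoef; ring.
rewrite normcM mulrCA ler_wpM2l ?normc_ge0 // [leRHS]mulrC.
apply: le_trans (exprn_quadratic _ hu hv) _.
by rewrite ler_wpM2r ?sqr_ge0 // lerXn2r ?nnegrE // ler_nat.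
Qed.

End PowerFamilies.

Section PolyGeom.
Variable R : realType.

Lemma geom_bound1 (q : R) k : 0 <= q < 1 -> k.+1%:R * q ^+ k <= (1 - q)^-1.
Proof.
move=> /andP[q0 q1]; have d0 : 0 < 1 - q by rewrite subr_gt0.
rewrite -[leRHS]mul1r ler_pdivlMr //.
suff : k.+1%:R * q ^+ k * (1 - q) <= 1 - q ^+ k.+1.
  by move=> /le_trans; apply; rewrite lerBlDr lerDl exprn_ge0.
elim: k => [|k IH]; first by rewrite expr0 expr1 !mul1r.
have -> : k.+2%:R * q ^+ k.+1 * (1 - q) =
    q * (k.+1%:R * q ^+ k * (1 - q)) + q ^+ k.+1 * (1 - q).
  by rewrite -[k.+2%:R]natr1 exprS; ring.
have h1 := ler_wpM2l q0 IH.
have h2 : q ^+ k.+1 <= 1 by rewrite exprn_ile1 // ltW.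
have h3 : q ^+ k.+1 * (1 - q) <= 1 - q by rewrite ler_piMl // ltW.
apply: le_trans (lerD h1 h3) _; rewrite mulrBr mulr1 -exprS.
by lra.
Qed.

(** Geometric decay beats any power: split [q] as the square of its root. *)
Lemma poly_geom_bounded L (q : R) : 0 <= q < 1 ->
  exists2 C : R, 0 <= C & forall k, k.+1%:R ^+ L * q ^+ k <= C.
Proof.
elim: L q => [|L IH] q /andP[q0 q1].
  by exists 1 => // k; rewrite expr0 mul1r exprn_ile1 // ltW.
have s0 : 0 <= Num.sqrt q by exact: sqrtr_ge0.
have s1 : Num.sqrt q < 1 by rewrite -sqrtr1 ltr_sqrt.
have [C C0 hC] := IH (Num.sqrt q) (introT andP (conj s0 s1)).
exists (C * (1 - Num.sqrt q)^-1).
  by rewrite mulr_ge0 // invr_ge0 subr_ge0 ltW.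
move=> k; have -> : q ^+ k = Num.sqrt q ^+ k * Num.sqrt q ^+ k.
  by rewrite -exprMn -expr2 sqr_sqrtr.
rewrite exprSr mulrACA ler_pM ?mulr_ge0 ?exprn_ge0 //.
by apply: geom_bound1; rewrite s0.
Qed.

End PolyGeom.

Section C11.
Variable R : realType.
Implicit Types (z v w : R[i]) (f g : R[i] -> R[i]).

(** Holomorphy at [z] with derivative [f'], quantitatively: the quadratic
    remainder estimate is uniform near [z], and it makes [f'] Lipschitz. *)
Definition C11 f f' z := exists K eta : R, 0 < eta /\ 0 <= K /\
  forall v w, normc (v - z) < eta -> normc (w - z) < eta ->
    normc (f w - f v - f' v * (w - v)) <= K * normc (w - v) ^+ 2.

(** Exchanging the two points in the quadratic estimate and adding bounds the
    variation of the derivative. *)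
Lemma C11_lipschitz f f' z : C11 f f' z -> exists L eta : R, 0 < eta /\ 0 <= L /\
  forall v w, normc (v - z) < eta -> normc (w - z) < eta ->
    [/\ normc (f w - f v - f' v * (w - v)) <= L * normc (w - v) ^+ 2,
        normc (f w - f v) <= L * normc (w - v),
        normc (f' w - f' v) <= L * normc (w - v),
        normc (f v) <= L & normc (f' v) <= L].
Proof.
move=> [K [eta [e0 [K0 h]]]].
have n0 := @normc_ge0 R.
have ball2 v w : normc (v - z) < eta -> normc (w - z) < eta ->
    normc (w - v) <= 2 * eta.
  move=> hv hw; rewrite -(subrKA z); apply: le_trans (normcD _ _) _.
  by rewrite (normcB z); lra.
have lip' v w : normc (v - z) < eta -> normc (w - z) < eta ->
    normc (f' w - f' v) <= 2 * K * normc (w - v).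
  move=> hv hw; case: (eqVneq w v) => [->|wv].
    by rewrite !subrr ComplexField.Normc.normc0 mulr0.
  have p0 : 0 < normc (w - v) by rewrite lt_def n0 normc_eq0 subr_eq0 wv.
  rewrite -(ler_pM2r p0) -normcM.
  have -> : (f' w - f' v) * (w - v) = (f w - f v - f' v * (w - v)) +
      (f v - f w - f' w * (v - w)) by ring.
  apply: le_trans (normcD _ _) _; have h1 := h _ _ hv hw; have h2 := h _ _ hw hv.
  rewrite (normcB v w) in h2; apply: le_trans (lerD h1 h2) _.
  by rewrite le_eqVlt; apply/orP; left; apply/eqP; ring.
have z0 : normc (z - z) < eta by rewrite subrr ComplexField.Normc.normc0.
pose B := normc (f' z) + 2 * K * (2 * eta).
have B0 : 0 <= B by rewrite addr_ge0 // !mulr_ge0 // ltW.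
have bd v : normc (v - z) < eta -> normc (f' v) <= B.
  move=> hv; rewrite -[f' v](subrK (f' z)); apply: le_trans (normcD _ _) _.
  rewrite addrC lerD2l; apply: le_trans (lip' _ _ z0 hv) _.
  by rewrite ler_wpM2l ?mulr_ge0 //; exact: ball2.
pose Lf := B + K * (2 * eta).
have Lf0 : 0 <= Lf by rewrite addr_ge0 // !mulr_ge0 // ltW.
have lipf v w : normc (v - z) < eta -> normc (w - z) < eta ->
    normc (f w - f v) <= Lf * normc (w - v).
  move=> hv hw.
  rewrite -[f w - f v](subrK (f' v * (w - v))); apply: le_trans (normcD _ _) _.
  rewrite addrC mulrDl normcM lerD ?ler_wpM2r // ?bd //.
  apply: le_trans (h _ _ hv hw) _; rewrite -mulrA ler_wpM2l // expr2.
  by rewrite ler_wpM2r // ball2.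
pose M := normc (f z) + Lf * (2 * eta).
have M0 : 0 <= M by rewrite addr_ge0 // !mulr_ge0 // ltW.
have bdf v : normc (v - z) < eta -> normc (f v) <= M.
  move=> hv; rewrite -[f v](subrK (f z)); apply: le_trans (normcD _ _) _.
  rewrite addrC lerD2l; apply: le_trans (lipf _ _ z0 hv) _.
  by rewrite ler_wpM2l //; exact: ball2.
clearbody M; clearbody Lf; clearbody B.
exists (K + Lf + 2 * K + M + B), eta; split => //.
have K2 : 0 <= 2 * K by rewrite mulr_ge0.
have L0 : 0 <= K + Lf + 2 * K + M + B by rewrite !addr_ge0.
split => // v w hv hw; split.
- by apply: le_trans (h _ _ hv hw) _; rewrite ler_wpM2r ?sqr_ge0 //; lra.
- by apply: le_trans (lipf _ _ hv hw) _; rewrite ler_wpM2r //; lra.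
- by apply: le_trans (lip' _ _ hv hw) _; rewrite ler_wpM2r //; lra.
- by apply: le_trans (bdf _ hv) _; lra.
- by apply: le_trans (bd _ hv) _; lra.
Qed.

Lemma C11_ext f f' g g' z : C11 f f' z ->
  (exists2 eta : R, 0 < eta & forall v, normc (v - z) < eta ->
    f v = g v /\ f' v = g' v) -> C11 g g' z.
Proof.
move=> [K [eta [e0 [K0 h]]]] [eta' e0' fg].
exists K, (Num.min eta eta'); rewrite lt_min e0 e0'; split=> //; split=> // v w.
rewrite !lt_min => /andP[v1 v2] /andP[w1 w2].
have [<- <-] := fg _ v2; have [<- _] := fg _ w2; exact: h.
Qed.

Lemma C11_cst (c : R[i]) z : C11 (fun=> c) (fun=> 0) z.
Proof.
exists 0, 1; split => //; split => // v w _ _.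
by rewrite subrr mul0r subrr ComplexField.Normc.normc0 mul0r.
Qed.

Lemma C11_id z : C11 id (fun=> 1) z.
Proof.
exists 0, 1; split => //; split => // v w _ _.
by rewrite mul1r subrr ComplexField.Normc.normc0 mul0r.
Qed.

Lemma C11_add f f' g g' z : C11 f f' z -> C11 g g' z ->
  C11 (fun v => f v + g v) (fun v => f' v + g' v) z.
Proof.
move=> [K [eta [e0 [K0 h]]]] [K' [eta' [e0' [K0' h']]]].
exists (K + K'), (Num.min eta eta'); rewrite lt_min e0 e0'; split=> //.
split=> [|v w]; first by rewrite addr_ge0.
rewrite !lt_min => /andP[v1 v2] /andP[w1 w2].
have -> : f w + g w - (f v + g v) - (f' v + g' v) * (w - v) =
  (f w - f v - f' v * (w - v)) + (g w - g v - g' v * (w - v)) by ring.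
apply: le_trans (normcD _ _) _; rewrite mulrDl; apply: lerD; [exact: h|exact: h'].
Qed.

Lemma C11_mul f f' g g' z : C11 f f' z -> C11 g g' z ->
  C11 (fun v => f v * g v) (fun v => f' v * g v + f v * g' v) z.
Proof.
move=> /C11_lipschitz[K [eta [e0 [K0 h]]]] /C11_lipschitz[K' [eta' [e0' [K0' h']]]].
exists (K * K' + K * K' + K * K'), (Num.min eta eta'); rewrite lt_min e0 e0'; split=> //.
split=> [|v w]; first by rewrite !addr_ge0 // mulr_ge0.
rewrite !lt_min => /andP[v1 v2] /andP[w1 w2].
have -> : f w * g w - f v * g v - (f' v * g v + f v * g' v) * (w - v) =
  (f w - f v - f' v * (w - v)) * g w + f' v * (w - v) * (g w - g v) +
  f v * (g w - g v - g' v * (w - v)) by ring.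
have [a1 a2 a3 a4 a5] := h _ _ v1 w1; have [b1 b2 b3 b4 b5] := h' _ _ v2 w2.
have [_ _ _ b6 _] := h' _ _ w2 v2.
have n0 := @normc_ge0 R.
apply: le_trans (normcD _ _) _; rewrite [leRHS]mulrDl lerD //; last first.
  by rewrite normcM -mulrA ler_pM.
apply: le_trans (normcD _ _) _; rewrite [leRHS]mulrDl lerD //.
  by rewrite normcM mulrAC ler_pM.
by rewrite !normcM expr2 mulrACA ler_pM ?mulr_ge0 // ler_wpM2r.
Qed.

Lemma C11_comp f f' g g' z : C11 f f' z -> C11 g g' (f z) ->
  C11 (fun v => g (f v)) (fun v => g' (f v) * f' v) z.
Proof.
move=> /C11_lipschitz[K [eta [e0 [K0 h]]]] /C11_lipschitz[K' [eta' [e0' [K0' h']]]].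
have n0 := @normc_ge0 R.
have K1 : 0 < K + 1 by rewrite ltr_wpDl.
have q0 : 0 < eta' / (K + 1) by rewrite divr_gt0.
exists (K' * K ^+ 2 + K' * K), (Num.min eta (eta' / (K + 1))).
rewrite lt_min e0 q0; split=> //.
split=> [|v w]; first by rewrite addr_ge0 ?mulr_ge0 ?sqr_ge0.
rewrite !lt_min => /andP[v1 v2] /andP[w1 w2].
have z0 : normc (z - z) < eta by rewrite subrr ComplexField.Normc.normc0.
have near v' : normc (v' - z) < eta -> normc (v' - z) < eta' / (K + 1) ->
    normc (f v' - f z) < eta'.
  move=> p1 p2; have [_ p3 _ _ _] := h _ _ z0 p1.
  apply: le_lt_trans p3 _; rewrite ltr_pdivlMr // in p2.
  by apply: le_lt_trans p2; rewrite mulrC ler_wpM2l // lerDl.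
have [a1 a2 a3 a4 a5] := h _ _ v1 w1.
have [b1 b2 b3 b4 b5] := h' _ _ (near _ v1 v2) (near _ w1 w2).
have -> : g (f w) - g (f v) - g' (f v) * f' v * (w - v) =
  (g (f w) - g (f v) - g' (f v) * (f w - f v)) +
  g' (f v) * (f w - f v - f' v * (w - v)) by ring.
apply: le_trans (normcD _ _) _; rewrite mulrDl lerD //.
  apply: le_trans b1 _; rewrite -mulrA -exprMn ler_wpM2l //.
  by rewrite lerXn2r ?nnegrE ?mulr_ge0.
by rewrite normcM -mulrA ler_pM.
Qed.

Lemma C11_invr z : z != 0 -> C11 (fun v => v^-1) (fun v => - v ^- 2) z.
Proof.
move=> z0; have p0 : 0 < normc z by rewrite lt_def normc_eq0 z0 normc_ge0.
have n0 := @normc_ge0 R.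
have half v : normc (v - z) < normc z / 2 -> normc z / 2 <= normc v.
  move=> hv; have := normcD v (z - v); rewrite addrC subrK (normcB z) => h.
  by lra.
have q0 : 0 < normc z / 2 by rewrite divr_gt0.
exists ((normc z / 2) ^- 3), (normc z / 2); split=> //.
split=> [|v w hv hw]; first by rewrite invr_ge0 exprn_ge0 // ltW.
have vn := lt_le_trans q0 (half _ hv); have wn := lt_le_trans q0 (half _ hw).
have v0 : v != 0 by rewrite -normc_eq0 gt_eqF.
have w0 : w != 0 by rewrite -normc_eq0 gt_eqF.
have -> : w^-1 - v^-1 - - v ^- 2 * (w - v) = (v ^+ 2 * w)^-1 * (w - v) ^+ 2.
  by field; rewrite v0 w0.
rewrite normcM normcX ler_wpM2r ?sqr_ge0 // ComplexField.Normc.normcV.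
rewrite lef_pV2 ?posrE ?exprn_gt0 //; last first.
  by rewrite normcM normcX mulr_gt0 ?exprn_gt0.
rewrite normcM normcX exprSr ler_pM ?exprn_ge0 ?(ltW q0) ?half //.
by rewrite lerXn2r ?nnegrE ?(ltW q0) ?n0 ?half.
Qed.

Lemma C11_inv f f' z : C11 f f' z -> f z != 0 ->
  C11 (fun v => (f v)^-1) (fun v => - f v ^- 2 * f' v) z.
Proof. by move=> hf f0; exact: (C11_comp hf (C11_invr f0)). Qed.

(** The Lipschitz bound turns the quadratic estimate for [f] into one for [g]. *)
Lemma C11_right_inverse f f' g z (L : R) : 0 <= L ->
  (exists2 eta : R, 0 < eta & forall v w, normc (v - z) < eta ->
     normc (w - z) < eta -> normc (g w - g v) <= L * normc (w - v) /\ f (g v) = v) ->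
  C11 f f' (g z) -> f' (g z) != 0 ->
  C11 g (fun v => (f' (g v))^-1) z.
Proof.
move=> L0 [eta e0 hg] /C11_lipschitz[K [eta' [e0' [K0 h]]]] f0.
have n0 := @normc_ge0 R.
pose b := normc (f' (g z)).
have b0 : 0 < b by rewrite lt_def normc_eq0 f0 n0.
pose d := Num.min eta' (b / 2 / (K + 1)).
have K1 : 0 < K + 1 by rewrite ltr_wpDl.
have d0 : 0 < d by rewrite lt_min e0' !divr_gt0.
have L1 : 0 < L + 1 by rewrite ltr_wpDl.
exists (K * L ^+ 2 * 2 / b), (Num.min eta (d / (L + 1))).
rewrite lt_min e0 divr_gt0 //; split=> //.
split=> [|v w]; first by rewrite !mulr_ge0 ?sqr_ge0 // invr_ge0 ltW.
rewrite !lt_min => /andP[v1 v2] /andP[w1 w2].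
have z0 : normc (z - z) < eta by rewrite subrr ComplexField.Normc.normc0.
have z0' : normc (g z - g z) < eta' by rewrite subrr ComplexField.Normc.normc0.
have near v' : normc (v' - z) < eta -> normc (v' - z) < d / (L + 1) ->
    normc (g v' - g z) < d.
  move=> p1 p2; have [p3 _] := hg _ _ z0 p1.
  apply: le_lt_trans p3 _; rewrite ltr_pdivlMr // in p2.
  by apply: le_lt_trans p2; rewrite mulrC ler_wpM2l // lerDl.
have vd := near _ v1 v2; have wd := near _ w1 w2.
have [vd' vd2] : normc (g v - g z) < eta' /\ normc (g v - g z) < b / 2 / (K + 1).
  by move: vd; rewrite lt_min => /andP.
have wd' : normc (g w - g z) < eta' by move: wd; rewrite lt_min => /andP[].
have low : b / 2 <= normc (f' (g v)).
  have [_ _ p _ _] := h _ _ z0' vd'.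
  have p2 : normc (f' (g v) - f' (g z)) <= b / 2.
    apply: le_trans p _; rewrite ltr_pdivlMr // in vd2.
    by apply: le_trans (ltW vd2); rewrite mulrC ler_wpM2l // lerDl.
  have := normcD (f' (g v)) (f' (g z) - f' (g v)).
  by rewrite addrC subrK (normcB (f' (g z))) -/b => ?; lra.
have fv0 : f' (g v) != 0.
  by rewrite -normc_eq0 gt_eqF // (lt_le_trans _ low) // divr_gt0.
have [p1 fgv] := hg _ _ v1 w1; have [_ fgw] := hg _ _ w1 v1.
have -> : g w - g v - (f' (g v))^-1 * (w - v) =
  - (f' (g v))^-1 * (f (g w) - f (g v) - f' (g v) * (g w - g v)).
  by rewrite fgv fgw; field.
rewrite normcM normcN ComplexField.Normc.normcV.
have [q _ _ _ _] := h _ _ vd' wd'.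
rewrite mulrC ler_pdivrMr; last by rewrite (lt_le_trans _ low) // divr_gt0.
apply: le_trans q _; apply: (@le_trans _ _ (K * (L * normc (w - v)) ^+ 2)).
  by rewrite ler_wpM2l // lerXn2r ?nnegrE ?mulr_ge0.
have -> : K * (L * normc (w - v)) ^+ 2 =
   K * L ^+ 2 * 2 / b * normc (w - v) ^+ 2 * (b / 2) by field; rewrite gt_eqF.
by rewrite ler_wpM2l // !mulr_ge0 ?sqr_ge0 // invr_ge0 ltW.
Qed.

Lemma C11_hol c n M z : weight_bound (wt R n) c 2 M -> normc z < 1 ->
  C11 (hol c n) (hol (dcoef c n) (fun i j => (n i j).-1)) z.
Proof.
move=> h z1; exists M, (1 - normc z); rewrite subr_gt0; split => //.
have M0 : 0 <= M by have := h 0%N; rewrite /square_sum big_ord0.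
have near v : normc (v - z) < 1 - normc z -> normc v <= 1.
  move=> hv; have := normcD (v - z) z; rewrite subrK => /le_trans; apply.
  by rewrite ltW // -ltrBrDr.
split=> // v w hv hw; apply: hol_quadratic => //; exact: near.
Qed.

Lemma C11_derivable f f' z : C11 f f' z -> derivable (f : R[i]^o -> R[i]^o) z 1.
Proof.
move=> [K [eta [e0 [K0 h]]]].
apply/cvg_ex; exists (f' z : R[i]^o).
apply/cvgrPdist_lt => eps eps0.
have re : 0 < cRe eps by move: eps0; rewrite ltcE => /andP[].
have epsE : eps = (cRe eps)%:C%C.
  by move: eps0; rewrite ltcE => /andP[]; case: eps {re} => a b /= /eqP -> _.
pose d := Num.min eta (cRe eps / (K + 1)).
have K1 : 0 < K + 1 by rewrite ltr_wpDl.
have d0 : 0 < d by rewrite lt_min e0 divr_gt0.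
exists d%:C%C => /=; first by rewrite ltcR.
move=> t /=; rewrite sub0r normrN => td t0.
rewrite absc_normc ltcR in td; have := td; rewrite lt_min => /andP[nt1 nt2].
have := h z (t + z); rewrite subrr ComplexField.Normc.normc0 addrK => /(_ e0 nt1) q.
rewrite epsE absc_normc ltcR.
have -> : f' z - t^-1 *: (f (t%:A + z) - f z) =
    - (t^-1 * (f (t + z) - f z - f' z * t)).
  rewrite (_ : t%:A = t :> R[i]); last exact: mulr1.
  rewrite /GRing.scale /=.
  by field.
have p0 : 0 < normc t by rewrite lt_def normc_eq0 t0 normc_ge0.
rewrite normcN normcM ComplexField.Normc.normcV mulrC ltr_pdivrMr //.
apply: le_lt_trans q _; rewrite expr2 mulrA ltr_pM2r //.
rewrite ltr_pdivlMr // in nt2; apply: le_lt_trans nt2.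
by rewrite mulrC ler_wpM2l ?normc_ge0 // lerDl.
Qed.

End C11.

(** * Trigonometric series and their Hoelder norms *)

Section Expi.
Variable R : realType.
Implicit Types (x y t : R) (z : R[i]).

Lemma normc_expi x : normc (expi x) = 1.
Proof. by rewrite /= cos2Dsin2 sqrtr1. Qed.

Lemma expiD x y : expi (x + y) = expi x * expi y.
Proof. by rewrite /expi cosD sinD; simpc; congr (_ +i* _)%C; ring. Qed.

Lemma expi0 : expi (0 : R) = 1.
Proof. by rewrite /expi cos0 sin0. Qed.

Lemma expiN x : expi (- x) = ((expi x)^*)%C.
Proof. by rewrite /expi cosN sinN. Qed.

Lemma expi_conjM x : expi x * ((expi x)^*)%C = 1.
Proof. by rewrite -expiN -expiD subrr expi0. Qed.

Lemma expi_neq0 x : expi x != 0.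
Proof. by rewrite -normc_eq0 normc_expi oner_neq0. Qed.

Lemma expi_mulrn x n : expi (n%:R * x) = expi x ^+ n.
Proof.
elim: n => [|n IH]; first by rewrite mul0r expi0 expr0.
by rewrite -natr1 mulrDl mul1r expiD IH exprSr.
Qed.

Lemma MVT_bound (f df : R -> R) t (C : R) : (forall x, is_derive x 1 f (df x)) ->
  (forall x, `|x| <= `|t| -> `|df x| <= C) -> `|f t - f 0| <= C * `|t|.
Proof.
move=> hd hC.
have cf : forall A : set R, {within A, continuous f}.
  move=> A; apply: continuous_subspaceT => x.
  by apply: differentiable_continuous; apply/derivable1_diffP; have [] := hd x.
case: (lerP 0 t) => t0.
  have [c hc ->] := @MVT_segment R f df 0 t t0 (fun x _ => hd x) (cf _).
  rewrite subr0 normrM ler_wpM2r // hC //.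
  by move: hc; rewrite in_itv /= => /andP[c0 ct]; rewrite !ger0_norm.
have [c hc] := @MVT_segment R f df t 0 (ltW t0) (fun x _ => hd x) (cf _).
rewrite sub0r => e; rewrite distrC e normrM normrN ler_wpM2r // hC //.
by move: hc; rewrite in_itv /= => /andP[c0 ct]; rewrite !ler0_norm ?(ltW t0) // lerN2.
Qed.

Lemma sin_lipschitz0 t : `|sin t| <= `|t|.
Proof.
have := @MVT_bound sin cos t 1 (@is_derive_sin R) (fun x _ => cos_max x).
by rewrite sin0 subr0 mul1r.
Qed.

Lemma cos_quadratic0 t : `|cos t - 1| <= `|t| ^+ 2.
Proof.
have := @MVT_bound cos (fun x => - sin x) t `|t| (@is_derive_cos R).
rewrite cos0 expr2; apply=> x xt; rewrite normrN.
exact: le_trans (sin_lipschitz0 x) xt.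
Qed.

Lemma sin_quadratic0 t : `|sin t - t| <= `|t| ^+ 2.
Proof.
have hd x : is_derive x 1 (fun x : R => sin x - x) (cos x - 1).
  exact: is_deriveB.
have := @MVT_bound _ _ t `|t| hd; rewrite sin0 subrr subr0 expr2; apply=> x xt.
have := @MVT_bound cos (fun x => - sin x) x 1 (@is_derive_cos R).
rewrite cos0 mul1r => h; apply: le_trans xt; apply: h => y _.
by rewrite normrN sin_max.
Qed.

Lemma expi_lipschitz x y : normc (expi y - expi x) <= 2 * `|y - x|.
Proof.
have -> : expi y - expi x = expi x * (expi (y - x) - 1).
  by rewrite mulrBr -expiD (addrC x) subrK mulr1.
rewrite normcM normc_expi mul1r; set t := y - x.
apply: le_trans (normc_le_sum _) _; rewrite /= subr0 mulr_natl mulr2n.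
apply: lerD (sin_lipschitz0 t).
have := @MVT_bound cos (fun x => - sin x) t 1 (@is_derive_cos R).
by rewrite cos0 mul1r; apply=> u _; rewrite normrN sin_max.
Qed.

Lemma expi_quadratic x y :
  normc (expi y - expi x - 'i%C * (y - x)%:C%C * expi x) <= 2 * `|y - x| ^+ 2.
Proof.
have -> : expi y - expi x - 'i%C * (y - x)%:C%C * expi x =
    expi x * (expi (y - x) - 1 - 'i%C * (y - x)%:C%C).
  by rewrite !mulrBr -expiD (addrC x) subrK mulr1 [X in _ - X]mulrC.
rewrite normcM normc_expi mul1r; set t := y - x.
apply: le_trans (normc_le_sum _) _; rewrite mulr_natl mulr2n.
have -> : expi t - 1 - 'i%C * t%:C%C = ((cos t - 1) +i* (sin t - t))%C.
  by rewrite /expi; simpc; congr (_ +i* _)%C; ring.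
by apply: lerD; [exact: cos_quadratic0|exact: sin_quadratic0].
Qed.

End Expi.

Section QuadraticDerive.
Variables (R : realType) (W : normedModType R).

Lemma quadratic_is_derive (g : R -> W) (t : R) (d : W) (K : R) :
  (forall s, `|g s - g t - (s - t) *: d| <= K * `|s - t| ^+ 2) ->
  is_derive t 1 g d.
Proof.
move=> h.
have K0 : 0 <= K.
  have e : t + 1 - t = 1 by rewrite addrAC subrr add0r.
  have := h (t + 1); rewrite e normr1 expr1n mulr1.
  exact: le_trans.
have cv : (fun u => u^-1 *: (g (u *: 1 + t) - g t)) @ 0^' --> d.
  apply/cvgrPdist_lt => eps eps0.
  exists (eps / (K + 1)) => /=; first by rewrite divr_gt0 // ltr_wpDl.
  move=> u /=; rewrite sub0r normrN => ud u0.
  have := h (u *: 1 + t); rewrite addrK /GRing.scale /= mulr1 => q.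
  have p0 : 0 < `|u| by rewrite normr_gt0.
  have -> : d - u^-1 *: (g (u + t) - g t) = - (u^-1 *: (g (u + t) - g t - u *: d)).
    by rewrite [in RHS]scalerBr scalerA mulVf // scale1r opprB.
  rewrite normrN normrZ normfV mulrC ltr_pdivrMr //.
  apply: le_lt_trans q _; rewrite expr2 mulrA ltr_pM2r //.
  rewrite ltr_pdivlMr ?ltr_wpDl // in ud; apply: le_lt_trans ud.
  by rewrite mulrC ler_wpM2l // lerDl.
have dg : derivable g t 1 by apply/cvg_ex; exists d; exact: cv.
apply: DeriveDef => //.
by rewrite /derive; exact: cvg_lim cv.
Qed.

End QuadraticDerive.

Section PlaneNorm.
Variable R : realType.
Implicit Types (z : R[i]) (x y : R * R).

Lemma plane_ofD z w : plane_of (z + w) = plane_of z + plane_of w :> R * R.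
Proof. by case: z w => a b [c d]. Qed.

Lemma plane_ofN z : plane_of (- z) = - plane_of z :> R * R.
Proof. by case: z. Qed.

Lemma plane_ofB z w : plane_of (z - w) = plane_of z - plane_of w :> R * R.
Proof. by rewrite plane_ofD plane_ofN. Qed.

Lemma plane_ofZ (a : R) z : plane_of (a%:C%C * z) = a *: plane_of z :> R * R.
Proof. by case: z => b c; rewrite /plane_of /=; simpc. Qed.

Lemma plane_of_norm_le z : `|plane_of z| <= normc z.
Proof. by rewrite prod_normE /= ge_max abs_Re_le abs_Im_le. Qed.

End PlaneNorm.

Section TrigSeries.
Variable R : realType.
Implicit Types (c : nat -> nat -> R[i]) (w W : nat -> nat -> R).

Definition trig w c (t : R) : R * R :=
  plane_of (csum (fun i j => c i j * expi (w i j * t))).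

Definition tderiv w c : nat -> nat -> R[i] := fun i j => 'i%C * (w i j)%:C%C * c i j.

Variables (w W : nat -> nat -> R).
Hypothesis W1 : forall i j, 1 <= W i j.
Hypothesis wW : forall i j, `|w i j| <= W i j.

Lemma summable_trig c M t : weight_bound W c 0 M ->
  summable_by (fun i j => c i j * expi (w i j * t)) M.
Proof.
move=> h N; apply: le_trans (h N); apply: square_sum_le => i j.
by rewrite expr0 mulr1 normcM normc_expi mulr1.
Qed.

Lemma weight_tderiv c L M : weight_bound W c L.+1 M ->
  weight_bound W (tderiv w c) L M.
Proof.
move=> h N; apply: le_trans (h N); apply: square_sum_le => i j.
rewrite /tderiv !normcM normcr [normc 'i%C](_ : _ = 1); last first.
  by rewrite /= expr0n expr1n add0r sqrtr1.
rewrite mul1r (mulrC `|_|) -mulrA ler_wpM2l ?normc_ge0 // exprS.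
by rewrite ler_wpM2r // exprn_ge0 // (le_trans ler01).
Qed.

Lemma trig_le c M t : weight_bound W c 0 M -> `|trig w c t| <= M.
Proof.
move=> h; apply: le_trans (plane_of_norm_le _) _.
by apply: normc_csum_le; exact: summable_trig.
Qed.

Lemma trigB c d M M' t : weight_bound W c 0 M -> weight_bound W d 0 M' ->
  trig w (c - d) t = trig w c t - trig w d t.
Proof.
move=> hc hd; rewrite /trig -plane_ofB.
rewrite -(csumB (summable_trig t hc) (summable_trig t hd)).
congr (plane_of (csum _)); apply/funext => i; apply/funext => j.
by rewrite !fctE mulrBl.
Qed.

Lemma trigZ (x : R) c M t : weight_bound W c 0 M ->
  trig w (fun i j => x%:C%C * c i j) t = x *: trig w c t.
Proof.
move=> hc; rewrite /trig -plane_ofZ -(csumZ _ (summable_trig t hc)).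
congr (plane_of (csum _)); apply/funext => i; apply/funext => j.
by rewrite mulrA.
Qed.

Lemma trig_lipschitz c M s t : weight_bound W c 1 M ->
  `|trig w c s - trig w c t| <= 2 * M * `|s - t|.
Proof.
move=> h; have h0 := weight_bound_le W1 h (leq0n 1).
rewrite /trig -plane_ofB; apply: le_trans (plane_of_norm_le _) _.
rewrite -(csumB (summable_trig s h0) (summable_trig t h0)).
apply: normc_csum_le => N.
rewrite mulrAC; apply: le_trans (ler_wpM2l _ (h N)); last by rewrite mulr_ge0.
rewrite -square_sumZ; apply: square_sum_le => i j; rewrite !fctE -mulrBr normcM.
rewrite mulrCA ler_wpM2l ?normc_ge0 //; apply: le_trans (expi_lipschitz _ _) _.
rewrite -mulrBr normrM -mulrA ler_wpM2l // mulrC expr1.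
by rewrite ler_wpM2l.
Qed.

Lemma trig_is_derive c M (t : R) : weight_bound W c 2 M ->
  is_derive t 1 (trig w c) (trig w (tderiv w c) t).
Proof.
move=> h; have h0 := weight_bound_le W1 h (leq0n 2).
have h1 := weight_tderiv (weight_bound_le W1 h (leqnSn 1)).
apply: (@quadratic_is_derive _ _ _ _ _ (2 * M)) => s.
rewrite /trig -plane_ofB -plane_ofZ -plane_ofB.
apply: le_trans (plane_of_norm_le _) _.
have ss := summable_trig s h0; have st := summable_trig t h0.
have s1 := summable_trig t h1.
rewrite -(csumZ _ s1) -(csumB ss st).
rewrite -(csumB (summable_byD ss (summable_byN st)) (summable_byZ _ s1)).
apply: normc_csum_le => N.
rewrite mulrAC; apply: le_trans (ler_wpM2l _ (h N)); last by rewrite mulr_ge0.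
rewrite -square_sumZ; apply: square_sum_le => i j.
rewrite [X in normc X](_ : _ = c i j * (expi (w i j * s) - expi (w i j * t) -
   'i%C * (w i j * s - w i j * t)%:C%C * expi (w i j * t))); last first.
  have -> : (w i j * s - w i j * t)%:C%C = (w i j)%:C%C * (s - t)%:C%C.
    by rewrite -mulrBr rmorphM.
  by rewrite !fctE /tderiv; ring.
rewrite normcM mulrCA ler_wpM2l ?normc_ge0 //; apply: le_trans (expi_quadratic _ _) _.
rewrite -mulrBr normrM -mulrA ler_wpM2l // exprMn mulrC ler_wpM2l ?exprn_ge0 //.
by rewrite lerXn2r ?nnegrE // (le_trans ler01).
Qed.

Lemma derive1_trig c M : weight_bound W c 2 M ->
  derive1 (trig w c) = trig w (tderiv w c).
Proof.
move=> h; apply/funext => t; rewrite derive1E.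
by have [_ ->] := trig_is_derive t h.
Qed.

Lemma iter_tderiv_weight c L M k : weight_bound W c (k + L) M ->
  weight_bound W (iter k (tderiv w) c) L M.
Proof.
elim: k L => [//|k IH] L h /=; apply: weight_tderiv; apply: IH.
by rewrite addnS.
Qed.

Lemma derive1n_trig c L M k : weight_bound W c L M -> (k < L)%N ->
  derive1n k (trig w c) = trig w (iter k (tderiv w) c).
Proof.
move=> h; elim: k => [//|k IH] kL.
rewrite derive1nS IH ?(ltnW kL) //; apply: (@derive1_trig _ M).
apply: iter_tderiv_weight; apply: weight_bound_le h _ => //.
by rewrite addn2.
Qed.

(** The Hoelder quotient is at most the Lipschitz constant for points at distance
    at most one, and twice the supremum for the others. *)
Lemma holder_norm_trig c M k a : 0 < a < 1 -> weight_bound W c k.+2 M ->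
  (holder_norm k a (trig w c) <= ((k%:R + 5) * M)%:E)%E.
Proof.
move=> /andP[a0 a1] h.
have M0 : 0 <= M by have := h 0%N; rewrite /square_sum big_ord0.
have sup j : (j < k.+1)%N -> (sup_norm (derive1n j (trig w c)) <= M%:E)%E.
  move=> jk; rewrite (derive1n_trig h) ?(ltn_trans jk) //.
  apply: ub_ereal_sup => _ [t _ <-]; rewrite lee_fin; apply: trig_le.
  apply: iter_tderiv_weight; apply: weight_bound_le h _ => //.
  by rewrite addn0 ltnW // ltnW.
have hk : weight_bound W (iter k (tderiv w) c) 1 M.
  by apply: iter_tderiv_weight; apply: weight_bound_le h _; rewrite ?addn1.
rewrite /holder_norm.
have -> : ((k%:R + 5) * M)%:E = (\sum_(j < k.+1) M%:E + (4 * M)%:E)%E.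
  rewrite sumEFin -EFinD sumr_const card_ord; congr _%:E.
  by rewrite -mulr_natl -natr1; ring.
apply: leeD; first by apply: lee_sum => j _; exact: sup.
rewrite (derive1n_trig h) //; apply: ub_ereal_sup => _ [[s t] /= st <-].
rewrite lee_fin.
have d0 : 0 < `|s - t| by rewrite normr_gt0 subr_eq0.
rewrite ler_pdivrMr ?powR_gt0 //.
case: (lerP `|s - t| 1) => d1.
  apply: le_trans (trig_lipschitz s t hk) _.
  apply: (@le_trans _ _ (2 * M * `|s - t| `^ a)).
    rewrite ler_wpM2l ?mulr_ge0 // -[leLHS]powRr1 ?(ltW d0) //.
    by rewrite ger_powR ?d0 // ltW.
  by rewrite ler_wpM2r ?powR_ge0 // ler_wpM2r // ler_nat.
have h0 := weight_bound_le W1 hk (leq0n 1).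
apply: le_trans (ler_normB _ _) _.
apply: (@le_trans _ _ (2 * M)).
  by rewrite mulr_natl mulr2n; apply: lerD; apply: trig_le.
apply: (@le_trans _ _ (4 * M * 1)).
  by rewrite mulr1 ler_wpM2r // ler_nat.
rewrite ler_wpM2l ?mulr_ge0 // -[leLHS](powRr0 `|s - t|).
by rewrite ler_powR // ltW.
Qed.

End TrigSeries.

(** * Power series in the amplitude with weighted coefficients *)

Section GeometricWeights.
Variable R : realType.
Implicit Types (a c : nat -> nat -> R[i]) (W : nat -> nat -> R).

(** Any fixed power of a weight of linear growth is absorbed by shrinking the
    radius of convergence. *)
Lemma geometric_weight W (C : R) a (r q A : R) L : 0 <= C ->
  (forall i j, 0 <= W i j <= C * (i + j).+1%:R) -> 0 <= q < r ->
  (forall N, square_sum (fun i j => normc (a i j) * r ^+ (i + j)) N <= A) ->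
  exists2 B : R, 0 <= B & forall N,
    square_sum (fun i j => normc (a i j) * W i j ^+ L * q ^+ (i + j)) N <= B.
Proof.
move=> C0 hW /andP[q0 qr] hA; have r0 : 0 < r by exact: le_lt_trans qr.
have qr1 : 0 <= q / r < 1 by rewrite divr_ge0 ?(ltW r0) //= ltr_pdivrMr ?mul1r.
have [P P0 hP] := poly_geom_bounded L qr1.
have A0 : 0 <= A by have := hA 0%N; rewrite /square_sum big_ord0.
exists (C ^+ L * P * A); first by rewrite !mulr_ge0 ?exprn_ge0.
move=> N; apply: le_trans (ler_wpM2l _ (hA N)); last by rewrite mulr_ge0 ?exprn_ge0.
rewrite -square_sumZ; apply: square_sum_le => i j.
have := hW i j; set w := W i j; set n := (i + j)%N => /andP[w0 wn].
have -> : q ^+ n = (q / r) ^+ n * r ^+ n by rewrite -exprMn divfK // gt_eqF.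
rewrite [leRHS]mulrCA -mulrA ler_wpM2l ?normc_ge0 // mulrA ler_wpM2r ?exprn_ge0 ?(ltW r0) //.
apply: (@le_trans _ _ ((C * n.+1%:R) ^+ L * (q / r) ^+ n)).
  rewrite ler_wpM2r ?exprn_ge0 //; first by case/andP: qr1.
  by rewrite lerXn2r ?nnegrE // mulr_ge0.
by rewrite exprMn -mulrA ler_wpM2l ?exprn_ge0.
Qed.

End GeometricWeights.

Section Analyticity.
Variables (R : realType) (E : lmodType R) (X : set E) (N : E -> \bar R).
Variables (T : (nat -> nat -> R[i]) -> E) (W : nat -> nat -> R) (L : nat).
Variables (Q C : R).
Hypothesis T_bound : forall c M, weight_bound W c L M ->
  X (T c) /\ (0 <= N (T c) <= (Q * M)%:E)%E.
Hypothesis T_linear : forall c d M M' (x : R),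
  weight_bound W c L M -> weight_bound W d L M' ->
  T (fun i j => c i j - x%:C%C * d i j) = T c - x *: T d.
Hypothesis C0 : 0 <= C.
Hypothesis hW : forall i j, 0 <= W i j <= C * (i + j).+1%:R.

Definition power_coef (a : nat -> nat -> R[i]) (e : R) : nat -> nat -> R[i] :=
  fun i j => a i j * (e ^+ (i + j))%:C%C.

(** Re-expansion of [e ^+ n] about [e0] by the binomial theorem. *)
Lemma analytic_of_powers a (r A e0 : R) (f : R -> E) :
  (forall k, square_sum (fun i j => normc (a i j) * r ^+ (i + j)) k <= A) ->
  `|e0| < r -> (forall e, `|e| < r -> f e = T (power_coef a e)) ->
  real_analytic_at X N f e0.
Proof.
move=> hA e0r hf.
pose s := (r - `|e0|) / 3.
have s0 : 0 < s by rewrite divr_gt0 // subr_gt0.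
pose q := `|e0| + s; pose q' := `|e0| + 2 * s.
have q0 : 0 <= q by rewrite addr_ge0 // ltW.
have q'0 : 0 < q' by rewrite ltr_wpDl // mulr_gt0.
have qq' : q < q' by rewrite /q /q' ltrD2l ltr_pMl // ltr1n.
have q'r : q' < r.
  have -> : r = `|e0| + 3 * s by rewrite /s mulrC divfK // addrC subrK.
  by rewrite /q' ltrD2l ltr_pM2r // ltr_nat.
have [B B0 hB] := geometric_weight L C0 hW (introT andP (conj (ltW q'0) q'r)) hA.
have binle n p (x : R) : 0 <= x <= s ->
    'C(n, p)%:R * `|e0| ^+ (n - p) * x ^+ p <= (`|e0| + x) ^+ n.
  move=> /andP[x0 _]; rewrite exprDn.
  case: (leqP p n) => pn; last by rewrite bin_small // !mul0r sumr_ge0 // => i _;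
    rewrite mulrn_wge0 // mulr_ge0 // exprn_ge0.
  rewrite (bigD1 (inord p)) //= inordK ?ltnS // -[X in X <= _]addr0.
  apply: lerD; first by rewrite -mulrA mulr_natl.
  by apply: sumr_ge0 => i _; rewrite mulrn_wge0 // mulr_ge0 // exprn_ge0.
pose c p : nat -> nat -> R[i] :=
  fun i j => a i j * ('C(i + j, p)%:R * e0 ^+ (i + j - p))%:C%C.
have hc p : weight_bound W (c p) L (B / s ^+ p).
  move=> k; rewrite ler_pdivlMr ?exprn_gt0 //; apply: le_trans (hB k).
  rewrite mulrC -square_sumZ; apply: square_sum_le => i j.
  rewrite /c normcM normcr normrM normrX ger0_norm //.
  have nW : 0 <= normc (a i j) * W i j ^+ L.
    by rewrite mulr_ge0 ?normc_ge0 // exprn_ge0 //; case/andP: (hW i j).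
  have := ler_wpM2l nW (binle (i + j)%N p s (introT andP (conj (ltW s0) (lexx s)))).
  move=> h; apply: (@le_trans _ _ (normc (a i j) * W i j ^+ L * q ^+ (i + j))).
    apply: le_trans h; rewrite le_eqVlt; apply/orP; left; apply/eqP; ring.
  by rewrite ler_wpM2l // lerXn2r ?nnegrE ?(ltW q'0) // ltW.
exists (T \o c), s, (Q * B); split => //.
  move=> n; have [h1 /andP[h2 h3]] := T_bound (hc n); split => //=.
  apply: (@le_trans _ _ ((Q * (B / s ^+ n))%:E * (s ^+ n)%:E)%E).
    by rewrite lee_wpmul2r // lee_fin exprn_ge0 // ltW.
  by rewrite -EFinM lee_fin -mulrA divfK // gt_eqF // exprn_gt0.
move=> e es; set x := e - e0.
have er : `|e| < r.
  rewrite -(subrK e0 e); apply: le_lt_trans (ler_normD _ _) _.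
  by apply: lt_trans q'r; rewrite /q' addrC ltrD2l (lt_trans es) // ltr_pMl // ltr1n.
pose rem k : nat -> nat -> R[i] := fun i j =>
  a i j * (e ^+ (i + j) - \sum_(p < k) 'C(i + j, p)%:R * e0 ^+ (i + j - p) * x ^+ p)%:C%C.
have xs : `|x| <= s by exact: ltW.
have remb k n : `|e ^+ n - \sum_(p < k) 'C(n, p)%:R * e0 ^+ (n - p) * x ^+ p| <=
    if (k <= n)%N then q ^+ n else 0.
  pose F p := 'C(n, p)%:R * e0 ^+ (n - p) * x ^+ p.
  have en : e ^+ n = \sum_(0 <= p < n.+1) F p.
    rewrite -(subrK e0 e) addrC exprDn big_mkord; apply: eq_bigr => p _.
    by rewrite /F -mulrA mulr_natl.
  rewrite en -(big_mkord xpredT F); case: (leqP k n) => kn; last first.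
    rewrite (@big_cat_nat _ _ _ n.+1 0 k) //= opprD addrA subrr sub0r normrN.
    rewrite big_nat big1 ?normr0 // => p /andP[np _].
    by rewrite /F bin_small // !mul0r.
  rewrite (@big_cat_nat _ _ _ k 0 n.+1) //=; last by rewrite ltnW.
  rewrite addrC addrK; apply: le_trans (ler_norm_sum _ _ _) _.
  apply: (@le_trans _ _ (\sum_(0 <= p < n.+1) `|F p|)).
    rewrite [leRHS](@big_cat_nat _ _ _ k 0 n.+1) //=; last by rewrite ltnW.
    by rewrite lerDr sumr_ge0.
  have -> : \sum_(0 <= p < n.+1) `|F p| = (`|e0| + `|x|) ^+ n.
    rewrite exprDn big_mkord; apply: eq_bigr => p _.
    by rewrite /F !normrM !normrX ger0_norm // -mulrA mulr_natl.
  have x0 : 0 <= `|e0| + `|x| by exact: addr_ge0.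
  by apply: lerXn2r; rewrite ?nnegrE //; rewrite lerD2l.
have hrem k : weight_bound W (rem k) L (B * (q / q') ^+ k).
  move=> K; rewrite mulrC.
  have qk : 0 <= (q / q') ^+ k by rewrite exprn_ge0 // divr_ge0 // ltW.
  apply: le_trans (ler_wpM2l qk (hB K)).
  rewrite -square_sumZ; apply: square_sum_le => i j.
  have nW : 0 <= normc (a i j) * W i j ^+ L.
    by rewrite mulr_ge0 ?normc_ge0 // exprn_ge0 //; case/andP: (hW i j).
  rewrite normcM normcr mulrAC [leRHS]mulrCA ler_wpM2l //.
  apply: le_trans (remb k (i + j)%N) _; case: leqP => kn; last first.
    by rewrite mulr_ge0 // exprn_ge0 // ltW.
  have -> : q ^+ (i + j) = (q / q') ^+ (i + j) * q' ^+ (i + j).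
    by rewrite -exprMn divfK // gt_eqF.
  rewrite ler_wpM2r ?exprn_ge0 ?(ltW q'0) // -(subnK kn) exprD ler_piMl //.
  by rewrite exprn_ile1 ?divr_ge0 ?(ltW q'0) // ler_pdivrMr // mul1r ltW.
have frem k : f e - \sum_(n < k) x ^+ n *: (T \o c) n = T (rem k).
  elim: k => [|k IH].
    rewrite big_ord0 subr0 (hf _ er); apply: (f_equal T); apply/funext => i; apply/funext => j.
    by rewrite /rem big_ord0 subr0.
  rewrite big_ord_recr /= opprD addrA IH -(T_linear _ (hrem k) (hc k)); apply: (f_equal T).
  apply/funext => i; apply/funext => j; rewrite /rem /c big_ord_recr /= opprD addrA.
  set u := e ^+ (i + j) - _; set v := _ * e0 ^+ _; set y := x ^+ k.
  by rewrite [(u - v * y)%:C%C](_ : _ = u%:C%C - v%:C%C * y%:C%C);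
    [ring|rewrite -rmorphM -rmorphB].
have [h1 _] := T_bound (hrem 0%N); have := frem 0%N.
rewrite big_ord0 subr0 => f0; rewrite f0; split => //.
rewrite -f0.
have qq1 : `|q / q'| < 1.
  rewrite ger0_norm ?divr_ge0 ?(ltW q'0) // ltr_pdivrMr // mul1r //.
apply: (@squeeze_cvge _ _ _ _ (fun=> 0%E) _ (fun k => (Q * (B * (q / q') ^+ k))%:E)).
- by apply: nearW => k; rewrite frem; have [] := T_bound (hrem k).
- exact: cvg_cst.
- apply: cvg_EFin; first exact: nearW.
  rewrite -(mulr0 Q) -[in X in _ --> X](mulr0 B).
  by apply: cvgMr; apply: cvgMr; exact: cvg_expr.
Qed.

End Analyticity.

(** * Analytic curves of trigonometric series *)

Lemma power_trade (R : realType) (x q : R) n k : `|x| <= q -> (n <= k)%N ->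
  q ^+ n * `|x| ^+ k <= `|x| ^+ n * q ^+ k.
Proof.
move=> xq nk; have q0 : 0 <= q by exact: le_trans xq.
rewrite -(subnK nk) !exprD mulrCA [leRHS]mulrCA.
rewrite [q ^+ n * _]mulrC ler_wpM2r //; first by rewrite mulr_ge0 // exprn_ge0.
by rewrite lerXn2r ?nnegrE.
Qed.

Section HolderAnalytic.
Variables (R : realType) (w W : nat -> nat -> R) (C : R) (k : nat) (alpha : R).
Hypothesis W1 : forall i j, 1 <= W i j.
Hypothesis wW : forall i j, `|w i j| <= W i j.
Hypothesis C0 : 0 <= C.
Hypothesis WC : forall i j, W i j <= C * (i + j).+1%:R.
Hypothesis w_period : forall i j, expi (w i j * (2 * pi)) = 1.
Hypothesis halpha : 0 < alpha < 1.
Implicit Types c a : nat -> nat -> R[i].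

Lemma trig_holder c M : weight_bound W c k.+2 M ->
  holder_space k alpha (trig w c) /\
  (0 <= holder_norm k alpha (trig w c) <= ((k%:R + 5) * M)%:E)%E.
Proof.
move=> h; have hn := holder_norm_trig W1 wW halpha h.
split; last first.
  rewrite hn andbT /holder_norm adde_ge0 ?sume_ge0 // => [j _|].
    apply: (@le_trans _ _ `|derive1n j (trig w c) 0|%:E).
      by rewrite lee_fin.
    by apply: ereal_sup_ubound; exists 0.
  apply: (@le_trans _ _ (`|derive1n k (trig w c) 0 - derive1n k (trig w c) 1| /
    `|0 - 1| `^ alpha)%:E).
    by rewrite lee_fin divr_ge0 // powR_ge0.
  apply: ereal_sup_ubound; exists (0, 1) => //=.
  by rewrite eq_sym oner_neq0.
split.
- move=> t; rewrite /trig; congr (plane_of (csum _)).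
  apply/funext => i; apply/funext => j.
  by rewrite mulrDr expiD w_period mulr1.
- move=> j t jk; rewrite (derive1n_trig W1 wW h); last by rewrite ltnW // ltnW.
  have hj : weight_bound W (iter j (tderiv w) c) 2 M.
    by apply: (iter_tderiv_weight W1 wW); apply: (weight_bound_le W1 h); rewrite addn2 !ltnS ltnW.
  by have [] := trig_is_derive W1 wW t hj.
- by apply: le_lt_trans hn _; rewrite ltry.
Qed.

Lemma holder_analytic_powers a (r A e0 : R) (f : R -> R -> R * R) :
  (forall n, square_sum (fun i j => normc (a i j) * r ^+ (i + j)) n <= A) ->
  `|e0| < r -> (forall e, `|e| < r -> f e = trig w (power_coef a e)) ->
  holder_analytic_at k alpha f e0.
Proof.
move=> hA e0r hf.
have W0 i j : 0 <= W i j <= C * (i + j).+1%:R.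
  by rewrite WC (le_trans ler01).
rewrite /holder_analytic_at.
apply: (@analytic_of_powers R _ (holder_space k alpha) (holder_norm k alpha)
  (trig w) W k.+2 (k%:R + 5) C trig_holder _ C0 W0 a r A e0 f hA e0r hf).
move=> c d M M' x hc hd.
have c0 := weight_bound_le W1 hc (leq0n _); have d0 := weight_bound_le W1 hd (leq0n _).
have xd : weight_bound W (fun i j => x%:C%C * d i j) 0 (`|x| * M').
  move=> n; apply: le_trans (ler_wpM2l (normr_ge0 x) (d0 n)).
  by rewrite -square_sumZ; apply: square_sum_le => i j; rewrite normcM normcr mulrA.
apply/funext => t; rewrite !fctE -(trigZ w x t d0) -(trigB w t c0 xd).
by [].
Qed.

(** Every power of [e] beyond the [n]-th is traded for [e ^ n] and a power of the
    smaller radius [q]. *)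
Lemma holder_remainder a (r A q : R) n : 
  (forall n, square_sum (fun i j => normc (a i j) * r ^+ (i + j)) n <= A) ->
  (forall i j, (i + j < n)%N -> a i j = 0) -> 0 < q < r ->
  exists B : R, forall e, `|e| < q ->
    (holder_norm k alpha (trig w (power_coef a e)) <= (B * `|e| ^+ n)%:E)%E.
Proof.
move=> hA ha /andP[q0 qr].
have W0 i j : 0 <= W i j <= C * (i + j).+1%:R.
  by rewrite WC (le_trans ler01).
have [B B0 hB] := geometric_weight k.+2 C0 W0 (introT andP (conj (ltW q0) qr)) hA.
exists ((k%:R + 5) * (B / q ^+ n)) => e eq.
have hb : weight_bound W (power_coef a e) k.+2 (`|e| ^+ n * (B / q ^+ n)).
  move=> N; rewrite mulrA ler_pdivlMr ?exprn_gt0 // mulrC.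
  apply: le_trans (ler_wpM2l _ (hB N)); last by rewrite exprn_ge0.
  rewrite -!square_sumZ; apply: square_sum_le => i j.
  rewrite /power_coef normcM normcr normrX.
  case: (ltnP (i + j) n) => [/ha ->|ij].
    by rewrite ComplexField.Normc.normc0 !mul0r !mulr0.
  rewrite mulrAC mulrCA [leRHS]mulrCA ler_wpM2l //.
    by rewrite mulr_ge0 ?normc_ge0 // exprn_ge0 // (le_trans ler01).
  by apply: power_trade; first exact: ltW.
have [_ /andP[_ h]] := trig_holder hb.
by rewrite -mulrA [X in (_ * X)%:E]mulrC.
Qed.

End HolderAnalytic.

Section ScalarAnalytic.
Variable R : realType.
Implicit Types a c : nat -> nat -> R[i].

Definition scalar_sum c : R := cRe (csum c).

Lemma weight_bound1 c M : weight_bound (fun _ _ => 1) c 0 M -> summable_by c M.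
Proof.
move=> h N; apply: le_trans (h N).
by apply: square_sum_le => i j; rewrite expr0 mulr1.
Qed.

Lemma scalar_analytic_powers a (r A e0 : R) (f : R -> R) :
  (forall n, square_sum (fun i j => normc (a i j) * r ^+ (i + j)) n <= A) ->
  `|e0| < r -> (forall e, `|e| < r -> f e = scalar_sum (power_coef a e)) ->
  scalar_analytic_at f e0.
Proof.
move=> hA e0r hf.
rewrite /scalar_analytic_at.
apply: (@analytic_of_powers R R^o setT (fun x => `|x|%:E)
  scalar_sum (fun _ _ => 1) 0 1 1 _ _ ler01 _ a r A e0 f hA e0r hf).
- move=> c M /weight_bound1 hc; split => //; rewrite lee_fin normr_ge0 /= lee_fin mul1r.
  by apply: le_trans (abs_Re_le _) _; exact: normc_csum_le.
- move=> c d M M' x /weight_bound1 hc /weight_bound1 hd.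
  rewrite /scalar_sum -[csum _]/(csum (c - (fun i j => x%:C%C * d i j))).
  rewrite (csumB hc (summable_byZ _ hd)) (csumZ _ hd).
  case: (csum c) (csum d) => u1 u2 [v1 v2] /=; simpc.
  by [].
- by move=> i j; rewrite ler01 mul1r ler1n.
Qed.

Lemma scalar_remainder a (r A : R) n : 0 < r ->
  (forall n, square_sum (fun i j => normc (a i j) * r ^+ (i + j)) n <= A) ->
  (forall i j, (i + j < n)%N -> a i j = 0) ->
  exists B : R, forall e, `|e| < r ->
    `|scalar_sum (power_coef a e)| <= B * `|e| ^+ n.
Proof.
move=> r0 hA ha; exists (A / r ^+ n) => e er.
apply: le_trans (abs_Re_le _) _; apply: normc_csum_le => N.
rewrite mulrAC ler_pdivlMr ?exprn_gt0 // mulrC [leRHS]mulrC.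
apply: le_trans (ler_wpM2l _ (hA N)); last by rewrite exprn_ge0.
rewrite -!square_sumZ; apply: square_sum_le => i j.
rewrite /power_coef normcM normcr normrX.
case: (ltnP (i + j) n) => [/ha ->|ij].
  by rewrite ComplexField.Normc.normc0 !mul0r !mulr0.
rewrite mulrCA [leRHS]mulrCA ler_wpM2l ?normc_ge0 //.
exact: power_trade (ltW er) ij.
Qed.

End ScalarAnalytic.

(** * Homeomorphisms of the plane that extend an exterior map *)

Section ComplexContraction.
Variable R : realType.

Lemma cvgn_shift (f : nat -> R) (l : R) : f @ \oo --> l ->
  (fun N => f N.+1) @ \oo --> l.
Proof.
move=> hf; apply: cvg_comp hf; apply/cvgnyPge => k; exists k => // n /= kn.
exact: leqW.
Qed.

(** The increments of the Picard iterates are dominated by a geometric series,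
    summed here as a double series supported on the first column. *)
Lemma complex_contraction (T : R[i] -> R[i]) :
  (forall z w, normc (T z - T w) <= 2^-1 * normc (z - w)) ->
  exists l, T l = l.
Proof.
move=> hT.
pose x n := iter n T 0.
pose u i j := if j is 0%N then x i.+1 - x i else 0.
pose D := normc (T 0).
have D0 : 0 <= D by exact: normc_ge0.
have inc n : normc (x n.+1 - x n) <= D * 2^-1 ^+ n.
  elim: n => [|n IH]; first by rewrite expr0 mulr1 /x /= subr0.
  apply: le_trans (hT _ _) _; rewrite exprS mulrCA ler_wpM2l //.
have sumx N : square_sum u N.+1 = x N.+1.
  rewrite /square_sum; under eq_bigr do rewrite big_ord_recl big1 ?addr0 //=.
  elim: N => [|N IH]; first by rewrite big_ord_recl big_ord0 addr0 subr0.
  by rewrite big_ord_recr /= IH addrC subrK.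
have hu : summable_by u (D * 2).
  have geo N : \sum_(i < N) 2^-1 ^+ i <= 2 :> R.
    have -> : \sum_(i < N) 2^-1 ^+ i = 2 - 2 * 2^-1 ^+ N :> R.
      elim: N => [|N IH]; first by rewrite big_ord0 expr0 mulr1 subrr.
      by rewrite big_ord_recr /= IH exprS; field.
    by rewrite gerBl mulr_ge0 // exprn_ge0.
  move=> N; apply: le_trans (ler_wpM2l D0 (geo N)); rewrite mulr_sumr.
  apply: ler_sum => i _; case: N i => [|N] i; first by case: i.
  rewrite big_ord_recl big1 ?addr0 //= => [|j _]; first exact: inc.
  exact: ComplexField.Normc.normc0.
have h := csum_cvg hu; exists (csum u).
apply/eqP; rewrite -subr_eq0 -normc_eq0 eq_le normc_ge0 andbT.
have h1 : (fun N => normc (square_sum u N.+1 - csum u)) @ \oo --> 0.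
  exact: cvgn_shift h.
have h2 : (fun N => normc (square_sum u N.+2 - csum u)) @ \oo --> 0.
  exact: cvgn_shift h1.
apply: (cvgn_ge (cvgn0D (cvgn0M 2^-1 h1) h2)) => N.
rewrite !sumx; have -> : T (csum u) - csum u =
  (T (csum u) - T (x N.+1)) + (x N.+2 - csum u) by rewrite addrA subrK.
apply: le_trans (normcD _ _) _; rewrite lerD2r (normcB (x N.+1)); exact: hT.
Qed.

End ComplexContraction.

Section PlaneHomeo.
Variable R : realType.
Implicit Types z w u v : R[i].

(** The inversion outside the unit disk, the conjugation inside: the two agree
    on the circle, and the map is a 1-Lipschitz retraction onto the disk
    followed by a reflection. *)
Definition fold z : R[i] := if normc z <= 1 then (z^*)%C else z^-1.

Lemma fold_le1 z : normc (fold z) <= 1.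
Proof.
rewrite /fold; case: ifP => [z1|/negbT]; first by rewrite normc_conj.
rewrite -ltNge => z1.
by rewrite ComplexField.Normc.normcV invf_le1 ?(ltW z1) // (lt_trans ltr01).
Qed.

Lemma fold_ge1 z : 1 <= normc z -> fold z = z^-1.
Proof.
rewrite /fold => z1; case: ifP => // z1'.
have z2 : normc z = 1 by apply/eqP; rewrite eq_le z1 z1'.
have z0 : z != 0 by rewrite -normc_eq0 z2 oner_neq0.
by apply: (mulfI z0); rewrite mulr_conjc z2 expr1n divff.
Qed.

Lemma fold_lipschitz z w : normc (fold z - fold w) <= normc (z - w).
Proof.
wlog zw : z w / normc z <= normc w.
  move=> h; case: (lerP (normc z) (normc w)) => [/h //|/ltW /h].
  by rewrite normcB (normcB w).
have n0 := @normc_ge0 R.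
case: (lerP (normc w) 1) => w1.
  have z1 := le_trans zw w1; rewrite /fold z1 w1 -rmorphB /= normc_conj //.
have wp : 0 < normc w by exact: lt_trans w1.
have w0 : w != 0 by rewrite -normc_eq0 gt_eqF.
case: (lerP (normc z) 1) => z1; last first.
  have zp : 0 < normc z by exact: lt_trans z1.
  have z0 : z != 0 by rewrite -normc_eq0 gt_eqF.
  rewrite !fold_ge1 ?(ltW z1) ?(ltW w1) //.
  have -> : z^-1 - w^-1 = (w - z) * (z * w)^-1 by field; rewrite z0 w0.
  rewrite normcM ComplexField.Normc.normcV normcM normcB ler_piMr //.
  by rewrite invf_le1 ?mulr_gt0 // mulr_ege1 // ltW.
rewrite (fold_ge1 (ltW w1)) /fold z1.
have -> : (z^*)%C - w^-1 = ((z^*)%C * w - 1) * w^-1 by field.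
rewrite normcM ComplexField.Normc.normcV ler_pdivrMr //.
apply: (@le_trans _ _ (normc (z - w))); last by rewrite ler_peMr // ltW.
rewrite -ler_sqr ?nnegrE //.
have -> : normc ((z^*)%C * w - 1) ^+ 2 = normc (z - w) ^+ 2 +
    (normc z ^+ 2 - 1) * (normc w ^+ 2 - 1).
  rewrite !sqr_normc_sum; case: z w {zw w1 wp w0 z1} => a b [c d] /=.
  by ring.
rewrite gerDl mulr_le0_ge0 //; first by rewrite subr_le0 expr_le1.
by rewrite subr_ge0 expr_ge1 // ltW.
Qed.

Variables (p : R[i] -> R[i]).

(** The exterior map [z + p (1 / z)], continued inside the disk as a function that
    need only be Lipschitz. *)
Definition Phi z := z + p (fold z).

Definition Psi x := xget 0 [set z | Phi z = x].

Hypothesis p_lip : forall u v, normc u <= 1 -> normc v <= 1 ->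
  normc (p u - p v) <= 2^-1 * normc (u - v).

Lemma Phi_near_id z w : normc (Phi z - Phi w - (z - w)) <= 2^-1 * normc (z - w).
Proof.
have -> : Phi z - Phi w - (z - w) = p (fold z) - p (fold w) by rewrite /Phi; ring.
apply: le_trans (p_lip (fold_le1 z) (fold_le1 w)) _.
by rewrite ler_wpM2l // fold_lipschitz.
Qed.

Lemma Phi_expand z w : normc (z - w) <= 2 * normc (Phi z - Phi w).
Proof.
have := normcD (Phi z - Phi w) (- (Phi z - Phi w - (z - w))).
rewrite opprB addrC subrK normcB => h1; have := Phi_near_id z w => h2.
by rewrite normcB in h2; move: h1 h2; rewrite ![normc (w - z)]normcB => h1 h2; lra.
Qed.

Lemma Phi_lipschitz z w : normc (Phi z - Phi w) <= 2 * normc (z - w).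
Proof.
have := normcD (Phi z - Phi w - (z - w)) (z - w); rewrite subrK => h1.
by have := Phi_near_id z w; have := normc_ge0 (z - w) => ? ?; lra.
Qed.

Lemma Phi_inj : injective Phi.
Proof.
move=> z w h; apply/eqP; rewrite -subr_eq0 -normc_eq0 eq_le normc_ge0 andbT.
by have := Phi_expand z w; rewrite h subrr ComplexField.Normc.normc0 mulr0.
Qed.

Lemma Phi_surj x : exists z, Phi z = x.
Proof.
have [|z hz] := @complex_contraction R (fun z => x - p (fold z)).
  move=> z w; have -> : x - p (fold z) - (x - p (fold w)) =
    - (p (fold z) - p (fold w)) by ring.
  rewrite normcN; apply: le_trans (p_lip (fold_le1 z) (fold_le1 w)) _.
  by rewrite ler_wpM2l // fold_lipschitz.
by exists z; rewrite /Phi -{1}hz subrK.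
Qed.

Lemma PhiK : cancel Psi Phi.
Proof. by move=> x; have := Phi_surj x => /(xgetPex 0). Qed.

Lemma PsiK : cancel Phi Psi.
Proof. by move=> z; apply: Phi_inj; rewrite PhiK. Qed.

Lemma Psi_lipschitz x y : normc (Psi x - Psi y) <= 2 * normc (x - y).
Proof. by have := Phi_expand (Psi x) (Psi y); rewrite !PhiK. Qed.

End PlaneHomeo.

(** * The image of the unit disk *)

Section PlaneTopology.
Variable R : realType.
Implicit Types x y : R * R.

Definition complex_of x : R[i] := (x.1 +i* x.2)%C.

Lemma complex_ofK x : plane_of (complex_of x) = x.
Proof. by case: x. Qed.

Lemma plane_ofK (z : R[i]) : complex_of (plane_of z) = z.
Proof. by case: z. Qed.

Lemma complex_ofB x y : complex_of (x - y) = complex_of x - complex_of y.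
Proof. by case: x y => a b [c d]; rewrite /complex_of /=; simpc. Qed.

Lemma normc_le_norm x : normc (complex_of x) <= 2 * `|x|.
Proof.
apply: le_trans (normc_le_sum _) _; rewrite mulr_natl mulr2n prod_normE /=.
by rewrite lerD // le_max lexx ?orbT.
Qed.

Lemma lipschitz_continuous (V W : normedModType R) (f : V -> W) (K : R) :
  (forall u v : V, `|f u - f v| <= K * `|u - v|) -> continuous f.
Proof.
move=> h x; apply/cvgrPdist_lt => eps eps0.
have K1 : 0 < `|K| + 1 by rewrite ltr_wpDl.
near=> y.
apply: le_lt_trans (h x y) _; apply: (@le_lt_trans _ _ ((`|K| + 1) * `|x - y|)).
  by rewrite ler_wpM2r // (le_trans (ler_norm K)) // lerDl.
rewrite mulrC -ltr_pdivlMr //; near: y.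
by apply: cvgr_dist_lt => //; rewrite divr_gt0.
Unshelve. all: by end_near. Qed.

End PlaneTopology.

Section HomeoDisk.
Variables (R : realType) (p : R[i] -> R[i]).
Hypothesis p_lip : forall u v, normc u <= 1 -> normc v <= 1 ->
  normc (p u - p v) <= 2^-1 * normc (u - v).
Implicit Types x y : R * R.

Definition radial x : R := normc (Psi p (complex_of x)).

Definition core : set (R * R) := [set x | radial x < 1].

Lemma normc_dist (z w : R[i]) : `|normc z - normc w| <= normc (z - w).
Proof.
rewrite ler_norml; apply/andP; split.
  by have := normcD (w - z) z; rewrite subrK (normcB z) => ?; lra.
by rewrite lerBlDr; have := normcD (z - w) w; rewrite subrK.
Qed.

Lemma radial_continuous : continuous radial.
Proof.
apply: (@lipschitz_continuous _ _ _ _ 4) => x y.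
apply: le_trans (normc_dist _ _) _; apply: le_trans (Psi_lipschitz p_lip _ _) _.
rewrite -complex_ofB; have := normc_le_norm (x - y); lra.
Qed.

Lemma core_image : core = [set plane_of (Phi p z) | z in [set z | normc z < 1]].
Proof.
apply/seteqP; split => [x hx|_ [z hz <-]].
  by exists (Psi p (complex_of x)) => //; rewrite (PhiK p_lip) complex_ofK.
by rewrite /core /radial /= plane_ofK (PsiK p_lip).
Qed.

Lemma core_open : open core.
Proof.
rewrite (_ : core = radial @^-1` [set r | r < 1]) //.
apply: open_comp; last exact: open_lt.
by move=> x _; exact: radial_continuous.
Qed.

Lemma closed_radial_le : closed [set x | radial x <= 1].
Proof.
apply: (@preimage_closed _ _ radial [set r | r <= 1]); last exact: closed_le.
by move=> x _; exact: radial_continuous.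
Qed.

Lemma closed_radial_ge : closed [set x | 1 <= radial x].
Proof.
apply: (@preimage_closed _ _ radial [set r | 1 <= r]); last exact: closed_ge.
by move=> x _; exact: radial_continuous.
Qed.

(** A point of radius one is approached along its own radius. *)
Lemma closure_core : closure core = [set x | radial x <= 1].
Proof.
apply/seteqP; split.
  rewrite [X in _ `<=` X](closure_id _).1; last exact: closed_radial_le.
  by apply: closureS => x; exact: ltW.
move=> x hx B hB.
pose z := Psi p (complex_of x).
pose g (s : R) := plane_of (Phi p ((1 - s)%:C%C * z)) : R * R.
have gx : g 0 = x by rewrite /g subr0 mul1r (PhiK p_lip) complex_ofK.
have gc : {for 0, continuous g}.
  have hc : continuous g.
    apply: (@lipschitz_continuous _ _ _ _ 2) => s t.
    rewrite -plane_ofB; apply: le_trans (plane_of_norm_le _) _.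
    apply: le_trans (Phi_lipschitz p_lip _ _) _; rewrite ler_wpM2l //.
    have -> : (1 - s)%:C%C * z - (1 - t)%:C%C * z = (t - s)%:C%C * z.
      by rewrite -mulrBl -rmorphB; congr (_%:C%C * _); ring.
    by rewrite normcM normcr distrC ler_piMr.
  exact: hc.
have : \forall s \near (0 : R), B (g s) by apply: gc; rewrite gx.
move=> [eta /= eta0 h].
pose s := Num.min (eta / 2) 2^-1.
have s0 : 0 < s by rewrite lt_min divr_gt0 //= invr_gt0.
have s1 : s < eta.
  by rewrite (@le_lt_trans _ _ (eta / 2)) ?ge_min ?lexx // ltr_pdivrMr // ltr_pMr // ltr1n.
have s2 : s <= 2^-1 by rewrite ge_min lexx orbT.
exists (g s); split; last by apply: h; rewrite /= sub0r normrN gtr0_norm.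
rewrite core_image; exists ((1 - s)%:C%C * z) => //=.
rewrite normcM normcr ger0_norm; last by lra.
apply: (@le_lt_trans _ _ (1 - s)); last by rewrite gtrBl.
by rewrite ler_piMr //; lra.
Qed.

Lemma fluid_domain_core : fluid_domain core = [set x | 1 < radial x].
Proof.
rewrite /fluid_domain closure_core; apply/seteqP; split=> x /=.
  by rewrite real_ltNge ?num_real // => /negP.
by rewrite real_ltNge ?num_real // => /negP.
Qed.

Lemma closure_fluid_sub : closure (fluid_domain core) `<=` [set x | 1 <= radial x].
Proof.
rewrite fluid_domain_core [X in _ `<=` X](closure_id _).1; last exact: closed_radial_ge.
by apply: closureS => x; exact: ltW.
Qed.

Lemma frontier_core : frontier core = [set x | radial x = 1].
Proof.
rewrite /frontier closure_core (interior_id _).1; last exact: core_open.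
apply/seteqP; split=> x /=.
  by move=> [h1 /negP]; rewrite -real_leNgt ?num_real // => h2; apply/eqP; rewrite eq_le h1.
by move=> e; rewrite e lexx; split => //; rewrite /core /= e ltxx.
Qed.

Lemma core_nonempty : core !=set0.
Proof.
exists (plane_of (Phi p 0)); rewrite core_image; exists 0 => //=.
by rewrite expr0n /= addr0 sqrtr0.
Qed.

Lemma core_bounded : bounded_set core.
Proof.
exists (`|plane_of (Phi p 0)| + 2); split; first exact: num_real.
move=> M hM x; rewrite core_image => -[z hz <-]; apply: ltW; apply: le_lt_trans hM.
rewrite -(subrK (plane_of (Phi p 0)) (plane_of _)); apply: le_trans (ler_normD _ _) _.
rewrite addrC lerD2l -plane_ofB; apply: le_trans (plane_of_norm_le _) _.
apply: le_trans (Phi_lipschitz p_lip _ _) _; rewrite subr0.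
by move: hz => /=; lra.
Qed.

(** The images of the radii are arcs through a common point. *)
Lemma core_connected : connected core.
Proof.
have -> : core = \bigcup_(z in [set z : R[i] | normc z < 1])
    ((fun t : R => plane_of (Phi p (t%:C%C * z))) @` `[0, 1]).
  rewrite core_image; apply/seteqP; split=> [_ [z hz <-]|_ [z hz] [t t01 <-]].
    by exists z => //; exists 1; rewrite ?mul1r //= in_itv /= ler01 lexx.
  move: t01; rewrite /= in_itv /= => /andP[t0 t1].
  exists (t%:C%C * z) => //=; rewrite normcM normcr ger0_norm //.
  by apply: le_lt_trans hz; rewrite ler_piMl ?normc_ge0.
apply: bigcup_connected.
  exists (plane_of (Phi p 0)) => z _; exists 0; rewrite ?mul0r //=.
  by rewrite in_itv /= lexx ler01.
move=> z hz; apply: connected_continuous_connected; first exact: segment_connected.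
apply: continuous_subspaceT; apply: (@lipschitz_continuous _ _ _ _ 2) => s t.
rewrite -plane_ofB; apply: le_trans (plane_of_norm_le _) _.
apply: le_trans (Phi_lipschitz p_lip _ _) _; rewrite ler_wpM2l //.
rewrite -mulrBl -rmorphB normcM normcr ler_piMr //.
exact: ltW.
Qed.

End HomeoDisk.

Section UnitCircle.
Variable R : realType.

Lemma expi_surj (z : R[i]) : normc z = 1 -> exists2 t, -pi <= t <= pi & z = expi t.
Proof.
move=> hz.
have h2 : cRe z ^+ 2 + cIm z ^+ 2 = 1 by rewrite -sqr_normc_sum hz expr1n.
have r1 : -1 <= cRe z <= 1 by rewrite -ler_norml -hz abs_Re_le.
have a0 := acos_ge0 r1; have a1 := acos_lepi r1; have p0 := pi_ge0 R.
have c1 : cos (acos (cRe z)) = cRe z by rewrite acosK.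
have s1 : sin (acos (cRe z)) = `|cIm z|.
  by rewrite sin_acos // -h2 addrAC subrr add0r sqrtr_sqr.
case: (lerP 0 (cIm z)) => i0.
  exists (acos (cRe z)); first by rewrite a1 andbT (le_trans _ a0) // oppr_le0.
  by rewrite /expi c1 s1 ger0_norm //; case: z {hz h2 r1 a0 a1 c1 s1 i0}.
exists (- acos (cRe z)); first by rewrite lerN2 a1 (le_trans _ p0) // oppr_le0.
rewrite /expi cosN sinN c1 s1 ltr0_norm // opprK.
by case: z {hz h2 r1 a0 a1 c1 s1 i0}.
Qed.

Lemma expi_inj (s t : R) : 0 <= s < 2 * pi -> 0 <= t < 2 * pi ->
  expi s = expi t -> s = t.
Proof.
move=> hs ht [hc hS].
have p0 := pi_gt0 R.
wlog st : s t hs ht hc hS / s <= t.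
  by move=> h; case: (lerP s t) => [|/ltW] ?; [exact: h|apply/esym; exact: h].
have d0 : 0 <= t - s by rewrite subr_ge0.
have d1 : t - s < 2 * pi by case/andP: hs => ? ?; case/andP: ht => ? ?; lra.
have c1 : cos (t - s) = 1 by rewrite cosB -hc -hS -!expr2 cos2Dsin2.
case: (lerP (t - s) pi) => dp.
  apply/eqP; rewrite eq_sym -subr_eq0; apply/eqP; apply: cos_inj.
  - by rewrite in_itv /= d0.
  - by rewrite in_itv /= lexx ltW.
  - by rewrite c1 cos0.
exfalso.
have : 2 * pi - (t - s) = 0.
  apply: cos_inj.
  - by rewrite in_itv /=; apply/andP; split; lra.
  - by rewrite in_itv /= lexx ltW.
  - rewrite cosB mulr_natl cos2pi sin2pi mul0r addr0 mul1r c1 cos0 //.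
by lra.
Qed.

End UnitCircle.

(** * Evaluation of arrays *)

Section Evaluation.
Variables (R : realType) (r : R).
Hypothesis r0 : 0 < r.
Implicit Types (a b : nat -> nat -> R) (x : R[i]).

Definition bounded_array a := exists M, norm_bound r a M.

Lemma bounded_arrayD a b : bounded_array a -> bounded_array b ->
  bounded_array (a + b).
Proof. by move=> [M h] [M' h']; exists (M + M'); exact: norm_boundD. Qed.

Lemma bounded_arrayN a : bounded_array a -> bounded_array (- a).
Proof. by move=> [M h]; exists M; exact: norm_boundN. Qed.

Lemma bounded_arrayZ (c : R) a : bounded_array a -> bounded_array (c *: a).
Proof. by move=> [M h]; exists (`|c| * M); exact: norm_boundZ. Qed.

Lemma bounded_array_cauchy a b : bounded_array a -> bounded_array b ->
  bounded_array (cauchy a b).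
Proof. by move=> [M h] [M' h']; exists (M * M'); exact: norm_bound_cauchy. Qed.

Lemma bounded_array_flip a : bounded_array a -> bounded_array (flip a).
Proof. by move=> [M h]; exists M; exact: norm_bound_flip. Qed.

Lemma bounded_array_cnst (c : R) : bounded_array (cnst c).
Proof. by exists `|c|; exact: norm_bound_cnst. Qed.

Lemma bounded_array_mirror a : bounded_array a -> bounded_array (mirror a).
Proof. by move=> [M h]; exists (2 * M); exact: norm_bound_mirror. Qed.

(** The value at [x = e z], [conj x = e conj z]. *)
Definition monomials x a : nat -> nat -> R[i] :=
  fun i j => (a i j)%:C%C * (x ^+ i * (x^*)%C ^+ j).

Definition ev x a : R[i] := csum (monomials x a).

Variable x : R[i].
Hypothesis xr : normc x <= r.

Lemma monomials_summable a M : norm_bound r a M -> summable_by (monomials x a) M.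
Proof.
move=> h N; apply: le_trans (h N); apply: square_sum_le => i j.
rewrite /monomials !normcM normcr !normcX normc_conj -exprD ler_wpM2l //.
by rewrite lerXn2r ?nnegrE ?normc_ge0 // ltW.
Qed.

Lemma evD a b : bounded_array a -> bounded_array b -> ev x (a + b) = ev x a + ev x b.
Proof.
move=> [M /monomials_summable h] [M' /monomials_summable h'].
rewrite /ev -(csumD h h'); congr csum; apply/funext => i; apply/funext => j.
by rewrite /monomials !fctE rmorphD /= mulrDl.
Qed.

Lemma evN a : bounded_array a -> ev x (- a) = - ev x a.
Proof.
move=> [M /monomials_summable h].
rewrite /ev -(csumN h); congr csum; apply/funext => i; apply/funext => j.
by rewrite /monomials !fctE rmorphN /= mulNr.
Qed.

Lemma evB a b : bounded_array a -> bounded_array b -> ev x (a - b) = ev x a - ev x b.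
Proof. by move=> ha hb; rewrite evD ?evN //; exact: bounded_arrayN. Qed.

Lemma evZ (c : R) a : bounded_array a -> ev x (c *: a) = c%:C%C * ev x a.
Proof.
move=> [M /monomials_summable h].
rewrite /ev -(csumZ _ h); congr csum; apply/funext => i; apply/funext => j.
by rewrite /monomials !fctE /GRing.scale /= rmorphM /= -mulrA.
Qed.

Lemma ev_cnst (c : R) : ev x (cnst c) = c%:C%C.
Proof.
have h := monomials_summable (norm_bound_cnst r c).
apply: (csum_unique h); apply: (@cvgn0_le _ _ (fun N => if N is 0%N then normc (- c%:C%C) else 0)).
  by apply/cvgrPdist_lt => eps eps0; exists 1%N => // -[//|n] _ /=; rewrite subrr normr0.
case=> [|N]; first by rewrite /square_sum big_ord0 sub0r normc_ge0 lexx.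
rewrite /square_sum big_ord_recl big_ord_recl [monomials _ _ _ _](_ : _ = c%:C%C).
  rewrite big1 ?addr0 => [|j _]; last by rewrite /monomials /cnst /= mul0r.
  rewrite big1 ?addr0 => [|i _].
    by rewrite subrr ComplexField.Normc.normc0 lexx.
  by rewrite big1 // => j _; rewrite /monomials /cnst /= mul0r.
by rewrite /monomials /cnst /= !expr0 !mulr1.
Qed.

Lemma ev_cauchy a b : bounded_array a -> bounded_array b ->
  ev x (cauchy a b) = ev x a * ev x b.
Proof.
move=> [M /monomials_summable h] [M' /monomials_summable h'].
rewrite /ev -(csumM h h'); congr csum; apply/funext => i; apply/funext => j.
rewrite /monomials /cauchy rmorph_sum mulr_suml; apply: eq_bigr => k _.
rewrite rmorph_sum mulr_suml; apply: eq_bigr => l _; rewrite rmorphM /=.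
have -> : x ^+ i = x ^+ k * x ^+ (i - k) by rewrite -exprD subnKC // -ltnS.
have -> : (x^*)%C ^+ j = (x^*)%C ^+ l * (x^*)%C ^+ (j - l).
  by rewrite -exprD subnKC // -ltnS.
by ring.
Qed.

Lemma ev_flip a : bounded_array a -> ev x (flip a) = ((ev x a)^*)%C.
Proof.
move=> [M /monomials_summable h].
rewrite /ev -(csum_conj h) -(csum_flip (summable_by_conj h)); congr csum.
apply/funext => i; apply/funext => j.
have e (c : R) (z : R[i]) : ((c%:C%C * z)^*)%C = c%:C%C * (z^*)%C.
  by case: z => u v; simpc.
rewrite /monomials /flip e (rmorphM (@conjc R)) 2!(rmorphXn (@conjc R)).
by rewrite /= conjcK [X in _ * X]mulrC.
Qed.

Lemma ev_diag a : (forall i j, i != j -> a i j = 0) ->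
  ev x a = csum (fun i j => (a i j * normc x ^+ (i + j))%:C%C).
Proof.
move=> ha; congr csum; apply/funext => i; apply/funext => j; rewrite /monomials.
case: (eqVneq i j) => [->|/ha ->]; last by rewrite !mul0r.
have -> : normc x ^+ (j + j) = (normc x ^+ 2) ^+ j by rewrite -exprM mul2n addnn.
by rewrite (rmorphM (real_complex R)) (rmorphXn (real_complex R)) /= -mulr_conjc exprMn.
Qed.

End Evaluation.

Lemma csum_real (R : realType) (a : nat -> nat -> R) M :
  summable_by (fun i j => (a i j)%:C%C) M ->
  csum (fun i j => (a i j)%:C%C) = (scalar_sum (fun i j => (a i j)%:C%C))%:C%C.
Proof.
move=> h; have := csum_conj h.
have -> : (fun i j => ((a i j)%:C%C)^*%C) = (fun i j => (a i j)%:C%C).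
  by apply/funext => i; apply/funext => j; rewrite conjc_real.
rewrite /scalar_sum; case: (csum _) => u v /= [] /eqP; rewrite -addr_eq0 => /eqP v0.
by congr (_ +i* _)%C; lra.
Qed.

(** * The formal Bernoulli identity *)

Section FormalIdentity.
Variables (R : realType) (m : nat) (tau : R).
Hypothesis hm : (2 <= m)%N.
Hypothesis htau : tau ^+ 2 * m%:R = 1.
Implicit Types a b d : nat -> nat -> R.

Local Notation sol := (solution m tau).
Local Notation G := (shape_tail sol).
Local Notation delta := (omega_tail sol).
Local Notation kap := (inverse_tail sol).
Local Notation g := (gser sol).
Local Notation h := (hser m sol).
Local Notation rem := (remser m tau sol).
Local Notation dd := (ddser tau sol).

Lemma flip_flip a : flip (flip a) = a. Proof. by []. Qed.

Lemma flipD a b : flip (a + b) = flip a + flip b. Proof. by []. Qed.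

Lemma flip_cnst (c : R) : flip (cnst c) = cnst c.
Proof.
by apply/funext => i; apply/funext => j; rewrite /flip /cnst andbC.
Qed.

Lemma symmetric_cauchy a b : flip a = a -> flip b = b ->
  flip (cauchy a b) = cauchy a b.
Proof. by move=> ha hb; rewrite flip_cauchy ha hb. Qed.

Lemma symmetricD a b : flip a = a -> flip b = b -> flip (a + b) = a + b.
Proof. by move=> ha hb; rewrite flipD ha hb. Qed.

Lemma symmetricZ (c : R) a : flip a = a -> flip (c *: a) = c *: a.
Proof. by move=> ha; rewrite -[RHS]/(c *: a) -{2}ha. Qed.

Lemma symmetricN a : flip a = a -> flip (- a) = - a.
Proof. by move=> ha; rewrite -{2}ha. Qed.

Lemma symmetric_addflip a : flip (a + flip a) = a + flip a.
Proof. by rewrite flipD flip_flip addrC. Qed.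

Lemma symmetric_mulflip a : flip (cauchy a (flip a)) = cauchy a (flip a).
Proof. by rewrite flip_cauchy flip_flip cauchyC. Qed.

Lemma flip_mirror a : flip (mirror a) = mirror a.
Proof.
by apply/funext => i; apply/funext => j; rewrite /flip /mirror minnC maxnC.
Qed.

Lemma cauchy_diag0 d a i j : (forall k l, k != l -> d k l = 0) ->
  (forall k, (k <= i)%N -> (k <= j)%N -> a (i - k)%N (j - k)%N = 0) ->
  cauchy d a i j = 0.
Proof.
move=> hd ha; rewrite /cauchy big1 // => k _; rewrite big1 // => l _.
case: (eqVneq (k : nat) l) => [kl|/hd ->]; last by rewrite mul0r.
have ki : (k <= i)%N by rewrite -ltnS.
have kj : (k <= j)%N by rewrite kl -ltnS.
by rewrite -kl ha // mulr0.
Qed.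

Lemma cauchy_euler_xvar a i j : cauchy a (euler m (xvar R)) i.+1 j = - m%:R * a i j.
Proof.
rewrite cauchyC /cauchy big_ord_recl big1 ?add0r; last first.
  by move=> l _; rewrite /euler /xvar /= mulr0 mul0r.
rewrite big_ord_recl big_ord_recl /= big1 ?addr0; last first.
  by move=> l _; rewrite /euler /xvar /= mulr0 mul0r.
rewrite big1 ?addr0; last first.
  by move=> k _; rewrite big1 // => l _; rewrite /euler /xvar /= mulr0 mul0r.
by rewrite /euler /xvar /bump /= subn1 subn0 /= mulr1 subr0 mulr1.
Qed.

Lemma delta_diag i j : i != j -> delta i j = 0.
Proof. by move=> ij; apply: omega_tail_diag; rewrite ij. Qed.

Lemma delta00 : delta 0%N 0%N = 0.
Proof. by apply: omega_tail_diag. Qed.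

Lemma delta_flip : flip delta = delta.
Proof.
apply/funext => i; apply/funext => j; rewrite /flip.
by case: (eqVneq i j) => [->//|ij]; rewrite !delta_diag // eq_sym.
Qed.

Lemma dd_diag i j : i != j -> dd i j = 0.
Proof.
move=> ij; rewrite /ddser !fctE delta_diag // scaler0 add0r.
apply: cauchy_diag0; first exact: delta_diag.
move=> k ki kj; rewrite delta_diag //; apply: contra ij => /eqP e.
by rewrite -(subnK ki) e subnK.
Qed.

Lemma shape_support i j : (i < j + 2)%N -> G i j = 0.
Proof.
rewrite -[in G]solution_fixed /= => ij; rewrite ifF //; apply/negbTE.
by rewrite -leqNgt; clear -ij; lia.
Qed.

Lemma gser_support i j : (i <= j)%N -> g i j = 0.
Proof.
move=> ij; rewrite /gser !fctE shape_support; last by rewrite addn2 ltnS leqW.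
rewrite addr0 /xvar; case: ifP => // /andP[/eqP i1 /eqP j0].
by rewrite i1 j0 in ij.
Qed.

Lemma inverse_fixed : kap = inverse_next m sol.
Proof. by rewrite -{1}solution_fixed. Qed.

Lemma shape_fixed i j : (j + 2 <= i)%N ->
  (i - j - 1)%:R * G i j = cauchy dd (euler m G) i j - rem i j.
Proof.
move=> ij; rewrite -[in LHS]solution_fixed /= ifT; last by clear -ij; lia.
rewrite mulrA divff ?mul1r //.
by rewrite pnatr_eq0; clear -ij; lia.
Qed.

Lemma agree_solution_self n : agree_series n sol sol.
Proof.
have [h1 h2 h3] := agree_solution m tau n.
by split; [apply: agree_diag (agree_sym h1)|apply: agree_diag (agree_sym h2)
  |apply: agree_diag (agree_sym h3)].
Qed.

Lemma rem_order i j : (i + j < 2)%N -> rem i j = 0.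
Proof.
move=> ij; have [_ hR _] := agree_remser m tau (ltn0Sn 0) (agree_solution_self 1).
by have [] := (hR i j).1 ij.
Qed.

Lemma tau_neq0 : tau != 0.
Proof.
apply/eqP => t0; move: htau; rewrite t0 expr0n mul0r => /eqP.
by rewrite eq_sym oner_eq0.
Qed.

Lemma omega_fixed j : m%:R * dd j j = - rem j.+1 j.
Proof.
have m0 : m%:R != 0 :> R by rewrite pnatr_eq0 -lt0n ltnW.
have t0 := tau_neq0.
case: j => [|j].
  rewrite rem_order // /ddser !fctE delta00 scaler0 add0r oppr0.
  have -> : cauchy delta delta 0 0 = 0.
    apply: cauchy_diag0; first exact: delta_diag.
    by move=> k; rewrite leqn0 => /eqP -> _; rewrite subn0 delta00.
  exact: mulr0.
have dE : delta j.+1 j.+1 = - (2 * tau)^-1 *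
    (rem j.+2 j.+1 / m%:R + cauchy delta delta j.+1 j.+1).
  by rewrite -[in LHS]solution_fixed /= eqxx.
rewrite /ddser !fctE dE /GRing.scale /=; move: (cauchy _ _ _ _) => q.
by field; rewrite t0 m0.
Qed.

(** The difference of the two sides of Bernoulli's law, up to a constant. *)
Definition defect : nat -> nat -> R :=
  rem - pser sol - cauchy (cauchy (tdser tau sol) (tdser tau sol)) (h + flip h).

Lemma td_square : cauchy (tdser tau sol) (tdser tau sol) = cnst (tau ^+ 2) + dd.
Proof.
rewrite /tdser cauchyDl !cauchyDr /ddser.
apply/funext => i; apply/funext => j; rewrite !fctE.
rewrite [cauchy delta (cnst _)]cauchyC !cauchy_cnstl /GRing.scale /= /cnst.
by case: ifP => _; ring.
Qed.

Lemma h_support i j : (i <= j)%N -> h i j = 0.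
Proof. by move=> ij; rewrite /hser /euler gser_support // mulr0. Qed.

(** Off the diagonal, on the side of the modes that are solved for, the
    fixed-point equations say that the defect vanishes: mode one through the
    equation of the angular velocity, the others through the division. *)
Lemma defect_upper i j : (j < i)%N -> defect i j = 0.
Proof.
move=> ij.
have m0 : m%:R != 0 :> R by rewrite pnatr_eq0 -lt0n ltnW.
have t2 : tau ^+ 2 = m%:R^-1 by apply: (mulIf m0); rewrite htau mulVf.
rewrite /defect td_square cauchyDl !fctE cauchy_cnstl cauchyDr !fctE.
have -> : cauchy dd (flip h) i j = 0.
  apply: cauchy_diag0; first exact: dd_diag.
  by move=> k ki kj; rewrite /flip h_support // leq_sub2r // ltnW.
have -> : pser sol i j = g i j.
  by rewrite /pser !fctE /flip [g j i]gser_support ?addr0 // ltnW.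
have -> : h i j + flip h i j = h i j by rewrite /flip (h_support (ltnW ij)) addr0.
have hE : h = euler m (xvar R) + euler m G.
  by apply/funext => k; apply/funext => l; rewrite /hser /euler /gser !fctE mulrDr.
have -> : cauchy dd h i j = cauchy dd (euler m (xvar R)) i j + cauchy dd (euler m G) i j.
  by rewrite hE cauchyDr !fctE.
rewrite addr0; case: i ij => // i; rewrite ltnS cauchy_euler_xvar => ij.
case: (eqVneq i j) => [->|nij].
  have -> : cauchy dd (euler m G) j.+1 j = 0.
    apply: cauchy_diag0; first exact: dd_diag.
    move=> k ki kj; rewrite /euler shape_support ?mulr0 //; clear -kj; lia.
  rewrite addr0 mulNr omega_fixed opprK /hser /euler.
  have gE : g j.+1 j = (j == 0)%:R.
    rewrite /gser !fctE shape_support ?addr0 /xvar; last by clear; lia.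
    by case: j {ij} => [|j].
  rewrite gE t2; case: (j) => [|k] /=; last by ring.
  by field.
rewrite (dd_diag nij) mulr0 add0r.
have ij2 : (j + 2 <= i.+1)%N by clear -ij nij; lia.
have e := shape_fixed ij2.
have gE : g i.+1 j = G i.+1 j.
  rewrite /gser !fctE /xvar eqSS; case: ifP => [/andP[/eqP i0 /eqP j0]|_]; last by rewrite add0r.
  by move: nij; rewrite i0 j0.
rewrite /hser /euler gE t2.
have e2 : (i.+1 - j - 1)%:R = i.+1%:R - j%:R - 1 :> R.
  by rewrite !natrB //; clear -ij ij2; lia.
rewrite e2 in e.
have -> : cauchy dd (euler m G) i.+1 j = (i.+1%:R - j%:R - 1) * G i.+1 j + rem i.+1 j.
  by rewrite e subrK.
by field.
Qed.

Lemma rem_symmetric : flip rem = rem.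
Proof.
have std : flip (tdser tau sol) = tdser tau sol.
  by apply: symmetricD; [exact: flip_cnst|exact: delta_flip].
have som : flip (omser tau sol) = omser tau sol.
  by apply: symmetricD; [exact: flip_cnst|exact: delta_flip].
have sk2 : flip (k2ser m sol) = k2ser m sol.
  by apply: symmetricD; [exact: symmetric_addflip|exact: symmetric_mulflip].
have skk : flip (kkser m sol) = kkser m sol.
  by apply: symmetricD; [exact: symmetric_addflip|exact: symmetric_mulflip].
have sp : flip (pser sol) = pser sol by exact: symmetric_addflip.
have sg : flip (sigser m sol) = sigser m sol by exact: flip_mirror.
have sps := symmetricD sp sg.
have C := symmetric_cauchy.
have sq2 : flip (q2ser m tau sol) = q2ser m tau sol.
  apply: symmetricD; first by apply: (C _ _ (C _ _ std som)); exact: symmetricZ.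
  exact: (C _ _ (C _ _ som som) (C _ _ sps sps)).
apply: symmetricD; last first.
  apply: symmetricN; exact: (C _ _ (C _ _ som som) (symmetric_mulflip _)).
apply: symmetricD; last exact: (C _ _ sq2 (symmetric_mulflip _)).
apply: symmetricD; first exact: (C _ _ (C _ _ std std) sk2).
by apply: (C _ _ (C _ _ std som)); apply: symmetricZ; exact: C.
Qed.

Lemma defect_symmetric : flip defect = defect.
Proof.
have std : flip (tdser tau sol) = tdser tau sol.
  by apply: symmetricD; [exact: flip_cnst|exact: delta_flip].
have C := symmetric_cauchy.
apply: symmetricD; last first.
  by apply: symmetricN; apply: (C _ _ (C _ _ std std)); exact: symmetric_addflip.
apply: symmetricD; first exact: rem_symmetric.
by apply: symmetricN; exact: symmetric_addflip.
Qed.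

Lemma defect_diag i j : i != j -> defect i j = 0.
Proof.
rewrite neq_ltn => /orP[ij|]; last exact: defect_upper.
by rewrite -defect_symmetric /flip defect_upper.
Qed.

End FormalIdentity.

(** * Bernoulli's law on the circle *)

Section ConjugationMorphism.
Variable R : realType.
Implicit Types z w : R[i].

Lemma conjcD z w : ((z + w)^*)%C = (z^*)%C + (w^*)%C.
Proof. exact: (rmorphD (@conjc R)). Qed.

Lemma conjcN z : ((- z)^*)%C = - (z^*)%C.
Proof. exact: (rmorphN (@conjc R)). Qed.

Lemma conjcM z w : ((z * w)^*)%C = (z^*)%C * (w^*)%C.
Proof. exact: (rmorphM (@conjc R)). Qed.

End ConjugationMorphism.

Section EvaluatedIdentity.
Variables (R : realType) (m : nat) (tau r : R) (s : series R).
Hypothesis r0 : 0 < r.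
Hypothesis hinv : inverse_tail s = inverse_next m s.
Hypothesis ng : bounded_array r (gser s).
Hypothesis nh : bounded_array r (hser m s).
Hypothesis nkap : bounded_array r (inverse_tail s).
Hypothesis nd : bounded_array r (omega_tail s).

Local Notation delta := (omega_tail s).
Local Notation g := (gser s).
Local Notation h := (hser m s).
Local Notation al := (aser m s).
Local Notation k := (kser m s).
Local Notation om := (omser tau s).
Local Notation td := (tdser tau s).
Local Notation kap := (inverse_tail s).
Local Notation sig := (sigser m s).

(** The coefficients of the holomorphic part of the lab-frame flow. *)
Definition flow_part : nat -> nat -> R := h + cauchy al (flip g) - sig.

Let C := @bounded_array_cauchy R r r0.
Let F := @bounded_array_flip R r.
Let D := @bounded_arrayD R r r0.
Let Z := @bounded_arrayZ R r.
Let N := @bounded_arrayN R r.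
Let K := @bounded_array_cnst R r.

Lemma bounded_aser : bounded_array r al. Proof. exact: (D ng nh). Qed.

Lemma bounded_kser : bounded_array r k.
Proof. exact: (D nkap (N bounded_aser)). Qed.

Lemma bounded_omser : bounded_array r om. Proof. exact: (D (K _) nd). Qed.

Lemma bounded_tdser : bounded_array r td. Proof. exact: (D (K _) nd). Qed.

Lemma bounded_sigser : bounded_array r sig.
Proof. exact: (bounded_array_mirror r0 (C bounded_aser (F ng))). Qed.

Lemma bounded_flow_part : bounded_array r flow_part.
Proof. exact: (D (D nh (C bounded_aser (F ng))) (N bounded_sigser)). Qed.

Variable x : R[i].
Hypothesis xr : normc x <= r.

Lemma ev_al : ev x al = ev x g + ev x h.
Proof. exact: (evD r0 xr ng nh). Qed.

Lemma ev_inverse : (1 + ev x k) * (1 + ev x al) = 1.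
Proof.
have na := bounded_aser.
have e : ev x kap = ev x al * ev x al - ev x al * ev x kap.
  rewrite {1}hinv (evB r0 xr (C na na) (C na nkap)).
  by rewrite (ev_cauchy r0 xr na na) (ev_cauchy r0 xr na nkap).
rewrite (evB r0 xr nkap na).
have -> : (1 + (ev x kap - ev x al)) * (1 + ev x al) =
   1 + ev x kap - (ev x al * ev x al - ev x al * ev x kap) by ring.
by rewrite -e addrK.
Qed.

Definition mean_flow : R[i] := 1 + ev x g + ((ev x g)^*)%C + ev x sig.

Lemma mean_flow_conj : ((mean_flow)^*)%C = mean_flow.
Proof.
rewrite /mean_flow !conjcD conjcK conjc1 -(ev_flip r0 xr bounded_sigser).
by rewrite [flip _]flip_mirror; ring.
Qed.

(** The holomorphic part of the lab flow and the mean flow add up to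
    [F' conj(1 + g)]. *)
Lemma mean_flow_split :
  mean_flow + ev x flow_part = (1 + ev x al) * (((1 + ev x g)^*)%C).
Proof.
have na := bounded_aser; have nc := C na (F ng).
rewrite (evB r0 xr (D nh nc) bounded_sigser) (evD r0 xr nh nc).
rewrite (ev_cauchy r0 xr na (F ng)) (ev_flip r0 xr ng) conjcD conjc1.
by rewrite /mean_flow ev_al; ring.
Qed.

Lemma ev_omser : ev x om = 1 + tau%:C%C + ev x delta.
Proof. by rewrite (evD r0 xr (K _) nd) (ev_cnst r0 xr) rmorphD rmorph1. Qed.

Definition defect_of : nat -> nat -> R :=
  remser m tau s - pser s - cauchy (cauchy td td) (h + flip h).

(** Pure algebra, once the product of the two inverse series is known to be one;
    the formal law thus holds for the values. *)
Lemma bernoulli :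
  (1 - ev x om * mean_flow) ^+ 2 * ((1 + ev x k) * ((1 + ev x k)^*)%C) -
  ev x om ^+ 2 * ((1 + ev x g) * ((1 + ev x g)^*)%C) =
  (tau%:C%C + ev x delta) ^+ 2 - (1 + tau%:C%C + ev x delta) ^+ 2 +
  ev x defect_of.
Proof.
have na := bounded_aser; have nk := bounded_kser; have nom := bounded_omser.
have ntd := bounded_tdser; have nsig := bounded_sigser.
have etd : ev x td = tau%:C%C + ev x delta.
  by rewrite (evD r0 xr (K _) nd) (ev_cnst r0 xr).
have evF a : bounded_array r a -> ev x (flip a) = ((ev x a)^*)%C by exact: (ev_flip r0 xr).
have evC a b : bounded_array r a -> bounded_array r b ->
  ev x (cauchy a b) = ev x a * ev x b by exact: (ev_cauchy r0 xr).
have evA a b : bounded_array r a -> bounded_array r b ->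
  ev x (a + b) = ev x a + ev x b by exact: (evD r0 xr).
have evS a b : bounded_array r a -> bounded_array r b ->
  ev x (a - b) = ev x a - ev x b by exact: (evB r0 xr).
have np : bounded_array r (pser s) := D ng (F ng).
have ep : ev x (pser s) = ev x g + ((ev x g)^*)%C by rewrite (evA _ _ ng (F ng)) evF.
have nkn : bounded_array r (inverse_next m s) by rewrite -hinv.
have nkf := C nk (F nk).
have ekf : ev x (cauchy k (flip k)) = ev x k * ((ev x k)^*)%C by rewrite (evC _ _ nk (F nk)) evF.
have nk2 : bounded_array r (k2ser m s) := D (D nkn (F nkn)) nkf.
have ek2 : ev x (k2ser m s) = ev x kap + ((ev x kap)^*)%C + ev x k * ((ev x k)^*)%C.
  by rewrite (evA _ _ (D nkn (F nkn)) nkf) ekf (evA _ _ nkn (F nkn)) (evF _ nkn) -hinv.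
have nkk : bounded_array r (kkser m s) := D (D nk (F nk)) nkf.
have ekk : ev x (kkser m s) = ev x k + ((ev x k)^*)%C + ev x k * ((ev x k)^*)%C.
  by rewrite (evA _ _ (D nk (F nk)) nkf) ekf (evA _ _ nk (F nk)) (evF _ nk).
have nps := D np nsig.
have nto := C ntd nom; have noo := C nom nom; have ntt := C ntd ntd.
have nq2 : bounded_array r (q2ser m tau s) := D (C nto (Z 2 nsig)) (C noo (C nps nps)).
have eq2 : ev x (q2ser m tau s) = ev x td * ev x om * (2%:C%C * ev x sig) +
    ev x om * ev x om * (ev x (pser s) + ev x sig) ^+ 2.
  rewrite (evA _ _ (C nto (Z 2 nsig)) (C noo (C nps nps))).
  rewrite (evC _ _ nto (Z 2 nsig)) (evC _ _ ntd nom) (evZ r0 xr 2 nsig).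
  rewrite (evC _ _ noo (C nps nps)) (evC _ _ nom nom) (evC _ _ nps nps) (evA _ _ np nsig).
  by rewrite expr2.
have nk1 := D (K 1) nk.
have ek1 : ev x (cnst 1 + k) = 1 + ev x k by rewrite (evA _ _ (K 1) nk) (ev_cnst r0 xr).
have n1 := C ntt nk2.
have n2 := C nto (Z 2 (C np nkk)).
have n3 := C nq2 (C nk1 (F nk1)).
have n4 := C noo (C ng (F ng)).
have nrem : bounded_array r (remser m tau s) := D (D (D n1 n2) n3) (N n4).
have erem : ev x (remser m tau s) =
   ev x td * ev x td * ev x (k2ser m s) +
   ev x td * ev x om * (2%:C%C * (ev x (pser s) * ev x (kkser m s))) +
   ev x (q2ser m tau s) * ((1 + ev x k) * ((1 + ev x k)^*)%C) -
   ev x om * ev x om * (ev x g * ((ev x g)^*)%C).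
  rewrite (evS _ _ (D (D n1 n2) n3) n4) (evA _ _ (D n1 n2) n3) (evA _ _ n1 n2).
  rewrite (evC _ _ ntt nk2) (evC _ _ ntd ntd).
  rewrite (evC _ _ nto (Z 2 (C np nkk))) (evC _ _ ntd nom) (evZ r0 xr 2 (C np nkk)).
  rewrite (evC _ _ np nkk) (evC _ _ nq2 (C nk1 (F nk1))) (evC _ _ nk1 (F nk1)).
  rewrite (evF _ nk1) ek1 (evC _ _ noo (C ng (F ng))) (evC _ _ nom nom).
  by rewrite (evC _ _ ng (F ng)) (evF _ ng).
have nhh := D nh (F nh).
have edef : ev x defect_of = ev x (remser m tau s) - ev x (pser s) -
    ev x td * ev x td * (ev x h + ((ev x h)^*)%C).
  rewrite (evS _ _ (D nrem (N np)) (C ntt nhh)) (evS _ _ nrem np) (evC _ _ ntt nhh).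
  by rewrite (evC _ _ ntd ntd) (evA _ _ nh (F nh)) (evF _ nh).
have eka : ev x kap = ev x k + ev x g + ev x h.
  by rewrite (evS _ _ nkap na) ev_al; ring.
rewrite edef erem eq2 ek2 ekk ep eka ev_omser etd /mean_flow !conjcD conjc1.
rewrite (_ : 2%:C%C = 2); last by rewrite (rmorph_nat (real_complex R)).
by ring.
Qed.

End EvaluatedIdentity.

(** * Flows with holomorphic conjugate lab velocity *)

Lemma local_lipschitz_continuous (R : realType) (V W : normedModType R)
    (f : V -> W) (x : V) (K eta : R) : 0 < eta ->
  (forall y, `|x - y| < eta -> `|f x - f y| <= K * `|x - y|) ->
  {for x, continuous f}.
Proof.
move=> eta0 h; apply/cvgrPdist_lt => eps eps0.
have K1 : 0 < `|K| + 1 by rewrite ltr_wpDl.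
have d0 : 0 < Num.min eta (eps / (`|K| + 1)) by rewrite lt_min eta0 divr_gt0.
apply/nbhs_ballP; exists (Num.min eta (eps / (`|K| + 1))) => //= y.
rewrite -ball_normE /= lt_min => /andP[h1 h2].
apply: le_lt_trans (h y h1) _; apply: (@le_lt_trans _ _ ((`|K| + 1) * `|x - y|)).
  by rewrite ler_wpM2r // (le_trans (ler_norm K)) // lerDl.
by rewrite mulrC -ltr_pdivlMr.
Qed.

Section PlaneDifferential.
Variables (R : realType) (W : normedModType R).
Implicit Types x y : R * R.

Definition plane_linear (a b : W) (h : R * R) : W := h.1 *: a + h.2 *: b.

Lemma plane_linear_is_linear a b : linear (plane_linear a b).
Proof.
move=> k u v; rewrite /plane_linear /= scalerDr !scalerDl !scalerA.
by rewrite addrACA.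
Qed.

HB.instance Definition _ a b := GRing.isLinear.Build R (R * R)%type W *:%R
  (plane_linear a b) (plane_linear_is_linear a b).

Lemma quadratic_differentiable (f : R * R -> W) x (a b : W) (K eta : R) :
  0 < eta ->
  (forall y, `|y - x| < eta ->
     `|f y - f x - plane_linear a b (y - x)| <= K * `|y - x| ^+ 2) ->
  [/\ differentiable f x, pdx f x = a & pdy f x = b].
Proof.
move=> eta0 hf.
have lc : continuous (plane_linear a b).
  apply: (@lipschitz_continuous _ _ _ _ (`|a| + `|b|)) => u v.
  rewrite -linearB /plane_linear; apply: le_trans (ler_normD _ _) _.
  rewrite !normrZ mulrDl lerD // mulrC ler_wpM2l // prod_normE /= le_max lexx ?orbT //.
have lo : f \o shift x = cst (f x) + plane_linear a b +o_ (0 : R * R) id.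
  apply/eqaddoP => _ /posnumP[e].
  have K1 : 0 < `|K| + 1 by rewrite ltr_wpDl.
  have d0 : 0 < Num.min eta (e%:num / (`|K| + 1)) by rewrite lt_min eta0 divr_gt0.
  apply/nbhs_ballP; exists (Num.min eta (e%:num / (`|K| + 1))) => //= h.
  rewrite -ball_normE /= sub0r normrN lt_min => /andP[hs hk].
  rewrite !fctE /=.
  have := hf (h + x); rewrite addrK => /(_ hs) q.
  rewrite opprD addrA; apply: le_trans q _.
  rewrite expr2 mulrA ler_wpM2r //.
  rewrite ltr_pdivlMr // in hk; apply: le_trans (ltW hk).
  by rewrite mulrC ler_wpM2l // (le_trans (ler_norm K)) // lerDl.
have dfE : 'd f x = plane_linear a b :> (R * R -> W) by exact: diff_unique lo.
have df : differentiable f x.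
  by apply/diff_locallyP; rewrite dfE; split.
split => //.
  by rewrite /pdx deriveE // dfE /plane_linear /= scale1r scale0r addr0.
by rewrite /pdy deriveE // dfE /plane_linear /= scale1r scale0r add0r.
Qed.

End PlaneDifferential.

Lemma derive_sum_squares (R : realType) (V : normedModType R) (f1 f2 e1 e2 : V -> R)
    (c1 c2 : R) (x v : V) :
  differentiable f1 x -> differentiable f2 x ->
  differentiable e1 x -> differentiable e2 x ->
  'D_v (c1 *: (f1 * f1 + f2 * f2) + c2 *: (e1 * e1 + e2 * e2)) x =
  c1 * 2 * (f1 x * 'D_v f1 x + f2 x * 'D_v f2 x) +
  c2 * 2 * (e1 x * 'D_v e1 x + e2 x * 'D_v e2 x).
Proof.
move=> h1 h2 h3 h4.
have D1 := differentiableM h1 h1; have D2 := differentiableM h2 h2.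
have D3 := differentiableM h3 h3; have D4 := differentiableM h4 h4.
have D12 := differentiableD D1 D2; have D34 := differentiableD D3 D4.
have dd f : differentiable f x -> derivable (f : V -> R) x v by move/diff_derivable.
rewrite (deriveD (dd _ (differentiableZ c1 D12)) (dd _ (differentiableZ c2 D34))).
rewrite (deriveZ c1 (dd _ D12)) (deriveZ c2 (dd _ D34)).
rewrite (deriveD (dd _ D1) (dd _ D2)) (deriveD (dd _ D3) (dd _ D4)).
rewrite (deriveM (dd _ h1) (dd _ h1)) (deriveM (dd _ h2) (dd _ h2)).
rewrite (deriveM (dd _ h3) (dd _ h3)) (deriveM (dd _ h4) (dd _ h4)).
by rewrite /GRing.scale /=; ring.
Qed.

Section RelativeFlow.
Variables (R : realType) (D : set (R * R)) (w w' : R[i] -> R[i]) (Omega : R).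
Hypothesis D_open : open D.
Hypothesis w_C11 : forall x, D x -> C11 w w' (complex_of x).
Implicit Types x y : R * R.

(** The velocity in the rotating frame, when [w] is the conjugate of the velocity in
    the lab frame. *)
Definition relative_velocity x : R * R :=
  plane_of ((w (complex_of x))^*)%C - Omega *: perp x.

Definition bernoulli_pressure x : R :=
  - (dotp (relative_velocity x) (relative_velocity x) / 2)
  + Omega ^+ 2 / 2 * dotp x x.

Local Notation U := relative_velocity.
Local Notation P := bernoulli_pressure.
Local Notation a x := (cRe (w' (complex_of x))).
Local Notation b x := (cIm (w' (complex_of x))).

Lemma conj_flow_quadratic x : D x -> exists K eta : R, 0 < eta /\
  forall y, `|y - x| < eta ->
  `|U y - U x - plane_linear (a x, - b x - Omega) (- b x + Omega, - a x) (y - x)| <=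
    K * `|y - x| ^+ 2.
Proof.
move=> /w_C11[K [eta [eta0 [K0 h]]]].
exists (K * 4), (eta / 2); split; first by rewrite divr_gt0.
move=> y yx.
have n1 : normc (complex_of y - complex_of x) < eta.
  rewrite -complex_ofB; apply: le_lt_trans (normc_le_norm _) _.
  by rewrite mulrC -ltr_pdivlMr.
have n0 : normc (complex_of x - complex_of x) < eta.
  by rewrite subrr ComplexField.Normc.normc0.
have := h _ _ n0 n1 => q.
have -> : U y - U x - plane_linear (a x, - b x - Omega) (- b x + Omega, - a x) (y - x) =
    plane_of ((w (complex_of y) - w (complex_of x) -
      w' (complex_of x) * (complex_of y - complex_of x))^*)%C.
  rewrite /relative_velocity /plane_linear /perp /plane_of.
  case: (w (complex_of y)) (w (complex_of x)) (w' (complex_of x)) => c1 c2 [c3 c4] [c5 c6].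
  case: x {q n0 n1 yx h} y => x1 x2 [y1 y2].
  rewrite /complex_of /=; congr (_, _).
    change (c1 - Omega * - y2 - (c3 - Omega * - x2) -
      ((y1 - x1) * c5 + (y2 - x2) * (- c6 + Omega)) =
      c1 - c3 - (c5 * (y1 - x1) - c6 * (y2 - x2))).
    by ring.
  change (- c2 - Omega * y1 - (- c4 - Omega * x1) -
    ((y1 - x1) * (- c6 - Omega) + (y2 - x2) * - c5) =
    - (c2 - c4 - (c5 * (y2 - x2) + c6 * (y1 - x1)))).
  by ring.
apply: le_trans (plane_of_norm_le _) _; rewrite normc_conj; apply: le_trans q _.
rewrite -mulrA ler_wpM2l // -complex_ofB.
have := normc_le_norm (y - x); have := normc_ge0 (complex_of (y - x)) => p1 p2.
have -> : 4 * `|y - x| ^+ 2 = (2 * `|y - x|) ^+ 2 by ring.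
by rewrite lerXn2r ?nnegrE ?mulr_ge0.
Qed.

Lemma velocity_derivatives x : D x ->
  [/\ differentiable U x, pdx U x = (a x, - b x - Omega)
    & pdy U x = (- b x + Omega, - a x)].
Proof.
move=> Dx; have [K [eta [eta0 h]]] := conj_flow_quadratic Dx.
exact: quadratic_differentiable eta0 h.
Qed.

Lemma velocity_component_derivatives x : D x ->
  [/\ differentiable (fun y => (U y).1) x,
      'D_(1, 0) (fun y => (U y).1) x = a x & 'D_(0, 1) (fun y => (U y).1) x = - b x + Omega] /\
  [/\ differentiable (fun y => (U y).2) x,
      'D_(1, 0) (fun y => (U y).2) x = - b x - Omega & 'D_(0, 1) (fun y => (U y).2) x = - a x].
Proof.
move=> Dx; have [K [eta [eta0 h]]] := conj_flow_quadratic Dx.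
split.
- apply: (@quadratic_differentiable R R _ x (a x) (- b x + Omega) K eta eta0) => y /h.
  by apply: le_trans; rewrite [leRHS]prod_normE /= le_max lexx.
- apply: (@quadratic_differentiable R R _ x (- b x - Omega) (- a x) K eta eta0) => y /h.
  by apply: le_trans; rewrite [leRHS]prod_normE /= le_max lexx orbT.
Qed.

Lemma coordinate_derivatives x :
  [/\ differentiable (fun y : R * R => y.1) x,
      'D_(1, 0) (fun y : R * R => y.1) x = 1 & 'D_(0, 1) (fun y : R * R => y.1) x = 0] /\
  [/\ differentiable (fun y : R * R => y.2) x,
      'D_(1, 0) (fun y : R * R => y.2) x = 0 & 'D_(0, 1) (fun y : R * R => y.2) x = 1].
Proof.
split.
- apply: (@quadratic_differentiable R R _ x 1 0 0 1 ltr01) => y _.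
  by rewrite /plane_linear /= scaler0 addr0 /GRing.scale /= mulr1 subrr normr0 mul0r.
- apply: (@quadratic_differentiable R R _ x 0 1 0 1 ltr01) => y _.
  by rewrite /plane_linear /= scaler0 add0r /GRing.scale /= mulr1 subrr normr0 mul0r.
Qed.

Lemma pressure_derivatives x : D x ->
  [/\ differentiable P x,
      pdx P x = - ((U x).1 * a x + (U x).2 * (- b x - Omega)) + Omega ^+ 2 * x.1
    & pdy P x = - ((U x).1 * (- b x + Omega) + (U x).2 * (- a x)) + Omega ^+ 2 * x.2].
Proof.
move=> Dx; have [[d1 x1 y1] [d2 x2 y2]] := velocity_component_derivatives Dx.
have [[e1 u1 v1] [e2 u2 v2]] := coordinate_derivatives x.
have PE : P = (- 2^-1) *: ((fun y => (U y).1) * (fun y => (U y).1) +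
    (fun y => (U y).2) * (fun y => (U y).2)) +
    (Omega ^+ 2 / 2) *: ((fun y : R * R => y.1) * (fun y : R * R => y.1) +
    (fun y : R * R => y.2) * (fun y : R * R => y.2)).
  apply/funext => y; rewrite !fctE /bernoulli_pressure /dotp /GRing.scale /=.
  by ring.
have D11 := differentiableM d1 d1; have D22 := differentiableM d2 d2.
have E11 := differentiableM e1 e1; have E22 := differentiableM e2 e2.
have DP : differentiable P x.
  by rewrite PE; apply: differentiableD; apply: differentiableZ; apply: differentiableD.
have dv v : 'D_v P x = - ((U x).1 * 'D_v (fun y => (U y).1) x +
      (U x).2 * 'D_v (fun y => (U y).2) x) +
    Omega ^+ 2 * (x.1 * 'D_v (fun y : R * R => y.1) x +
      x.2 * 'D_v (fun y : R * R => y.2) x).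
  rewrite PE (derive_sum_squares (- 2^-1) (Omega ^+ 2 / 2) v d1 d2 e1 e2).
  by field.
split => //.
- by rewrite /pdx dv x1 x2 u1 u2 mulr1 mulr0 addr0.
- by rewrite /pdy dv y1 y2 v1 v2 mulr1 mulr0 add0r.
Qed.

(** Conjugates of holomorphic functions are divergence-free and irrotational, and
    the rotation of the frame adds [- 2 Omega] to the curl; the momentum
    equation is then the identity for the gradient of the kinetic energy. *)
Lemma flow_equations x : D x ->
  [/\ advection U x + (2 * Omega) *: perp (U x) - Omega ^+ 2 *: x = - gradient P x,
      divergence U x = 0 & curl U x = - (2 * Omega)].
Proof.
move=> Dx; have [_ hx hy] := velocity_derivatives Dx.
have [_ px py] := pressure_derivatives Dx.
rewrite /advection /gradient /divergence /curl hx hy px py.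
move: (U x) (a x) (b x) => [u1 u2] p q; rewrite /perp; split; last 2 first.
- by rewrite /= subrr.
- by rewrite /=; ring.
case: x {Dx hx hy px py} => x1 x2; rewrite /=; congr (_, _).
  change (u1 * p + u2 * (- q + Omega) + 2 * Omega * - u2 - Omega ^+ 2 * x1 =
    - (- (u1 * p + u2 * (- q - Omega)) + Omega ^+ 2 * x1)).
  by ring.
change (u1 * (- q - Omega) + u2 * - p + 2 * Omega * u1 - Omega ^+ 2 * x2 =
  - (- (u1 * (- q + Omega) + u2 * - p) + Omega ^+ 2 * x2)).
by ring.
Qed.

Lemma derivative_continuous x : D x ->
  {for x, continuous (fun y => a y)} /\ {for x, continuous (fun y => b y)}.
Proof.
move=> /w_C11/C11_lipschitz[L [eta [eta0 [L0 h]]]].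
have key (f : R[i] -> R) : (forall z z', `|f z - f z'| <= normc (z - z')) ->
    {for x, continuous (fun y => f (w' (complex_of y)))}.
  move=> hf.
  have e20 : 0 < eta / 2 by rewrite divr_gt0.
  apply: (@local_lipschitz_continuous _ _ _ _ x (L * 2) (eta / 2) e20) => y h1.
  have n1 : normc (complex_of y - complex_of x) < eta.
    rewrite normcB -complex_ofB; apply: le_lt_trans (normc_le_norm _) _.
    by rewrite mulrC -ltr_pdivlMr.
  have n0 : normc (complex_of x - complex_of x) < eta.
    by rewrite subrr ComplexField.Normc.normc0.
  have [_ _ q _ _] := h _ _ n1 n0.
  apply: le_trans (hf _ _) _; apply: le_trans q _.
  by rewrite -complex_ofB -mulrA ler_wpM2l // normc_le_norm.
by split; apply: key => z z'; [apply: le_trans (abs_Re_le (z - z'))|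
  apply: le_trans (abs_Im_le (z - z'))]; case: z z' => ? ? [].
Qed.

Lemma flow_C1 : C1_on D U /\ C1_on D P.
Proof.
have nearD x : D x -> \forall y \near x, D y by move=> Dx; exact: open_nbhs_nbhs.
have nfor (V : normedModType R) (f g : R * R -> V) x : D x ->
    (forall y, D y -> f y = g y) -> {for x, continuous g} -> {for x, continuous f}.
  move=> Dx fg cg; rewrite /prop_for /continuous_at fg //.
  apply: cvg_trans cg; apply: near_eq_cvg; near=> y; apply/esym/fg; near: y.
  exact: nearD.
have cpair (f g : R * R -> R) x : {for x, continuous f} -> {for x, continuous g} ->
  {for x, continuous (fun y => (f y, g y))} by move=> cf cg; apply: (cvg_pair cf cg); exact: nbhs_filter.
split=> x Dx; have [ca cb] := derivative_continuous Dx.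
  have [d _ _] := velocity_derivatives Dx; split => //.
  have cO : {for x, continuous (fun=> Omega)} by exact: cvg_cst.
  split.
  - apply: (nfor _ _ (fun y => (a y, - b y - Omega)) _ Dx).
      by move=> y /velocity_derivatives[].
    apply: (cpair (fun y => a y) (fun y => - b y - Omega) x ca).
    by apply: continuousB => //; exact: continuousN.
  - apply: (nfor _ _ (fun y => (- b y + Omega, - a y)) _ Dx).
      by move=> y /velocity_derivatives[].
    apply: (cpair (fun y => - b y + Omega) (fun y => - a y)).
      by apply: continuousD => //; exact: continuousN.
    exact: continuousN.
have [d _ _] := pressure_derivatives Dx; split => //.
have [[d1 _ _] [d2 _ _]] := velocity_component_derivatives Dx.
have [[e1 _ _] [e2 _ _]] := coordinate_derivatives x.
have c1 := differentiable_continuous d1; have c2 := differentiable_continuous d2.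
have f1 := differentiable_continuous e1; have f2 := differentiable_continuous e2.
have cO : {for x, continuous (fun=> Omega)} by exact: cvg_cst.
have cOO : {for x, continuous (fun=> Omega ^+ 2)} by exact: cvg_cst.
split.
- apply: (nfor _ _ (fun y => - ((U y).1 * a y + (U y).2 * (- b y - Omega)) +
    Omega ^+ 2 * y.1) _ Dx); first by move=> y /pressure_derivatives[].
  apply: continuousD; last exact: continuousM.
  apply: continuousN; apply: continuousD; first exact: continuousM.
  by apply: continuousM => //; apply: continuousB => //; exact: continuousN.
- apply: (nfor _ _ (fun y => - ((U y).1 * (- b y + Omega) + (U y).2 * (- a y)) +
    Omega ^+ 2 * y.2) _ Dx); first by move=> y /pressure_derivatives[].
  apply: continuousD; last exact: continuousM.
  apply: continuousN; apply: continuousD; apply: continuousM => //.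
    by apply: continuousD => //; exact: continuousN.
  exact: continuousN.
Unshelve. all: by end_near. Qed.

End RelativeFlow.

(** * The area enclosed by the boundary *)

Section AreaOfCore.
Variables (R : realType) (p : R[i] -> R[i]) (x y x' : R -> R).
Hypothesis p_lip : forall u v, normc u <= 1 -> normc v <= 1 ->
  normc (p u - p v) <= 2^-1 * normc (u - v).
Hypothesis p_real : forall u, normc u <= 1 -> p (u^*)%C = ((p u)^*)%C.
Hypothesis trace : forall t, plane_of (Phi p (expi t)) = (x t, y t).
Hypothesis x_decreasing : {in `[0, pi] &, {homo x : s t /~ s < t}}.
Hypothesis y_pos : forall t : R, 0 < t < pi -> 0 < y t.
Hypothesis x_derive : forall t : R, is_derive t 1 x (x' t).
Hypothesis x'_continuous : continuous x'.
Hypothesis y_continuous : continuous y.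
Implicit Types (u v s t : R).

Local Notation pi := (@pi R).
Local Notation rho := (radial p).

Lemma Phi_conj z : Phi p (z^*)%C = ((Phi p z)^*)%C.
Proof.
rewrite /Phi conjcD -p_real ?fold_le1 // /fold normc_conj; case: ifP => // _.
by rewrite [in RHS]fmorphV.
Qed.

Lemma Psi_conj z : Psi p (z^*)%C = ((Psi p z)^*)%C.
Proof. by apply: (Phi_inj p_lip); rewrite Phi_conj !PhiK. Qed.

Lemma radial_opp u v : rho (u, - v) = rho (u, v).
Proof. by rewrite /radial -[LHS]normc_conj -Psi_conj /complex_of /= opprK. Qed.

Lemma radial_trace t : rho (x t, y t) = 1.
Proof. by rewrite /radial -trace plane_ofK (PsiK p_lip) normc_expi. Qed.

Lemma trace_opp t : x (- t) = x t /\ y (- t) = - y t.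
Proof.
have := trace (- t); rewrite expiN Phi_conj.
by have := trace t; case: (Phi p (expi t)) => a b [-> ->] [-> ->].
Qed.

Lemma y_ends : y 0 = 0 /\ y pi = 0.
Proof.
split; first by have [_] := trace_opp 0; rewrite oppr0; lra.
have := trace (- pi); have [-> ->] := trace_opp pi.
have -> : expi (- pi) = expi pi by rewrite /expi cosN sinN sinpi oppr0.
by rewrite trace => -[]; lra.
Qed.

Lemma y_ge0 t : 0 <= t <= pi -> 0 <= y t.
Proof.
have [y0 yp] := y_ends.
move=> /andP[]; rewrite le_eqVlt => /predU1P[<- _|t0]; first by rewrite y0.
rewrite le_eqVlt => /predU1P[->|tp]; first by rewrite yp.
by apply/ltW/y_pos; rewrite t0.
Qed.

Lemma x_inj s t : 0 <= s <= pi -> 0 <= t <= pi -> x s = x t -> s = t.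
Proof.
move=> hs ht e; case: (ltgtP s t) => // st.
  by have := x_decreasing (_ : t \in _) (_ : s \in _) st; rewrite !in_itv /= e ltxx => /(_ ht hs).
by have := x_decreasing (_ : s \in _) (_ : t \in _) st; rewrite !in_itv /= e ltxx => /(_ hs ht).
Qed.

Definition angle u := xget 0 [set t | 0 <= t <= pi /\ x t = u].

Lemma angleK t : 0 <= t <= pi -> angle (x t) = t.
Proof.
move=> ht; have : exists s, 0 <= s <= pi /\ x s = x t by exists t.
by move=> /(xgetPex 0)[h1 h2]; exact: x_inj.
Qed.

Let pi_ge0' : 0 <= pi. Proof. exact: pi_ge0. Qed.

Lemma x_range t : 0 <= t <= pi -> x pi <= x t <= x 0.
Proof.
have h := ltW_nhomo_in x_decreasing.
by move=> /andP[h1 h2]; rewrite !h ?in_itv /= ?h1 ?h2 ?lexx ?pi_ge0'.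
Qed.

Lemma x_onto u : x pi <= u <= x 0 -> exists2 t, 0 <= t <= pi & x t = u.
Proof.
move=> hu; have cx : {within `[0, pi], continuous x}.
  apply: continuous_subspaceT => t.
  by apply/differentiable_continuous/derivable1_diffP; case: (x_derive t).
have [|t ht <-] := IVT (v := u) pi_ge0' cx.
  have /andP[h1 h2] := hu; have h3 := le_trans h1 h2.
  by rewrite min_r // max_l.
by exists t => //; move: ht; rewrite in_itv.
Qed.

Lemma radial_eq1 u v : rho (u, v) = 1 ->
  exists2 t, 0 <= t <= pi & u = x t /\ `|v| = y t.
Proof.
move=> h; have [t /andP[t1 t2] e] := expi_surj h.
have : (u, v) = (x t, y t).
  by rewrite -trace -e PhiK // complex_ofK.
move=> [-> ->]; have [xe yo] := trace_opp t.
case: (lerP 0 t) => t0.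
  by exists t; rewrite ?t0 // ger0_norm // y_ge0 // t0.
exists (- t); first by rewrite oppr_ge0 (ltW t0) lerNl.
by rewrite xe yo ler0_norm // -oppr_ge0 -yo y_ge0 // oppr_ge0 (ltW t0) lerNl.
Qed.

(** By the intermediate value theorem a path that avoids the boundary stays on
    one side of it. *)
Lemma radial_path (q : R -> R * R) a b : continuous q ->
  (forall s, Num.min a b <= s <= Num.max a b -> rho (q s) != 1) ->
  rho (q a) < 1 -> rho (q b) < 1.
Proof.
move=> cq h ra; rewrite ltNge; apply/negP => rb.
have cr (A : set R) : {within A, continuous (rho \o q)}.
  apply: continuous_subspaceT => s.
  by apply: continuous_comp; [exact: cq|exact: radial_continuous].
have hv : Num.min (rho (q a)) (rho (q b)) <= 1 <= Num.max (rho (q a)) (rho (q b)).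
  by rewrite ge_min le_max (ltW ra) rb orbT.
have [ab|/ltW ba] := leP a b.
- have [s] := IVT ab (cr _) hv; rewrite in_itv /= => hs e.
  by have := h s; rewrite min_l // max_r // => /(_ hs); rewrite -e eqxx.
- have hv' : Num.min ((rho \o q) b) ((rho \o q) a) <= 1 <= Num.max ((rho \o q) b) ((rho \o q) a).
    by rewrite minC maxC.
  have [s] := IVT ba (cr _) hv'; rewrite in_itv /= => hs e.
  by have := h s; rewrite min_r // max_l // => /(_ hs); rewrite -e eqxx.
Qed.

Lemma vertical_continuous u : continuous (fun s : R => (u, s)).
Proof.
apply: (@lipschitz_continuous _ _ _ _ 1) => s t.
by rewrite prod_normE /= subrr normr0 mul1r max_r.
Qed.

Lemma horizontal_continuous v : continuous (fun s : R => (s, v)).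
Proof.
apply: (@lipschitz_continuous _ _ _ _ 1) => s t.
by rewrite prod_normE /= subrr normr0 mul1r max_l.
Qed.

Lemma radial_upward u v : (forall s, v <= s -> rho (u, s) != 1) -> ~ rho (u, v) < 1.
Proof.
move=> h rv; have [M [Mr bM]] := core_bounded p_lip.
have := bM (`|M| + 1); rewrite (le_lt_trans (ler_norm M)) ?ltrDl // => /(_ isT) b1.
pose s := Num.max v (`|M| + 2).
have vs : v <= s by rewrite le_max lexx.
have : rho (u, s) < 1.
  apply: (@radial_path (fun s => (u, s)) v s) => //; first exact: vertical_continuous.
  by move=> s' /andP[h1 _]; apply: h; rewrite min_l in h1.
move=> /b1 /=; rewrite prod_normE /= ge_max => /andP[_].
have : `|M| + 2 <= s by rewrite le_max lexx orbT.
by move=> h1 h2; have := ler_norm s; have := normr_ge0 M; lra.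
Qed.

Lemma Phi0_between : exists2 u, x pi < u < x 0 & rho (u, 0) < 1.
Proof.
have e1 : expi pi = - 1 :> R[i] by rewrite /expi cospi sinpi; apply/eqP; rewrite eq_complex /= oppr0 !eqxx.
have tp := trace pi; have t0 := trace 0; rewrite e1 in tp; rewrite expi0 in t0.
exists (cRe (Phi p 0)).
  have h1 := Phi_near_id p_lip (- 1) 0; have h2 := Phi_near_id p_lip 1 0.
  have := le_trans (abs_Re_le _) h1; have := le_trans (abs_Re_le _) h2.
  rewrite !subr0 normcN [normc 1](_ : _ = 1); last by rewrite /= expr1n expr0n addr0 sqrtr1.
  have -> : cRe (Phi p 1 - Phi p 0 - 1) = x 0 - cRe (Phi p 0) - 1.
    by move: t0; case: (Phi p 1) (Phi p 0) => a b [c d] [<- _].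
  have -> : cRe (Phi p (- 1) - Phi p 0 - - 1) = x pi - cRe (Phi p 0) + 1.
    by move: tp; case: (Phi p (- 1)) (Phi p 0) => a b [c d] [<- _] /=; rewrite opprK.
  by rewrite !ler_norml => /andP[h3 h4] /andP[h5 h6]; apply/andP; split; lra.
have c0 : (0^*)%C = 0 :> R[i] by rewrite /= oppr0.
have := Phi_conj 0; rewrite c0 => e.
have -> : (cRe (Phi p 0), 0) = plane_of (Phi p 0) :> R * R.
  by move: e; case: (Phi p 0) => a b [e]; rewrite /plane_of /=; congr pair; lra.
by rewrite /radial plane_ofK (PsiK p_lip) ComplexField.Normc.normc0.
Qed.

(** A vertical line meets the boundary only at the heights [y] and [- y] of its
    angle, and the side of the boundary on which a point lies is followed along
    paths from the real axis and from infinity. *)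
Lemma core_section u v :
  core p (u, v) <-> x pi <= u <= x 0 /\ `|v| < y (angle u).
Proof.
have [y0 yp] := y_ends.
wlog v0 : v / 0 <= v.
  move=> H; case: (lerP 0 v) => v0; first exact: H.
  by have := H (- v); rewrite normrN /core /= radial_opp; apply; lra.
rewrite (ger0_norm v0) /core /=; split=> [rv|[hu]].
  case: (boolP (x pi <= u <= x 0)) => hu; last first.
    case: (radial_upward _ rv) => s _; apply: contra hu => /eqP/radial_eq1[t ht [-> _]].
    exact: x_range.
  split => //; rewrite ltNge; apply/negP => vy.
  have [t ht e] := x_onto hu; rewrite -e angleK // in vy.
  apply: (radial_upward _ rv) => s vs; apply/eqP => /[dup] hs /radial_eq1[t' ht' []].
  rewrite -e => /(x_inj ht ht') <-; rewrite ger0_norm ?(le_trans v0) // => es.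
  have ev : v = y t by apply/eqP; rewrite eq_le vy andbT -es.
  by move: rv; rewrite ev -e radial_trace ltxx.
have [t ht e] := x_onto hu; rewrite -{1}e angleK // => vy.
have inner s : x pi < s < x 0 -> rho (s, 0) != 1.
  move=> /andP[s1 s2]; apply/eqP => /radial_eq1[t' /andP[t1 t2] []] es.
  rewrite normr0 => ey; have := @y_pos t'; rewrite -ey ltxx.
  rewrite !lt_neqAle t1 t2 !andbT; case: (eqVneq 0 t') => [h|_].
    by rewrite es -h ltxx in s2.
  case: (eqVneq t' pi) => [h|_]; first by rewrite es h ltxx in s1.
  by move=> /(_ isT).
have hu' : x pi < u < x 0.
  move: hu; rewrite !le_eqVlt => /andP[/orP[/eqP eu|->] /orP[/eqP eu'|->]] //.
  - by move: vy; rewrite -eu in e; have := x_inj ht _ e; rewrite lexx pi_ge0' => -> //; rewrite yp; lra.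
  - by move: vy; rewrite -eu in e; have := x_inj ht _ e; rewrite lexx pi_ge0' => -> //; rewrite yp; lra.
  - by move: vy; rewrite eu' in e; have := x_inj ht _ e; rewrite lexx pi_ge0' => -> //; rewrite y0; lra.
have [w /andP[w1 w2] rw] := Phi0_between.
have /andP[u1 u2] := hu'.
have r0 : rho (u, 0) < 1.
  apply: (@radial_path (fun s => (s, 0)) w u) => //; first exact: horizontal_continuous.
  move=> s /andP[s1 s2]; apply: inner; rewrite (lt_le_trans _ s1) ?lt_min ?w1 //.
  by rewrite (le_lt_trans s2) // gt_max w2.
apply: (@radial_path (fun s => (u, s)) 0 v) => //; first exact: vertical_continuous.
move=> s; rewrite min_l // max_r // => /andP[s0 sv]; apply/eqP => /radial_eq1[t' ht' []].
by rewrite -e => /(x_inj ht ht') <-; rewrite ger0_norm // => es; move: vy; rewrite -es ltNge sv.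
Qed.

(** Slicing vertically, and then taking the angle as the variable. *)
Lemma area_core : area (core p) = (\int[lebesgue_measure]_(t in `[0%R, pi]) (- 2 * (y t * x' t))%:E)%E.
Proof.
have sec u : @lebesgue_measure R (xsection (core p) u) =
    ((fun u => (2 * y (angle u))%:E) \_ `[x pi, x 0]) u.
  rewrite patchE; case: ifPn => [/set_mem/=|/negP hu].
    rewrite in_itv /= => hu.
    have [t ht e] := x_onto hu.
    have -> : xsection (core p) u = `]- y (angle u), (y (angle u))[%classic.
      apply/seteqP; split => v; rewrite /xsection /= in_itv /= -ltr_norml.
        by move=> /set_mem/core_section[].
      by move=> hv; apply/mem_set/core_section.
    rewrite lebesgue_measure_itv /= lte_fin -e angleK //.
    have := y_ge0 ht; rewrite le_eqVlt => /predU1P[<-|yt]; first by rewrite oppr0 ltxx mulr0.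
    rewrite ifT; last by lra.
    by rewrite -EFinD opprK mulr_natl mulr2n.
  have -> : xsection (core p) u = set0.
    apply/seteqP; split => v //; rewrite /xsection /= => /set_mem/core_section[h _].
    by apply: hu; apply/mem_set; rewrite /= in_itv.
  by rewrite measure0.
rewrite /area /product_measure1.
under eq_integral => u _ do rewrite /= sec.
rewrite -integral_mkcond.
have pp : 0 < pi by exact: pi_gt0.
have cx : continuous x.
  move=> t; apply/differentiable_continuous/derivable1_diffP; by case: (x_derive t).
have dxE : derive1 x = x'.
  by apply/funext => t; rewrite derive1E; case: (x_derive t).
have cang : {within `[x pi, x 0], continuous angle}.
  apply: (@segment_can_ge_continuous R 0 pi x angle pi_ge0').
    exact: continuous_subspaceT.
  by move=> t; rewrite in_itv /= => /angleK.
have -> : (fun u => (2 * y (angle u))%:E) = (fun u => ((fun u => 2 * y (angle u)) u)%:E) by [].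
rewrite (@integration_by_substitution_decreasing R x (fun u => 2 * y (angle u)) 0 pi pi_ge0').
- apply: eq_integral => t /set_mem/=; rewrite in_itv /= => ht.
  by rewrite !fctE /= dxE angleK //; congr (_%:E); ring.
- exact: x_decreasing.
- by rewrite dxE => t _; exact: x'_continuous.
- by rewrite dxE; apply/cvg_ex; exists (x' 0); apply: cvg_at_right_filter; exact: x'_continuous.
- by rewrite dxE; apply/cvg_ex; exists (x' pi); apply: cvg_at_left_filter; exact: x'_continuous.
- split => //.
  + by apply: cvg_at_right_filter; exact: cx.
  + by apply: cvg_at_left_filter; exact: cx.
- have c2 : continuous (fun w => 2 * y w).
    by move=> w; apply: cvgM; [exact: cvg_cst|exact: y_continuous].
  move=> u; apply: (@continuous_comp _ _ _ (angle : subspace _ -> R) (fun w => 2 * y w)).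
    exact: cang.
  exact: c2.
Qed.

End AreaOfCore.

(** * The coefficients of low order *)

Section LowOrder.
Variable R : realType.
Implicit Types a b : nat -> nat -> R.

(** The coefficients that enter the expansion up to the orders of interest,
    listed as (0,0), (1,0), (0,1), (2,0), (1,1), (0,2), (2,1), (1,2). *)
Definition jet a (v00 v10 v01 v20 v11 v02 v21 v12 : R) : Prop :=
  (a 0%N 0%N = v00 /\ a 1%N 0%N = v10 /\ a 0%N 1%N = v01 /\ a 2%N 0%N = v20) /\
  (a 1%N 1%N = v11 /\ a 0%N 2%N = v02 /\ a 2%N 1%N = v21 /\ a 1%N 2%N = v12).

Lemma jet_self a : jet a (a 0%N 0%N) (a 1%N 0%N) (a 0%N 1%N) (a 2%N 0%N)
  (a 1%N 1%N) (a 0%N 2%N) (a 2%N 1%N) (a 1%N 2%N).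
Proof. by []. Qed.

Lemma jetD a b v0 v1 v2 v3 v4 v5 v6 v7 w0 w1 w2 w3 w4 w5 w6 w7 :
  jet a v0 v1 v2 v3 v4 v5 v6 v7 -> jet b w0 w1 w2 w3 w4 w5 w6 w7 ->
  jet (a + b) (v0 + w0) (v1 + w1) (v2 + w2) (v3 + w3) (v4 + w4) (v5 + w5)
    (v6 + w6) (v7 + w7).
Proof.
by move=> [[<- [<- [<- <-]]] [<- [<- [<- <-]]]] [[<- [<- [<- <-]]] [<- [<- [<- <-]]]].
Qed.

Lemma jetN a v0 v1 v2 v3 v4 v5 v6 v7 : jet a v0 v1 v2 v3 v4 v5 v6 v7 ->
  jet (- a) (- v0) (- v1) (- v2) (- v3) (- v4) (- v5) (- v6) (- v7).
Proof. by move=> [[<- [<- [<- <-]]] [<- [<- [<- <-]]]]. Qed.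

Lemma jetZ c a v0 v1 v2 v3 v4 v5 v6 v7 : jet a v0 v1 v2 v3 v4 v5 v6 v7 ->
  jet (c *: a) (c * v0) (c * v1) (c * v2) (c * v3) (c * v4) (c * v5) (c * v6) (c * v7).
Proof. by move=> [[<- [<- [<- <-]]] [<- [<- [<- <-]]]]. Qed.

Lemma jet_flip a v0 v1 v2 v3 v4 v5 v6 v7 : jet a v0 v1 v2 v3 v4 v5 v6 v7 ->
  jet (flip a) v0 v2 v1 v5 v4 v3 v7 v6.
Proof. by move=> [[<- [<- [<- <-]]] [<- [<- [<- <-]]]]. Qed.

Lemma jet_mirror a v0 v1 v2 v3 v4 v5 v6 v7 : jet a v0 v1 v2 v3 v4 v5 v6 v7 ->
  jet (mirror a) v0 v2 v2 v5 v4 v5 v7 v7.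
Proof. by move=> [[e0 [_ [e2 _]]] [e4 [e5 [_ e7]]]]. Qed.

Lemma jet_cnst c : jet (cnst c) c 0 0 0 0 0 0 0.
Proof. by []. Qed.

Lemma jet_cauchy a b v0 v1 v2 v3 v4 v5 v6 v7 w0 w1 w2 w3 w4 w5 w6 w7 :
  jet a v0 v1 v2 v3 v4 v5 v6 v7 -> jet b w0 w1 w2 w3 w4 w5 w6 w7 ->
  jet (cauchy a b) (v0 * w0) (v0 * w1 + v1 * w0) (v0 * w2 + v2 * w0)
    (v0 * w3 + v1 * w1 + v3 * w0) (v0 * w4 + v1 * w2 + v2 * w1 + v4 * w0)
    (v0 * w5 + v2 * w2 + v5 * w0)
    (v0 * w6 + v2 * w3 + v1 * w4 + v4 * w1 + v3 * w2 + v6 * w0)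
    (v0 * w7 + v1 * w5 + v2 * w4 + v4 * w2 + v5 * w1 + v7 * w0).
Proof.
move=> [[<- [<- [<- <-]]] [<- [<- [<- <-]]]] [[<- [<- [<- <-]]] [<- [<- [<- <-]]]].
by split; (split; last split; last split); rewrite /cauchy !big_ord_recr !big_ord0 /=
  ?big_ord_recr ?big_ord0 /= ?big_ord_recr ?big_ord0 /=; ring.
Qed.

Lemma jet_eq a v0 v1 v2 v3 v4 v5 v6 v7 w0 w1 w2 w3 w4 w5 w6 w7 :
  jet a v0 v1 v2 v3 v4 v5 v6 v7 ->
  (v0 = w0 /\ v1 = w1 /\ v2 = w2 /\ v3 = w3) ->
  (v4 = w4 /\ v5 = w5 /\ v6 = w6 /\ v7 = w7) ->
  jet a w0 w1 w2 w3 w4 w5 w6 w7.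
Proof. by move=> h [<- [<- [<- <-]]] [<- [<- [<- <-]]]. Qed.

End LowOrder.

Section LowOrderSolution.
Variables (R : realType) (m : nat) (tau : R).
Hypothesis hm : (2 <= m)%N.
Hypothesis htau : tau ^+ 2 * m%:R = 1.

Local Notation sol := (solution m tau).
Local Notation mr := (m%:R : R).
Local Notation c := (shape_tail sol 2 0).
Local Notation d := (omega_tail sol 1 1).
Local Notation G20 := c.

Lemma jet_gser : jet (gser sol) 0 1 0 c 0 0 0 0.
Proof.
by rewrite /jet /gser !fctE /xvar /= !fctE; do 8! rewrite ?(@shape_support _ _ tau) //= ?addr0 ?add0r.
Qed.

Lemma jet_omega_tail : jet (omega_tail sol) 0 0 0 0 d 0 0 0.
Proof.
by split; (split; last split; last split); rewrite ?delta00 // delta_diag.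
Qed.

Lemma jet_hser : jet (hser m sol) 0 (- mr) 0 (- (2 * mr * c)) 0 0 0 0.
Proof.
have [[e0 [e1 [e2 e3]]] [e4 [e5 [e6 e7]]]] := jet_gser.
rewrite /jet /hser /euler e0 e1 e2 e3 e4 e5 e6 e7.
by split; (split; last split; last split); ring.
Qed.

Lemma jet_aser : jet (aser m sol) 0 (1 - mr) 0 ((1 - 2 * mr) * c) 0 0 0 0.
Proof.
apply: (jet_eq (jetD jet_gser jet_hser)).
  by split; last split; last split; ring.
by split; last split; last split; ring.
Qed.

Lemma jet_inverse_tail : jet (inverse_tail sol) 0 0 0 ((1 - mr) ^+ 2) 0 0 0 0.
Proof.
have ja := jet_aser.
have jk := jet_self (inverse_tail sol).
have := jetD (jet_cauchy ja ja) (jetN (jet_cauchy ja jk)).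
rewrite -[cauchy _ _ + _]/(inverse_next m sol) -inverse_fixed.
move=> [[e0 [e1 [e2 e3]]] [e4 [e5 [e6 e7]]]].
have f0 : inverse_tail sol 0%N 0%N = 0 by rewrite e0; ring.
have f1 : inverse_tail sol 1%N 0%N = 0 by rewrite e1 f0; ring.
have f2 : inverse_tail sol 0%N 1%N = 0 by rewrite e2 f0; ring.
have f4 : inverse_tail sol 1%N 1%N = 0 by rewrite e4 f0 f2; ring.
have f5 : inverse_tail sol 0%N 2%N = 0 by rewrite e5; ring.
split; (split; last split; last split) => //.
- by rewrite e3 f1 f0; ring.
- by rewrite e6 f4 f2; ring.
- by rewrite e7 f5; ring.
Qed.

Lemma jet_kser :
  jet (kser m sol) 0 (mr - 1) 0 ((1 - mr) ^+ 2 - (1 - 2 * mr) * c) 0 0 0 0.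
Proof.
apply: (jet_eq (jetD jet_inverse_tail (jetN jet_aser))).
  by split; last split; last split; ring.
by split; last split; last split; ring.
Qed.

Lemma jet_tdser : jet (tdser tau sol) tau 0 0 0 d 0 0 0.
Proof.
apply: (jet_eq (jetD (jet_cnst tau) jet_omega_tail));
by split; last split; last split; ring.
Qed.

Lemma jet_omser : jet (omser tau sol) (1 + tau) 0 0 0 d 0 0 0.
Proof.
apply: (jet_eq (jetD (jet_cnst (1 + tau)) jet_omega_tail));
by split; last split; last split; ring.
Qed.

Lemma jet_pser : jet (pser sol) 0 1 1 c 0 c 0 0.
Proof.
apply: (jet_eq (jetD jet_gser (jet_flip jet_gser)));
by split; last split; last split; ring.
Qed.

Lemma jet_sigser : jet (sigser m sol) 0 0 0 0 (1 - mr) 0 ((1 - mr) * c) ((1 - mr) * c).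
Proof.
apply: (jet_eq (jet_mirror (jet_cauchy jet_aser (jet_flip jet_gser))));
by split; last split; last split; ring.
Qed.

Lemma jet_q2ser : jet (q2ser m tau sol) 0 0 0 ((1 + tau) ^+ 2)
  (2 * tau * (1 + tau) * (1 - mr) + 2 * (1 + tau) ^+ 2) ((1 + tau) ^+ 2)
  (2 * tau * (1 + tau) * (1 - mr) * c + 2 * (1 + tau) ^+ 2 * (c + (1 - mr)))
  (2 * tau * (1 + tau) * (1 - mr) * c + 2 * (1 + tau) ^+ 2 * (c + (1 - mr))).
Proof.
have jp := jetD jet_pser jet_sigser.
apply: (jet_eq (jetD (jet_cauchy (jet_cauchy jet_tdser jet_omser) (jetZ 2 jet_sigser))
  (jet_cauchy (jet_cauchy jet_omser jet_omser) (jet_cauchy jp jp))));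
by split; last split; last split; ring.
Qed.

Lemma remser_low :
  remser m tau sol 2 0 = (1 + tau * mr) ^+ 2 /\
  remser m tau sol 2 1 =
    tau ^+ 2 * (((1 - mr) ^+ 2 - (1 - 2 * mr) * c) * (mr - 1)) +
    2 * tau * (1 + tau) *
      ((mr - 1) ^+ 2 + ((1 - mr) ^+ 2 - (1 - 2 * mr) * c) + c * (mr - 1)) +
    (2 * tau * (1 + tau) * (1 - mr) * c + 2 * (1 + tau) ^+ 2 * (c + (1 - mr))) +
    (1 + tau) ^+ 2 * (mr - 1) +
    (2 * tau * (1 + tau) * (1 - mr) + 2 * (1 + tau) ^+ 2) * (mr - 1) -
    (1 + tau) ^+ 2 * c.
Proof.
have jk := jet_kser; have jkf := jet_flip jk.
have jkk := jetD (jetD jk jkf) (jet_cauchy jk jkf).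
have ji := jet_inverse_tail; rewrite inverse_fixed in ji.
have jk2 := jetD (jetD ji (jet_flip ji)) (jet_cauchy jk jkf).
have j1 := jet_cauchy (jet_cauchy jet_tdser jet_tdser) jk2.
have j2 := jet_cauchy (jet_cauchy jet_tdser jet_omser) (jetZ 2 (jet_cauchy jet_pser jkk)).
have j1k := jetD (jet_cnst 1) jk.
have j3 := jet_cauchy jet_q2ser (jet_cauchy j1k (jet_flip j1k)).
have j4 := jet_cauchy (jet_cauchy jet_omser jet_omser) (jet_cauchy jet_gser (jet_flip jet_gser)).
have [[_ [_ [_ e3]]] [_ [_ [e6 _]]]] := jetD (jetD (jetD j1 j2) j3) (jetN j4).
split; first by rewrite /remser e3; ring.
by rewrite /remser e6; ring.
Qed.

Lemma shape_tail_low : c = - (1 + tau * mr) ^+ 2.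
Proof.
have n1 : (2 - 0 - 1)%N = 1%N by [].
have := @shape_fixed _ m tau 2 0 isT; rewrite n1 mul1r => ->.
have jo := jet_omega_tail; have jdd := jetD (jetZ (2 * tau) jo) (jet_cauchy jo jo).
have [[_ [_ [_ e]]] _] := jet_cauchy jdd (jet_self (euler m (shape_tail sol))).
have [r20 _] := remser_low; rewrite r20 [X in X - _](_ : _ = 0) ?sub0r //.
by apply: etrans e _; ring.
Qed.

End LowOrderSolution.

(** The coefficients in question are the remainder at the indices (2,0) and (2,1),
    divided, up to sign, by the factors of the fixed-point equations. *)
Lemma shape_omega_low (R : realType) (m : nat) (s sg : R) : (2 <= m)%N ->
  0 < s -> s ^+ 2 = m%:R -> sg = 1 \/ sg = -1 ->
  shape_tail (solution m (sg / s)) 2 0 = - (s + sg) ^+ 2 /\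
  omega_tail (solution m (sg / s)) 1 1 =
    sg * ((s + sg) ^+ 3 * (s + 3 * sg)) / (2 * s).
Proof.
move=> hm s0 sm hsg; have sn : s != 0 by exact: lt0r_neq0.
have sg2 : sg ^+ 2 = 1 by case: hsg => ->; ring.
have htau : (sg / s) ^+ 2 * m%:R = 1 by rewrite expr_div_n sg2 -sm; field.
have c0 := shape_tail_low m (sg / s).
have [_ r21] := remser_low m (sg / s).
have := omega_fixed hm htau 1; rewrite r21 c0.
have -> : ddser (sg / s) (solution m (sg / s)) 1 1 = 2 * (sg / s) * omega_tail (solution m (sg / s)) 1 1.
  have jo := jet_omega_tail m (sg / s).
  have [_ [e _]] := jetD (jetZ (2 * (sg / s)) jo) (jet_cauchy jo jo).
  by rewrite [LHS]e; ring.
rewrite -sm; move: (omega_tail _ 1 1) => d hd; split.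
  by case: hsg => ->; field.
have s1 : s ^+ 2 * (2 * (sg / s)) != 0.
  rewrite !mulf_neq0 ?expf_neq0 ?invr_eq0 //.
  by case: hsg => ->; rewrite ?oppr_eq0 oner_eq0.
apply: (mulfI s1); apply: (etrans (esym (mulrA _ _ _))); rewrite hd.
by case: hsg => ->; field.
Qed.

(** * Values on the circle *)

Lemma square_sum_support (K : comNzRingType) (u : nat -> nat -> K) n N :
  (forall i j, (n <= i)%N || (n <= j)%N -> u i j = 0) ->
  (n <= N)%N -> square_sum u N = square_sum u n.
Proof.
move=> hu nN; rewrite /square_sum (big_ord_widen N (fun i => \sum_(j < n) u i j) nN).
rewrite [RHS]big_mkcond /=; apply: eq_bigr => i _; case: ifPn => [iN|]; last first.
  by rewrite -leqNgt => iN; rewrite big1 // => j _; rewrite hu // iN.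
rewrite (big_ord_widen N (fun j => u i j) nN) [RHS]big_mkcond /=.
by apply: eq_bigr => j _; case: ifPn => //; rewrite -leqNgt => jn; rewrite hu // jn orbT.
Qed.

Section FiniteSums.
Variable R : realType.
Implicit Types (u v : nat -> nat -> R[i]).

Lemma csum_support u n : (forall i j, (n <= i)%N || (n <= j)%N -> u i j = 0) ->
  (exists M, summable_by u M) /\ csum u = square_sum u n.
Proof.
move=> hu; have [M hM] : exists M, summable_by u M.
  exists (square_sum (fun i j => normc (u i j)) n) => N.
  case: (leqP N n) => nN.
    by apply: square_sum_mono => // i j; exact: normc_ge0.
  rewrite (square_sum_support _ (ltnW nN)) // => i j /hu ->.
  by rewrite ComplexField.Normc.normc0.
split; first by exists M.
apply: (csum_unique hM); apply: (@cvgn0_le _ _ (fun N => if (N < n)%N then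
  normc (square_sum u N - square_sum u n) else 0)).
  apply/cvgrPdist_lt => eps eps0; exists n => // N /= nN.
  by rewrite ltnNge nN /= subrr normr0.
move=> N; rewrite normc_ge0 /=; case: ltnP => // nN.
by rewrite (square_sum_support hu nN) subrr ComplexField.Normc.normc0.
Qed.

Lemma Im_csum_real (a : nat -> nat -> R) M :
  summable_by (fun i j => (a i j)%:C%C) M -> cIm (csum (fun i j => (a i j)%:C%C)) = 0.
Proof. by move=> /csum_real ->. Qed.

End FiniteSums.

Lemma is_derive_components (R : realType) (f : R -> R * R) (t : R) (d : R * R) :
  is_derive t 1 f d ->
  is_derive t 1 (fun s => (f s).1) d.1 /\ is_derive t 1 (fun s => (f s).2) d.2.
Proof.
move=> hf.
have key (pr : R * R -> R) : continuous pr -> (forall k x y, pr (k *: (x - y)) = k * (pr x - pr y)) ->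
    is_derive t 1 (fun s => pr (f s)) (pr d).
  move=> cp lp; have [h1 h2] := hf.
  have h3 : pr (h^-1 *: (f (h *: (1 : R) + t) - f t)) @[h --> (0 : R)^'] --> pr d.
    by apply: cvg_comp; [exact: h1|rewrite -h2; exact: cp].
  have h4 : h^-1 *: (pr (f (h *: (1 : R) + t)) - pr (f t)) @[h --> (0 : R)^'] --> pr d.
    rewrite (_ : (fun h => _) = (fun h => pr (h^-1 *: (f (h *: (1 : R) + t) - f t)))) //.
    by apply/funext => h; rewrite lp.
  by apply: DeriveDef; [apply/cvg_ex; exists (pr d)|exact: cvg_lim h4].
split; apply: (key) => // x.
- by apply: (@lipschitz_continuous _ _ _ fst 1) => u v; rewrite mul1r prod_normE le_max lexx.
- by apply: (@lipschitz_continuous _ _ _ snd 1) => u v; rewrite mul1r prod_normE le_max lexx orbT.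
Qed.

Lemma sub_conjc (R : realType) (z : R[i]) : z - (z^*)%C = 'i%C * (2 * cIm z)%:C%C.
Proof.
case: z => p q; apply/eqP; rewrite eq_complex /=; apply/andP; split; apply/eqP; ring.
Qed.

Lemma sin_natmul_le (R : realType) (n : nat) (t : R) : `|sin (n%:R * t)| <= n%:R * `|sin t|.
Proof.
elim: n => [|n IH]; first by rewrite !mul0r sin0 normr0.
rewrite -natr1 !mulrDl !mul1r sinD; apply: le_trans (ler_normD _ _) _.
rewrite !normrM lerD //.
  by apply: le_trans IH; rewrite ler_piMr // cos_max.
by rewrite ler_piMl // cos_max.
Qed.

Section CircleEvaluation.
Variables (R : realType) (m : nat) (r : R).
Hypothesis r0 : 0 < r.
Implicit Types (a b : nat -> nat -> R) (e t : R) (u z : R[i]).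

Definition complexify a : nat -> nat -> R[i] := fun i j => (a i j)%:C%C.

Definition freq : nat -> nat -> R := fun i j => 1 - m%:R * (i%:R - j%:R).

Definition freq_weight : nat -> nat -> R := fun i j => 1 + (m * (i + j))%:R.

(** The value of the series variable [e zeta^-m] at [zeta = expi t]. *)
Definition amplitude e t : R[i] := e%:C%C * expi (- (m%:R * t)).

Definition rotation_exponent (i j : nat) : nat := m * (i - j).

Lemma freq_weight1 i j : 1 <= freq_weight i j.
Proof. by rewrite lerDl. Qed.

Lemma freq_le i j : `|freq i j| <= freq_weight i j.
Proof.
apply: le_trans (ler_normB _ _) _; rewrite normr1 lerD2l normrM normr_nat natrM.
by rewrite ler_wpM2l // natrD (le_trans (ler_normB _ _)) // !normr_nat.
Qed.

Lemma freq_weight_linear i j : freq_weight i j <= m.+1%:R * (i + j).+1%:R.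
Proof.
by rewrite /freq_weight -natrM nat1r ler_nat; clear; nia.
Qed.

Lemma expi_period i j : expi (freq i j * (2 * pi)) = 1 :> R[i].
Proof.
have e1 (n : nat) : expi (n%:R * (2 * pi)) = 1 :> R[i].
  rewrite expi_mulrn [expi (2 * pi)](_ : _ = 1) ?expr1n //.
  by rewrite mulr_natl /expi cos2pi sin2pi.
have -> : freq i j * (2 * pi) = 1%:R * (2 * pi) + (m * j)%:R * (2 * pi) - (m * i)%:R * (2 * pi).
  by rewrite /freq !natrM; ring.
by rewrite !expiD expiN !e1 conjc1 !mulr1.
Qed.

Lemma normc_amplitude e t : normc (amplitude e t) = `|e|.
Proof. by rewrite normcM normc_expi mulr1 normcr. Qed.

Lemma monomials_amplitude a e t i j : monomials (amplitude e t) a i j =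
  power_coef (complexify a) e i j * expi (- (m%:R * (i%:R - j%:R)) * t).
Proof.
rewrite /monomials /power_coef /complexify -mulrA; congr (_ * _).
rewrite /amplitude conjcM conjc_real -expiN opprK !exprMn mulrACA -exprD -rmorphXn.
congr (_ * _); rewrite -!expi_mulrn -expiD; congr expi; ring.
Qed.

Lemma trig_ev a e t : bounded_array r a -> `|e| <= r ->
  trig freq (power_coef (complexify a) e) t = plane_of (expi t * ev (amplitude e t) a).
Proof.
move=> [M ha] er; rewrite /trig /ev.
have x : normc (amplitude e t) <= r by rewrite normc_amplitude.
rewrite -(csumZ _ (monomials_summable r0 x ha)); congr (plane_of (csum _)).
apply/funext => i; apply/funext => j; rewrite monomials_amplitude mulrCA -expiD.
by congr (_ * expi _); rewrite /freq; ring.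
Qed.

Lemma hol_ev a e t : (forall i j, (i < j)%N -> a i j = 0) ->
  hol (power_coef (complexify a) e) rotation_exponent (expi (- t)) =
  ev (amplitude e t) a.
Proof.
move=> ha; congr csum; apply/funext => i; apply/funext => j.
rewrite monomials_amplitude -expi_mulrn /rotation_exponent.
case: (ltnP i j) => [/ha e0|ij]; first by rewrite /power_coef /complexify e0 !mul0r.
by congr (_ * expi _); rewrite natrM natrB //; ring.
Qed.

Lemma complexify_bound a M N : norm_bound r a M ->
  square_sum (fun i j => normc (complexify a i j) * r ^+ (i + j)) N <= M.
Proof.
by move=> h; apply: le_trans (h N); apply: square_sum_le => i j; rewrite normcr.
Qed.

Lemma weight_bounded (W : nat -> nat -> R) (C : R) a L q : 0 <= C ->
  (forall i j, 0 <= W i j <= C * (i + j).+1%:R) -> bounded_array r a -> 0 <= q < r ->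
  exists2 M : R, 0 <= M & forall e, `|e| <= q ->
    weight_bound W (power_coef (complexify a) e) L M.
Proof.
move=> C0 hW [M ha] hq.
have [B B0 hB] := geometric_weight L C0 hW hq (fun N => complexify_bound N ha).
exists B => // e eq N; apply: le_trans (hB N); apply: square_sum_le => i j.
have /andP[W0 _] := hW i j; have /andP[q0 _] := hq.
rewrite /power_coef normcM (normcr (e ^+ _)) normrX mulrAC ler_wpM2l //.
  by rewrite mulr_ge0 ?normc_ge0 // exprn_ge0.
by rewrite lerXn2r ?nnegrE.
Qed.

(** One power of [e] is traded for one of [q]. *)
Lemma weight_small (W : nat -> nat -> R) (C : R) a L q eta : 0 <= C ->
  (forall i j, 0 <= W i j <= C * (i + j).+1%:R) -> bounded_array r a -> 0 < q < r ->
  a 0%N 0%N = 0 -> 0 < eta ->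
  exists2 d : R, 0 < d & forall e, `|e| <= d ->
    weight_bound W (power_coef (complexify a) e) L eta.
Proof.
move=> C0 hW [M ha] /andP[q0 qr] a0 eta0.
have hq : 0 <= q < r by rewrite (ltW q0).
have [B B0 hB] := geometric_weight L C0 hW hq (fun N => complexify_bound N ha).
have B1 : 0 < B + 1 by rewrite ltr_wpDl.
exists (Num.min q (eta * q / (B + 1))); first by rewrite lt_min q0 divr_gt0 ?mulr_gt0.
move=> e; rewrite le_min => /andP[eq ee] N.
apply: (@le_trans _ _ (`|e| / q * B)); last first.
  rewrite mulrAC ler_pdivrMr //; apply: (@le_trans _ _ (`|e| * (B + 1))).
    by rewrite ler_wpM2l // lerDl.
  by rewrite -ler_pdivlMr.
apply: le_trans (ler_wpM2l _ (hB N)); last by rewrite divr_ge0 // ltW.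
rewrite -square_sumZ; apply: square_sum_le => i j.
have /andP[W0 _] := hW i j.
rewrite /power_coef normcM (normcr (e ^+ _)) normrX mulrAC [leRHS]mulrCA.
case: (posnP (i + j)) => [|ij].
  move/eqP; rewrite addn_eq0 => /andP[/eqP -> /eqP ->].
  by rewrite /complexify a0 ComplexField.Normc.normc0 !mul0r.
rewrite ler_wpM2l //; first by rewrite mulr_ge0 ?normc_ge0 // exprn_ge0.
rewrite mulrAC ler_pdivlMr // mulrC.
by have := power_trade eq ij; rewrite !expr1.
Qed.

Lemma sin_freq_le i j t : `|sin (freq i j * t)| <= freq_weight i j * `|sin t|.
Proof.
have -> : freq i j * t = (1 + m * j)%:R * t - (m * i)%:R * t.
  by rewrite /freq natrD !natrM; ring.
rewrite sinB; apply: le_trans (ler_normB _ _) _; rewrite !normrM.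
have -> : freq_weight i j = (1 + m * j)%:R + (m * i)%:R.
  by rewrite /freq_weight natrD !natrM natrD; ring.
rewrite mulrDl lerD //.
  by apply: le_trans (sin_natmul_le _ _); rewrite ler_piMr // cos_max.
by apply: le_trans (sin_natmul_le _ _); rewrite ler_piMl // cos_max.
Qed.

(** Every sine of an integer multiple is dominated by the sine itself, so that a
    small sine series cannot change the sign of the leading term. *)
Lemma sine_series_le a e t M :
  weight_bound freq_weight (power_coef (complexify a) e) 1 M ->
  `|(trig freq (power_coef (complexify a) e) t).2| <= M * `|sin t|.
Proof.
move=> h; have h0 := weight_bound_le freq_weight1 h (leq0n 1).
have hs := summable_trig freq t h0.
rewrite /trig; set u := fun i j => _ in hs *.
have sB : csum (u - (fun i j => (u i j)^*%C)) = csum u - ((csum u)^*)%C.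
  by rewrite (csumB hs (summable_by_conj hs)) (csum_conj hs).
have : normc (csum u - ((csum u)^*)%C) <= 2 * (M * `|sin t|).
  rewrite -sB; apply: normc_csum_le => N.
  apply: (@le_trans _ _ ((2 * `|sin t|) * square_sum
      (fun i j => normc (power_coef (complexify a) e i j) * freq_weight i j ^+ 1) N)); last first.
    by rewrite mulrCA [leRHS]mulrC ler_wpM2l ?mulr_ge0.
  rewrite -square_sumZ; apply: square_sum_le => i j.
  rewrite !fctE /u conjcM.
  have -> : ((power_coef (complexify a) e i j)^*)%C = power_coef (complexify a) e i j.
    by rewrite /power_coef /complexify conjcM !conjc_real.
  rewrite -mulrBr normcM mulrCA ler_wpM2l ?normc_ge0 //.
  rewrite expr1 -mulrA (mulrC `|sin t|).
  apply: le_trans (ler_wpM2l _ (sin_freq_le i j t)) => //.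
  rewrite sub_conjc normcM normcr [normc 'i%C](_ : _ = 1); last first.
    by rewrite /= expr0n expr1n add0r sqrtr1.
  by rewrite mul1r normrM ger0_norm.
rewrite sub_conjc.
rewrite normcM normcr [normc 'i%C](_ : _ = 1); last first.
  by rewrite /= expr0n expr1n add0r sqrtr1.
by rewrite mul1r normrM ger0_norm // ler_pM2l.
Qed.

Hypothesis m0 : (0 < m)%N.

Definition mean_value a e : R :=
  scalar_sum (fun i j => if i == j then power_coef (complexify a) e i j else 0).

Definition oscillation : nat -> nat -> R := fun i j => - (m%:R * (i%:R - j%:R)).

Definition primitive_coef a e : nat -> nat -> R[i] := fun i j =>
  if i == j then 0 else power_coef (complexify a) e i j * ((oscillation i j)^-1)%:C%C.

(** Integration term by term; the oscillating terms vanish at the multiples of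
    [pi]. *)
Definition mean_primitive a e t : R :=
  mean_value a e * t + (trig oscillation (primitive_coef a e) t).2.

Lemma oscillation_le i j : `|oscillation i j| <= freq_weight i j.
Proof.
rewrite normrN normrM normr_nat /freq_weight natrM natrD ler_wpDl //.
by rewrite ler_wpM2l // (le_trans (ler_normB _ _)) // !normr_nat.
Qed.

Lemma oscillation_ge1 i j : i != j -> 1 <= `|oscillation i j|.
Proof.
move=> ij; rewrite normrN normrM normr_nat.
have m1 : 1 <= m%:R :> R by rewrite ler1n.
suff : 1 <= `|i%:R - j%:R| :> R by move=> h; rewrite -[leLHS]mulr1 ler_pM.
wlog : i j ij / (j < i)%N.
  by move=> H; case: (ltngtP i j) ij => // h _; [rewrite distrC|]; apply: H => //; rewrite gtn_eqF.
by move=> h; rewrite -natrB ?(ltnW h) // normr_nat ler1n subn_gt0.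
Qed.

Lemma primitive_coef_bound a e L M :
  weight_bound freq_weight (power_coef (complexify a) e) L M ->
  weight_bound freq_weight (primitive_coef a e) L M.
Proof.
move=> h N; apply: le_trans (h N); apply: square_sum_le => i j.
have w0 : 0 <= freq_weight i j ^+ L by rewrite exprn_ge0 // (le_trans ler01) // freq_weight1.
rewrite /primitive_coef; case: eqVneq => [_|ij].
  by rewrite ComplexField.Normc.normc0 mul0r mulr_ge0 ?normc_ge0.
rewrite ler_wpM2r // normcM normcr ler_piMr ?normc_ge0 // normfV invf_le1.
  exact: oscillation_ge1.
by apply: lt_le_trans (oscillation_ge1 ij).
Qed.

(** The constant terms integrate to the linear one, and the frequencies of the
    others are bounded below. *)
Lemma mean_primitive_derive a e t : bounded_array r a -> `|e| < r ->
  is_derive t 1 (mean_primitive a e) (cRe (ev (amplitude e t) a)).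
Proof.
move=> ba er.
have W0 i j : 0 <= freq_weight i j <= m.+1%:R * (i + j).+1%:R.
  by rewrite freq_weight_linear (le_trans ler01) // freq_weight1.
have [|M M0 hM] := weight_bounded 2 (ler0n _ _) W0 ba (q := `|e|); first by rewrite normr_ge0.
have h2 := hM e (lexx _); have h0 := weight_bound_le freq_weight1 h2 (leq0n 2).
have b2 := primitive_coef_bound h2.
have [_ d2] := is_derive_components (trig_is_derive freq_weight1 oscillation_le t b2).
have dl : is_derive t 1 (fun s : R => mean_value a e * s) (mean_value a e).
  apply: (@quadratic_is_derive _ _ _ _ _ 0) => s.
  by rewrite mul0r -mulrBr [_ *: _]mulrC subrr normr0.
have := is_deriveD dl d2.
suff -> : cRe (ev (amplitude e t) a) = mean_value a e +
    (trig oscillation (tderiv oscillation (primitive_coef a e)) t).2 by [].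
rewrite /mean_value /scalar_sum /trig [(plane_of _).2]/(cIm (csum _)).
pose u i j := power_coef (complexify a) e i j * expi (oscillation i j * t).
have uE : monomials (amplitude e t) a = u.
  by apply/funext => i; apply/funext => j; rewrite monomials_amplitude.
pose u1 i j := if i == j then power_coef (complexify a) e i j else 0.
pose u2 i j := if i == j then 0 else u i j.
have s1 : summable_by u1 M.
  move=> N; apply: le_trans (h0 N); apply: square_sum_le => i j; rewrite expr0 mulr1 /u1.
  by case: ifP => // _; rewrite ComplexField.Normc.normc0 normc_ge0.
have s2 : summable_by u2 M.
  move=> N; apply: le_trans (h0 N); apply: square_sum_le => i j; rewrite expr0 mulr1 /u2.
  case: ifP => _; first by rewrite ComplexField.Normc.normc0 normc_ge0.
  by rewrite /u normcM normc_expi mulr1.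
have -> : ev (amplitude e t) a = csum u1 + csum u2.
  rewrite /ev uE -(csumD s1 s2); congr csum; apply/funext => i; apply/funext => j.
  rewrite !fctE /u1 /u2; case: eqVneq => [->|_]; last by rewrite add0r.
  by rewrite addr0 /u /oscillation subrr mulr0 oppr0 mul0r expi0 mulr1.
have -> : (fun i j => tderiv oscillation (primitive_coef a e) i j * expi (oscillation i j * t)) =
    (fun i j => 'i%C * u2 i j).
  apply/funext => i; apply/funext => j; rewrite /tderiv /primitive_coef /u2.
  case: eqVneq => [_|ij]; first by rewrite !mulr0 mul0r.
  have o0 : oscillation i j != 0 by rewrite -normr_gt0 (lt_le_trans ltr01) // oscillation_ge1.
  rewrite /u -!mulrA; congr (_ * _); rewrite mulrCA; congr (_ * _).
  by rewrite mulrCA; congr (_ * _); rewrite mulrA -rmorphM mulfV // rmorph1 mul1r.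
rewrite (csumZ _ s2) -[fun i j => if _ then _ else _]/u1.
by case: (csum u1) (csum u2) => p q [p' q'] /=; rewrite mul0r mul1r add0r.
Qed.

Lemma mean_primitive_at a e t : bounded_array r a -> `|e| <= r ->
  (forall i j, cIm (expi (oscillation i j * t)) = 0) ->
  mean_primitive a e t = mean_value a e * t.
Proof.
move=> [M ha] er ht; rewrite /mean_primitive /trig.
have h0 : weight_bound freq_weight (power_coef (complexify a) e) 0 M.
  move=> N; apply: le_trans (ha N); apply: square_sum_le => i j.
  rewrite expr0 mulr1 /power_coef /complexify normcM !normcr normrX ler_wpM2l //.
  by rewrite lerXn2r ?nnegrE // ltW.
have hs := summable_trig oscillation t (primitive_coef_bound h0).
pose b i j := cRe (primitive_coef a e i j * expi (oscillation i j * t)).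
suff E : (fun i j => primitive_coef a e i j * expi (oscillation i j * t)) = fun i j => (b i j)%:C%C.
  rewrite E in hs; have i0 : (plane_of (csum (fun i j => (b i j)%:C%C))).2 = 0.
    exact: Im_csum_real hs.
  by rewrite E i0 addr0.
apply/funext => i; apply/funext => j; rewrite /b /primitive_coef.
case: eqVneq => _; first by rewrite mul0r.
have := ht i j; case: (expi _) => p q /= ->.
by rewrite /power_coef /complexify; simpc.
Qed.

Lemma mean_primitive_values a e : bounded_array r a -> `|e| <= r ->
  [/\ mean_primitive a e 0 = 0, mean_primitive a e pi = mean_value a e * pi
    & mean_primitive a e (2 * pi) = mean_value a e * (2 * pi)].
Proof.
move=> ba er.
have key (n : nat) : mean_primitive a e (n%:R * pi) = mean_value a e * (n%:R * pi).
  apply: mean_primitive_at => // i j /=.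
  have s0 (k : nat) : sin (k%:R * pi) = 0 :> R.
    apply/eqP; rewrite -normr_le0; apply: le_trans (sin_natmul_le _ _) _.
    by rewrite sinpi normr0 mulr0.
  have -> : oscillation i j * (n%:R * pi) = (m * j * n)%:R * pi - (m * i * n)%:R * pi.
    by rewrite /oscillation !natrM; ring.
  by rewrite sinB !s0 mul0r mulr0 subrr.
split; [|have := key 1%N; by rewrite mul1r|exact: key].
by have := key 0%N; rewrite mul0r mulr0.
Qed.

End CircleEvaluation.

(** * The vortex of a given amplitude *)

Section DiskLipschitz.
Variable R : realType.
Implicit Types (f g : R[i] -> R[i]) (u v : R[i]).

Definition disk_lipschitz f := exists2 K : R, 0 <= K &
  forall u v, normc u <= 1 -> normc v <= 1 ->
    normc (f u - f v) <= K * normc (u - v) /\ normc (f u) <= K.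

Lemma disk_lipschitz_cst z : disk_lipschitz (fun=> z).
Proof.
exists (normc z) => [|u v _ _]; first exact: normc_ge0.
by rewrite subrr ComplexField.Normc.normc0 mulr_ge0 ?normc_ge0.
Qed.

Lemma disk_lipschitz_id : disk_lipschitz id.
Proof. by exists 1 => // u v u1 v1; rewrite mul1r. Qed.

Lemma disk_lipschitzD f g : disk_lipschitz f -> disk_lipschitz g ->
  disk_lipschitz (fun u => f u + g u).
Proof.
move=> [K K0 hf] [L L0 hg]; exists (K + L) => [|u v u1 v1]; first by rewrite addr_ge0.
have [f1 f2] := hf u v u1 v1; have [g1 g2] := hg u v u1 v1.
split; last by apply: le_trans (normcD _ _) _; rewrite lerD.
by rewrite opprD addrACA mulrDl; apply: le_trans (normcD _ _) _; rewrite lerD.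
Qed.

Lemma disk_lipschitzM f g : disk_lipschitz f -> disk_lipschitz g ->
  disk_lipschitz (fun u => f u * g u).
Proof.
move=> [K K0 hf] [L L0 hg]; exists (2 * (K * L) + K * L) => [|u v u1 v1].
  by rewrite addr_ge0 // !mulr_ge0.
have [f1 f2] := hf u v u1 v1; have [g1 g2] := hg u v u1 v1.
have [_ f3] := hf v u v1 u1; have n0 := @normc_ge0 R.
have KL : 0 <= K * L by rewrite mulr_ge0.
split; last by rewrite normcM; apply: (@le_trans _ _ (K * L)); [rewrite ler_pM|lra].
have -> : f u * g u - f v * g v = (f u - f v) * g u + f v * (g u - g v) by ring.
apply: le_trans (normcD _ _) _; rewrite !normcM.
apply: (@le_trans _ _ (K * normc (u - v) * L + K * (L * normc (u - v)))).
  by rewrite lerD // ler_pM // mulr_ge0.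
by have := mulr_ge0 KL (n0 (u - v)); lra.
Qed.

Lemma disk_lipschitzV f (b : R) : 0 < b ->
  (forall u, normc u <= 1 -> b <= normc (f u)) -> disk_lipschitz f ->
  disk_lipschitz (fun u => (f u)^-1).
Proof.
move=> b0 hb [K K0 hf]; have n0 := @normc_ge0 R.
exists (K / b ^+ 2 + b^-1) => [|u v u1 v1].
  by rewrite addr_ge0 ?divr_ge0 ?invr_ge0 ?exprn_ge0 ?(ltW b0).
have [f1 _] := hf u v u1 v1; have bu := hb u u1; have bv := hb v v1.
have pu := lt_le_trans b0 bu; have pv := lt_le_trans b0 bv.
have fu : f u != 0 by rewrite -normc_eq0 gt_eqF.
have fv : f v != 0 by rewrite -normc_eq0 gt_eqF.
have iV z : normc z^-1 = (normc z)^-1 by rewrite ComplexField.Normc.normcV.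
split; last first.
  rewrite iV; apply: (@le_trans _ _ b^-1); first by rewrite lef_pV2.
  by rewrite lerDr divr_ge0 // exprn_ge0 // ltW.
have -> : (f u)^-1 - (f v)^-1 = - ((f u - f v) * ((f u)^-1 * (f v)^-1)) by field; rewrite fu fv.
rewrite normcN !normcM !iV.
apply: (@le_trans _ _ (K * normc (u - v) * (b^-1 * b^-1))).
  by rewrite ler_pM ?mulr_ge0 ?invr_ge0 // ler_pM ?invr_ge0 // lef_pV2.
rewrite mulrAC ler_wpM2r // -invfM -expr2 lerDl invr_ge0 (ltW b0) //.
Qed.

Lemma disk_lipschitz_hol c n M : weight_bound (wt R n) c 1 M -> disk_lipschitz (hol c n).
Proof.
move=> h; have h0 := weight_bound_le (weight_ge1 R n) h (leq0n 1).
exists M => [|u v u1 v1]; first by have := h 0%N; rewrite /square_sum big_ord0.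
by split; [exact: hol_lipschitz h u1 v1|exact: hol_le h0 u1].
Qed.

End DiskLipschitz.

Section VortexDefinitions.
Variables (R : realType) (m : nat) (tau kappa : R).
Implicit Types (e : R) (u z : R[i]) (x : R * R).

Local Notation sol := (solution m tau).

Definition perturbation e : R[i] -> R[i] :=
  hol (power_coef (complexify (gser sol)) e) (fun i j => (m * (i - j)).-1).

(** In units of [kappa]. *)
Definition spin e : R := 1 + tau + scalar_sum (power_coef (complexify (omega_tail sol)) e).

Definition slope e u : R[i] :=
  1 + hol (power_coef (complexify (aser m sol)) e) (rotation_exponent m) u.

Definition swirl e u : R[i] := 1 + (spin e)%:C%C *
  hol (power_coef (complexify (flow_part m sol)) e) (rotation_exponent m) u.

(** The conjugate of the lab velocity, as a function of the inverse of the
    uniformizing variable. *)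
Definition lab_flow e u : R[i] := - ('i%C * kappa%:C%C) * u * swirl e u * (slope e u)^-1.

Definition flow e z : R[i] := lab_flow e (fold (Psi (perturbation e) z)).

Definition vortex_velocity e : R * R -> R * R :=
  relative_velocity (flow e) (kappa * spin e).

End VortexDefinitions.

Section Vortex.
Variables (R : realType) (m : nat) (tau kappa r e : R).
Hypothesis hm : (2 <= m)%N.
Hypothesis htau : tau ^+ 2 * m%:R = 1.
Hypothesis r0 : 0 < r.
Hypothesis hr : 12000 * m%:R * ball_cst R m ^+ 2 * r <= 1.
Hypothesis er : `|e| < r.
Implicit Types (u z : R[i]) (x : R * R) (t : R).

Local Notation sol := (solution m tau).
Local Notation g := (gser sol).
Local Notation al := (aser m sol).
Local Notation p := (perturbation m tau e).
Local Notation Fm := (Phi p).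
Local Notation Gm := (Psi p).
Local Notation amp := (amplitude m e).
Local Notation cr := (ball_cst R m * r).

Lemma cr_small : 0 <= cr <= 12^-1.
Proof.
have m2 : 2 <= m%:R :> R by rewrite ler_nat.
have rp := r0; have h := hr; have c6 : 6 <= ball_cst R m by rewrite /ball_cst; lra.
set c := ball_cst R m in h c6 *; apply/andP; split; first by nra.
have h1 : 12 * (c * r) <= 12000 * m%:R * c ^+ 2 * r; last lra.
have cr0 : 0 <= c * r by nra.
have mc : 12 <= m%:R * c by nra.
have -> : 12000 * m%:R * c ^+ 2 * r = 12000 * (m%:R * c) * (c * r) by ring.
nra.
Qed.

Lemma solution_bounds : [/\ norm_bound r g cr, norm_bound r al cr,
   norm_bound r (hser m sol) cr, bounded_array r (inverse_tail sol)
   & bounded_array r (omega_tail sol)].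
Proof.
have B := in_ball_solution r0 hm htau hr.
have [[h1 h2 _ _ _] h6] := in_ball_small r0 hm htau B.
have [_ b1 b2 _] := B.
by split => //; [exists r|exists (ball_eta R m)].
Qed.

Lemma weight_solution a (n : nat -> nat -> nat) L : bounded_array r a ->
  (forall i j, (n i j <= m * (i + j))%N) ->
  exists M, weight_bound (wt R n) (power_coef (complexify a) e) L M.
Proof.
move=> ba hn.
have W0 i j : 0 <= wt R n i j <= m.+1%:R * (i + j).+1%:R.
  rewrite /wt ler0n -natrM ler_nat (leq_trans (_ : _ <= (m * (i + j)).+1)%N) //.
    by rewrite ltnS hn.
  by rewrite mulSn mulnS; clear; lia.
have [|M _ hM] := weight_bounded L (ler0n _ _) W0 ba (q := `|e|); first by rewrite normr_ge0.
by exists M; apply: hM.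
Qed.

Lemma rotation_exponent_le i j : (rotation_exponent m i j <= m * (i + j))%N.
Proof. by rewrite leq_mul2l (leq_trans (leq_subr _ _)) ?leq_addr ?orbT. Qed.

Lemma boundary_exponent_le i j : ((m * (i - j)).-1 <= m * (i + j))%N.
Proof. exact: leq_trans (leq_pred _) (rotation_exponent_le i j). Qed.

Lemma power_coef_le a i j : normc (power_coef (complexify a) e i j) <= `|a i j| * r ^+ (i + j).
Proof.
rewrite /power_coef normcM !normcr normrX ler_wpM2l // lerXn2r ?nnegrE //; exact: ltW.
Qed.

(** The weight of the exponent [m (i - j) - 1] is [m (i - j)], the factor by which
    the derivation of [zeta] acts. *)
Lemma perturbation_weight : weight_bound (wt R (fun i j => (m * (i - j)).-1))
  (power_coef (complexify g) e) 1 cr.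
Proof.
have [_ _ hh _ _] := solution_bounds; move=> N; apply: le_trans (hh N).
apply: square_sum_le => i j; rewrite expr1 /wt /hser /euler.
case: (leqP i j) => [ij|ij].
  by rewrite /power_coef /complexify gser_support // mul0r ComplexField.Normc.normc0 !mul0r mulr0 normr0 mul0r.
rewrite prednK ?muln_gt0 ?subn_gt0 ?ij ?(ltnW hm) //.
rewrite mulrC normrM normrN -natrB ?(ltnW ij) // -natrM normr_nat -mulrA.
by rewrite ler_wpM2l // power_coef_le.
Qed.

Lemma perturbation_lipschitz u v : normc u <= 1 -> normc v <= 1 ->
  normc (p u - p v) <= cr * normc (u - v).
Proof. exact: hol_lipschitz perturbation_weight. Qed.

Lemma perturbation_half_lipschitz u v : normc u <= 1 -> normc v <= 1 ->
  normc (p u - p v) <= 2^-1 * normc (u - v).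
Proof.
move=> u1 v1; apply: le_trans (perturbation_lipschitz u1 v1) _.
rewrite ler_wpM2r ?normc_ge0 //; have := cr_small; lra.
Qed.

Lemma amplitude_le t : normc (amp t) <= r.
Proof. by rewrite normc_amplitude ltW. Qed.

Lemma power_coef_real a i j :
  ((power_coef (complexify a) e i j)^*)%C = power_coef (complexify a) e i j.
Proof. by rewrite /power_coef /complexify conjcM !conjc_real. Qed.

Lemma perturbation_conj u : normc u <= 1 -> p (u^*)%C = ((p u)^*)%C.
Proof.
move=> u1; have h0 := weight_bound_le (weight_ge1 R _) perturbation_weight (leq0n 1).
rewrite /perturbation /hol -(csum_conj (summable_hol h0 u1)).
congr csum; apply/funext => i; apply/funext => j.
by rewrite conjcM power_coef_real -[RHS]/(_ * conjc (u ^+ _)) rmorphXn.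
Qed.

(** On the unit circle everything is a function of the amplitude variable. *)
Lemma perturbation_circle t : p (expi (- t)) = expi t * ev (amp t) g.
Proof.
have [[Mg hg] _] : bounded_array r g /\ True.
  by have [h _ _ _ _] := solution_bounds; split => //; exists cr.
rewrite /ev -(csumZ _ (monomials_summable r0 (amplitude_le t) hg)).
congr csum; apply/funext => i; apply/funext => j; rewrite monomials_amplitude.
case: (leqP i j) => [ij|ij].
  by rewrite /power_coef /complexify gser_support // !mul0r mulr0.
rewrite mulrCA -expi_mulrn -expiD; congr (_ * expi _).
rewrite -subn1 natrB ?muln_gt0 ?subn_gt0 ?ij ?(ltnW hm) //.
by rewrite natrM natrB ?(ltnW ij) //; ring.
Qed.

Lemma fold_circle t : fold (expi t) = expi (- t).
Proof. by rewrite /fold normc_expi lexx expiN. Qed.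

Lemma Phi_circle t : Fm (expi t) = expi t * (1 + ev (amp t) g).
Proof. by rewrite /Phi fold_circle perturbation_circle mulrDr mulr1. Qed.

Lemma slope_circle t : slope m tau e (expi (- t)) = 1 + ev (amp t) al.
Proof.
rewrite /slope (hol_ev m e t) // => i j ij.
have -> : al = g + hser m sol by [].
by rewrite !fctE gser_support ?(ltnW ij) // h_support ?(ltnW ij) // addr0.
Qed.

Lemma flow_part_support i j : (i <= j)%N -> flow_part m sol i j = 0.
Proof.
move=> ij; rewrite /flow_part !fctE h_support // add0r /sigser /mirror.
by rewrite (minn_idPl ij) (maxn_idPr ij) subrr.
Qed.

Lemma swirl_circle t : swirl m tau e (expi (- t)) =
  1 + (spin m tau e)%:C%C * ev (amp t) (flow_part m sol).
Proof. by rewrite /swirl (hol_ev m e t) // => i j ij; rewrite flow_part_support // ltnW. Qed.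

Lemma slope_lower u : normc u <= 1 -> 2^-1 <= normc (slope m tau e u).
Proof.
move=> u1; have [_ ha _ _ _] := solution_bounds.
have h0 : weight_bound (wt R (rotation_exponent m)) (power_coef (complexify al) e) 0 cr.
  move=> N; apply: le_trans (ha N); apply: square_sum_le => i j.
  by rewrite expr0 mulr1 power_coef_le.
have := hol_le h0 u1; rewrite /slope; move: (hol _ _ _) => w hw.
have := normcD (1 + w) (- w); rewrite addrK normcN [normc 1](_ : _ = 1).
  by have := cr_small; lra.
by rewrite /= expr1n expr0n addr0 sqrtr1.
Qed.

Lemma slope_neq0 u : normc u <= 1 -> slope m tau e u != 0.
Proof. by move=> /slope_lower h; rewrite -normc_eq0 gt_eqF // (lt_le_trans _ h). Qed.

Lemma bounded_al : bounded_array r al.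
Proof. by have [_ h _ _ _] := solution_bounds; exists cr. Qed.

Lemma bounded_g : bounded_array r g.
Proof. by have [h _ _ _ _] := solution_bounds; exists cr. Qed.

Lemma bounded_h : bounded_array r (hser m sol).
Proof. by have [_ _ h _ _] := solution_bounds; exists cr. Qed.

Lemma bounded_flow : bounded_array r (flow_part m sol).
Proof. exact: (bounded_flow_part r0 bounded_g bounded_h). Qed.

(** The flow extends continuously to the boundary, because its factors are
    Lipschitz up to the unit circle and the slope stays away from zero. *)
Lemma lab_flow_lipschitz : disk_lipschitz (lab_flow m tau kappa e).
Proof.
have [M1 h1] := weight_solution 1 bounded_al rotation_exponent_le.
have [M2 h2] := weight_solution 1 bounded_flow rotation_exponent_le.
apply: disk_lipschitzM; last first.
  apply: (@disk_lipschitzV _ _ 2^-1) => //; first exact: slope_lower.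
  apply: disk_lipschitzD; first exact: disk_lipschitz_cst.
  exact: disk_lipschitz_hol h1.
apply: disk_lipschitzM.
  apply: disk_lipschitzM; [exact: disk_lipschitz_cst|exact: disk_lipschitz_id].
apply: disk_lipschitzD; first exact: disk_lipschitz_cst.
apply: disk_lipschitzM; first exact: disk_lipschitz_cst.
exact: disk_lipschitz_hol h2.
Qed.

Local Notation U := (vortex_velocity m tau kappa e).
Local Notation Om := (kappa * spin m tau e).

(** Folding and the inverse homeomorphism are Lipschitz on the whole plane, so that
    the formula for the velocity makes sense and is continuous there. *)
Lemma velocity_continuous : continuous U.
Proof.
have [K K0 hK] := lab_flow_lipschitz.
apply: (@lipschitz_continuous _ _ _ _ (K * 4 + `|Om|)) => x y.
rewrite /vortex_velocity /relative_velocity opprD opprK addrACA.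
rewrite [- (_ *: perp x) + _](_ : _ = - (Om *: (perp x - perp y))); last first.
  by rewrite scalerBr opprB addrC.
rewrite mulrDl; apply: le_trans (ler_normB _ _) _; apply: lerD.
  rewrite -plane_ofB -conjcN -conjcD; apply: le_trans (plane_of_norm_le _) _.
  rewrite normc_conj.
  have [h _] := hK _ _ (fold_le1 (Gm (complex_of x))) (fold_le1 (Gm (complex_of y))).
  apply: le_trans h _; rewrite -mulrA ler_wpM2l //.
  apply: le_trans (fold_lipschitz _ _) _; apply: le_trans (Psi_lipschitz perturbation_half_lipschitz _ _) _.
  by rewrite -complex_ofB; have := normc_le_norm (x - y); lra.
rewrite normrZ ler_wpM2l // !prod_normE /= -opprD normrN.
by rewrite ge_max !le_max !lexx orbT.
Qed.

Lemma pressure_continuous : continuous (bernoulli_pressure (flow m tau kappa e) Om).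
Proof.
have cU := velocity_continuous.
have c1 : continuous (fun x : R * R => x.1).
  by apply: (@lipschitz_continuous _ _ _ _ 1) => u v; rewrite mul1r prod_normE le_max lexx.
have c2 : continuous (fun x : R * R => x.2).
  by apply: (@lipschitz_continuous _ _ _ _ 1) => u v; rewrite mul1r prod_normE le_max lexx orbT.
have d1 : continuous (fun x => (U x).1) by move=> x; apply: continuous_comp; [exact: cU|exact: c1].
have d2 : continuous (fun x => (U x).2) by move=> x; apply: continuous_comp; [exact: cU|exact: c2].
have cd (f1 f2 : R * R -> R) : continuous f1 -> continuous f2 ->
    continuous (fun x => f1 x * f1 x + f2 x * f2 x).
  by move=> h1 h2 x; apply: cvgD; apply: cvgM; [exact: h1|exact: h1|exact: h2|exact: h2].
move=> x; rewrite /bernoulli_pressure /dotp; apply: cvgD.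
  apply: cvgN; apply: cvgMl; exact: (cd _ _ d1 d2).
by apply: cvgMr; exact: (cd _ _ c1 c2).
Qed.

Local Notation f := (trig (freq R m) (power_coef (complexify (cnst 1 + g)) e)).
Local Notation V := (core p).
Local Notation D := (fluid_domain V).

Lemma bounded_trace_array : bounded_array r (cnst 1 + g).
Proof. exact: (bounded_arrayD r0 (bounded_array_cnst r 1) bounded_g). Qed.

Lemma trace_circle t : plane_of (Fm (expi t)) = f t.
Proof.
rewrite (trig_ev m r0 t bounded_trace_array (ltW er)) Phi_circle.
by rewrite (evD r0 (amplitude_le t) (bounded_array_cnst r 1) bounded_g) (ev_cnst r0 (amplitude_le t)) rmorph1.
Qed.

Lemma outside_near z : 1 < normc z -> exists2 eta : R, 0 < eta &
  forall v, normc (v - z) < eta -> 1 < normc v.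
Proof.
move=> z1; exists (normc z - 1) => [|v hv]; first by rewrite subr_gt0.
by have := normcD v (z - v); rewrite addrC subrK (normcB z) => h; lra.
Qed.

Lemma normc_inv z : normc z^-1 = (normc z)^-1.
Proof. exact: ComplexField.Normc.normcV. Qed.

Lemma normc_inv_lt1 z : 1 < normc z -> normc z^-1 < 1.
Proof. by move=> z1; rewrite normc_inv invf_lt1 // (lt_trans ltr01). Qed.

Lemma neq0_outside z : 1 <= normc z -> z != 0.
Proof. by move=> z1; rewrite -normc_eq0 gt_eqF // (lt_le_trans ltr01). Qed.

(** The map is holomorphic outside the disk, where the folding is the inversion. *)
Lemma Phi_C11 z : 1 < normc z -> C11 Fm (fun w => slope m tau e w^-1) z.
Proof.
move=> z1.
have [M hM] := weight_solution 2 bounded_g boundary_exponent_le.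
have zi := normc_inv_lt1 z1; have z0 := neq0_outside (ltW z1).
have hc := C11_add (C11_id z) (C11_comp (C11_invr z0) (C11_hol hM zi)).
apply: (@C11_ext R _ _ Fm (fun w => slope m tau e w^-1) z hc); have [eta eta0 heta] := outside_near z1.
exists eta; first exact: eta0.
move=> v /heta v1.
split; first by rewrite /Phi fold_ge1 // ltW.
have vi := normc_inv_lt1 v1; rewrite /slope; congr (_ + _).
have h0 := weight_bound_le (weight_ge1 R _) (weight_dcoef hM) (leq0n 1).
rewrite -exprVn mulrN [_ * _ ^+ 2]mulrC /hol.
rewrite -(csumZ _ (summable_hol h0 (ltW vi))).
rewrite -(csumN (summable_byZ (v^-1 ^+ 2) (summable_hol h0 (ltW vi)))).
congr csum; apply/funext => i; apply/funext => j; rewrite !fctE /dcoef.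
have -> : al = g + hser m sol by [].
rewrite /power_coef /complexify !fctE /hser /euler.
case: (leqP i j) => [ij|ij]; first by rewrite gser_support // !(mulr0, mul0r, addr0, oppr0).
have k2 : (2 <= m * (i - j))%N by rewrite (leq_trans hm) // leq_pmulr // subn_gt0.
have eK : v^-1 ^+ 2 * v^-1 ^+ (m * (i - j)).-1.-1 = v^-1 ^+ rotation_exponent m i j.
  by rewrite -exprD /rotation_exponent; congr (_ ^+ _); move: k2; clear; case: (m * _)%N => [|[]].
rewrite mulrCA eK -mulNr; congr (_ * _); rewrite !mulrA -mulNr; congr (_ * _).
have -> : ((m * (i - j)).-1)%:R = (m%:R * (i%:R - j%:R) - 1)%:C%C :> R[i].
  rewrite -subn1 natrB ?(leq_trans _ k2) // natrM natrB ?(ltnW ij) //.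
  by rewrite rmorphB rmorphM rmorphB /= !rmorph_nat.
by rewrite -rmorphM -rmorphN; congr (_%:C%C); ring.
Qed.

Lemma Psi_C11 z : 1 < normc (Gm z) ->
  C11 Gm (fun v => (slope m tau e (Gm v)^-1)^-1) z.
Proof.
move=> z1; apply: (@C11_right_inverse _ Fm (fun w => slope m tau e w^-1) Gm z 2) => //.
- exists 1 => // v w _ _; split; first exact: (Psi_lipschitz perturbation_half_lipschitz).
  exact: (PhiK perturbation_half_lipschitz).
- exact: Phi_C11.
- by apply: slope_neq0; apply/ltW/normc_inv_lt1.
Qed.

Lemma lab_flow_C11 : exists L', forall u, normc u < 1 -> C11 (lab_flow m tau kappa e) L' u.
Proof.
have [M1 h1] := weight_solution 2 bounded_al rotation_exponent_le.
have [M2 h2] := weight_solution 2 bounded_flow rotation_exponent_le.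
eexists => u u1.
have c1 := C11_add (C11_cst 1 u) (C11_hol h1 u1).
have c2 := C11_add (C11_cst 1 u) (C11_mul (C11_cst (spin m tau e)%:C%C u) (C11_hol h2 u1)).
have s0 := slope_neq0 (ltW u1).
exact: (C11_mul (C11_mul (C11_mul (C11_cst (- ('i%C * kappa%:C%C)) u) (C11_id u)) c2) (C11_inv c1 s0)).
Qed.

Lemma domainE : D = [set x | 1 < radial p x].
Proof. exact: (fluid_domain_core perturbation_half_lipschitz). Qed.

Lemma flow_C11 : exists w', forall x, D x -> C11 (flow m tau kappa e) w' (complex_of x).
Proof.
have [L' hL] := lab_flow_C11; eexists => x; rewrite domainE => x1.
have c1 := Psi_C11 x1.
have c2 := C11_comp c1 (C11_invr (neq0_outside (ltW x1))).
have c3 := C11_comp c2 (hL _ (normc_inv_lt1 x1)).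
apply: (C11_ext c3); have [eta eta0 heta] := outside_near x1.
exists (eta / 2) => [|v hv]; first by rewrite divr_gt0.
have v1 : 1 < normc (Gm v).
  apply: heta; apply: le_lt_trans (Psi_lipschitz perturbation_half_lipschitz _ _) _.
  by rewrite mulrC -ltr_pdivlMr.
by split; [rewrite /flow fold_ge1 // ltW|].
Qed.

Lemma domain_open : open D.
Proof. by rewrite /fluid_domain; apply: closed_openC; exact: closed_closure. Qed.

Lemma complex_lipschitz_continuous (F : R[i] -> R[i]) (K : R) :
  (forall z w, normc (F z - F w) <= K * normc (z - w)) ->
  continuous (F : R[i]^o -> R[i]^o).
Proof.
move=> h z; have fz := @nbhs_filter R[i]^o z.
apply/(@cvgrPdist_lt _ R[i]^o _ _ fz) => eps eps0.
have K1 : 0 < `|K| + 1 by rewrite ltr_wpDl.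
have re : 0 < cRe eps by move: eps0; rewrite ltcE => /andP[].
have eE : eps = (cRe eps)%:C%C.
  by move: eps0; case: (eps) => a b; rewrite ltcE /= => /andP[/eqP -> _].
apply/nbhs_ballP; exists (cRe eps / (`|K| + 1))%:C%C => /=.
  by rewrite ltcE /= eqxx divr_gt0.
move=> w; rewrite -ball_normE /= absc_normc ltcR => hw.
rewrite absc_normc eE ltcR; apply: le_lt_trans (h z w) _.
apply: (@le_lt_trans _ _ ((`|K| + 1) * normc (z - w))).
  by rewrite ler_wpM2r ?normc_ge0 // (le_trans (ler_norm K)) // lerDl.
by rewrite mulrC -ltr_pdivlMr.
Qed.

Lemma perturbation_origin : p 0 = 0.
Proof.
rewrite /perturbation /hol.
rewrite (_ : (fun i j => _) = (fun i j => 0 : R[i])); last first.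
  apply/funext => i; apply/funext => j; case: (leqP i j) => [ij|ij].
    by rewrite /power_coef /complexify gser_support // !mul0r.
  rewrite expr0n; case: eqP => [h|_]; last by rewrite mulr0.
  have : (1 < m * (i - j))%N by rewrite (leq_trans hm) // leq_pmulr // subn_gt0.
  by move: h; case: (m * _)%N => [|[]].
have [_ ->] := @csum_support R (fun _ _ => 0) 0 (fun _ _ _ => erefl).
by rewrite /square_sum big_ord0.
Qed.

Lemma Phi_exterior : exterior_conformal_map Fm D.
Proof.
split.
- move=> z; rewrite /= absc_normc -[1]/(1%:C%C) ltcR => z1.
  exact: C11_derivable (Phi_C11 z1).
- by move=> z w _ _; exact: (Phi_inj perturbation_half_lipschitz).
- rewrite domainE; apply/seteqP; split => x.
    move=> [z]; rewrite /= absc_normc -[1]/(1%:C%C) ltcR => z1 <-.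
    by rewrite /radial plane_ofK (PsiK perturbation_half_lipschitz).
  move=> x1; exists (Gm (complex_of x)); last by rewrite (PhiK perturbation_half_lipschitz) complex_ofK.
  by rewrite /= absc_normc -[1]/(1%:C%C) ltcR.
- apply: continuous_subspaceT; exact: complex_lipschitz_continuous (Phi_lipschitz perturbation_half_lipschitz).
- move=> eps eps0; exists (1 + eps^-1) => z; rewrite absc_normc ltcR => hz.
  have ei : 0 < eps^-1 by rewrite invr_gt0.
  have z1 : 1 < normc z by lra.
  rewrite ltcR /Phi addrC addKr fold_ge1 ?(ltW z1) //.
  have h := perturbation_half_lipschitz (ltW (normc_inv_lt1 z1)) (_ : normc 0 <= 1).
  rewrite perturbation_origin !subr0 ComplexField.Normc.normc0 in h.
  apply: le_lt_trans (h ler01) _; rewrite normc_inv.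
  apply: (@lt_trans _ _ (normc z)^-1).
    by rewrite gtr_pMl ?invr_gt0 ?(lt_trans ltr01) // invf_lt1 // ltr1n.
  have z0 : 0 < normc z by lra.
  by rewrite -[eps]invrK ltf_pV2 ?posrE //; lra.
Qed.

Lemma rotation_complex (a : R) x : complex_of (rotation a x) = expi a * complex_of x.
Proof.
case: x => u v; apply/eqP; rewrite eq_complex /=.
by apply/andP; split; apply/eqP; ring.
Qed.

Lemma complex_of_inj x y : complex_of x = complex_of y -> x = y.
Proof. by move=> h; rewrite -(complex_ofK x) h complex_ofK. Qed.

Lemma velocity_complex x : complex_of (U x) =
  ((flow m tau kappa e (complex_of x))^*)%C - 'i%C * Om%:C%C * complex_of x.
Proof.
rewrite /vortex_velocity /relative_velocity complex_ofB plane_ofK; congr (_ - _).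
case: x => a b; rewrite /complex_of /perp.
change ((Om * - b) +i* (Om * a) = 'i%C * Om%:C%C * (a +i* b))%C.
by apply/eqP; rewrite eq_complex /=; apply/andP; split; apply/eqP; ring.
Qed.

Lemma expi_2pi : expi (2 * pi) = 1 :> R[i].
Proof. by rewrite mulr_natl /expi cos2pi sin2pi. Qed.

Section Rotation.
Let w := expi (2 * pi / m%:R) : R[i].
Let ww : w * (w^*)%C = 1. Proof. exact: expi_conjM. Qed.

Lemma rotation_power : (w^*)%C ^+ m = 1.
Proof.
have m0 : m%:R != 0 :> R by rewrite pnatr_eq0 -lt0n ltnW.
rewrite -rmorphXn -expi_mulrn [m%:R * _](_ : _ = 2 * pi); last by field.
by rewrite expi_2pi rmorph1.
Qed.

Lemma perturbation_rotation u : normc u <= 1 -> p ((w^*)%C * u) = w * p u.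
Proof.
move=> u1; have h0 := weight_bound_le (weight_ge1 R _) perturbation_weight (leq0n 1).
rewrite /perturbation /hol -(csumZ _ (summable_hol h0 u1)).
congr csum; apply/funext => i; apply/funext => j.
case: (leqP i j) => [ij|ij].
  by rewrite /power_coef /complexify gser_support // !mul0r mulr0.
have k1 : (0 < m * (i - j))%N by rewrite muln_gt0 subn_gt0 ij ltnW.
rewrite exprMn mulrCA; congr (_ * _).
rewrite -[LHS]mulr1 -ww (mulrC w) mulrA -exprSr prednK // exprM rotation_power expr1n.
by rewrite mul1r.
Qed.

Lemma fold_rotation z : fold (w * z) = (w^*)%C * fold z.
Proof.
rewrite /fold normcM normc_expi mul1r conjcM invfM; case: ifP => // _.
congr (_ * _); apply: (mulfI (expi_neq0 (2 * pi / m%:R))).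
by rewrite divff ?expi_neq0 // -[RHS]ww.
Qed.

Lemma Phi_rotation z : Fm (w * z) = w * Fm z.
Proof. by rewrite /Phi fold_rotation perturbation_rotation ?fold_le1 // mulrDr. Qed.

Lemma Psi_rotation z : Gm (w * z) = w * Gm z.
Proof. by apply: (Phi_inj perturbation_half_lipschitz); rewrite Phi_rotation !(PhiK perturbation_half_lipschitz). Qed.

Lemma lab_flow_rotation u : lab_flow m tau kappa e ((w^*)%C * u) =
  (w^*)%C * lab_flow m tau kappa e u.
Proof.
have key a : hol (power_coef (complexify a) e) (rotation_exponent m) ((w^*)%C * u) =
    hol (power_coef (complexify a) e) (rotation_exponent m) u.
  congr csum; apply/funext => i; apply/funext => j.
  by rewrite exprMn /rotation_exponent exprM rotation_power expr1n mul1r.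
by rewrite /lab_flow /swirl /slope !key; move: (_^-1) => q; ring.
Qed.

Lemma radial_rotation x : radial p (rotation (2 * pi / m%:R) x) = radial p x.
Proof. by rewrite /radial rotation_complex Psi_rotation normcM normc_expi mul1r. Qed.

(** The exponents in the exterior map are [1] modulo [m], and those of the slope
    and of the swirl are multiples of [m]. *)
Lemma vortex_mfold : mfold_symmetric m V U.
Proof.
split.
  rewrite domainE; apply/seteqP; split => x /=.
    by move=> [y y1 <-]; rewrite radial_rotation.
  move=> x1; exists (plane_of ((w^*)%C * complex_of x)); last first.
    by apply: complex_of_inj; rewrite rotation_complex plane_ofK mulrA -/w ww mul1r.
  rewrite -radial_rotation [rotation _ _](_ : _ = x) //.
  by apply: complex_of_inj; rewrite rotation_complex plane_ofK mulrA -/w ww mul1r.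
move=> x _; apply: complex_of_inj.
rewrite rotation_complex !velocity_complex rotation_complex -/w.
rewrite /flow Psi_rotation fold_rotation lab_flow_rotation conjcM conjcK.
by ring.
Qed.

End Rotation.

Lemma csum_freq_ev a t : bounded_array r a ->
  csum (fun i j => power_coef (complexify a) e i j * expi (freq R m i j * t)) =
  expi t * ev (amp t) a.
Proof.
move=> ba; have := trig_ev m r0 t ba (ltW er); rewrite /trig => /(congr1 (@complex_of R)).
by rewrite !plane_ofK.
Qed.

Lemma freq_weight_bound a L : bounded_array r a ->
  exists M, weight_bound (freq_weight R m) (power_coef (complexify a) e) L M.
Proof.
move=> ba.
have W0 i j : 0 <= freq_weight R m i j <= m.+1%:R * (i + j).+1%:R.
  by rewrite freq_weight_linear (le_trans ler01) // freq_weight1.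
have [|M _ hM] := weight_bounded L (ler0n _ _) W0 ba (q := `|e|); first by rewrite normr_ge0.
by exists M; apply: hM.
Qed.

Lemma trace_tderiv : tderiv (freq R m) (power_coef (complexify (cnst 1 + g)) e) =
  fun i j => 'i%C * power_coef (complexify (cnst 1 + al)) e i j.
Proof.
apply/funext => i; apply/funext => j; rewrite /tderiv /power_coef /complexify -mulrA.
congr (_ * _); rewrite mulrA -rmorphM; congr (_%:C%C * _).
have -> : al = g + hser m sol by [].
rewrite !fctE /hser /euler /freq /cnst; case: ifP => [/andP[/eqP -> /eqP ->]|_]; ring.
Qed.

Lemma bounded_slope_array : bounded_array r (cnst 1 + al).
Proof. exact: (bounded_arrayD r0 (bounded_array_cnst r 1) bounded_al). Qed.

Local Notation A t := (1 + ev (amp t) al).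
Local Notation B t := (1 + ev (amp t) g).
Local Notation K t := (1 + ev (amp t) (kser m sol)).

Lemma ev_1_add a t : bounded_array r a -> ev (amp t) (cnst 1 + a) = 1 + ev (amp t) a.
Proof.
move=> ba; rewrite (evD r0 (amplitude_le t) (bounded_array_cnst r 1) ba).
by rewrite (ev_cnst r0 (amplitude_le t)) rmorph1.
Qed.

Lemma trace_derive t : is_derive t 1 f (plane_of ('i%C * (expi t * A t))).
Proof.
have [M hM] := freq_weight_bound 2 bounded_trace_array.
have := trig_is_derive (freq_weight1 R m) (freq_le R m) t hM.
rewrite trace_tderiv /trig.
have [M' hM'] := freq_weight_bound 0 bounded_slope_array.
have hs := summable_trig (freq R m) t hM'.
rewrite (_ : (fun i j => _) = fun i j => 'i%C *
  (power_coef (complexify (cnst 1 + al)) e i j * expi (freq R m i j * t))); last first.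
  by apply/funext => i; apply/funext => j; rewrite mulrA.
by rewrite (csumZ _ hs) (csum_freq_ev _ bounded_slope_array) ev_1_add //; exact: bounded_al.
Qed.

Lemma trace_derive1 t : derive1 f t = plane_of ('i%C * (expi t * A t)).
Proof. by rewrite derive1E; case: (trace_derive t). Qed.

Lemma ev_al_le t : normc (ev (amp t) al) <= cr.
Proof.
have [_ h _ _ _] := solution_bounds.
by apply: normc_csum_le; apply: (monomials_summable r0 (amplitude_le t) h).
Qed.

Lemma slope_circle_neq0 t : A t != 0.
Proof. by rewrite -slope_circle slope_neq0 // normc_expi. Qed.

Lemma trace_derive1_continuous : continuous (derive1 f).
Proof.
have [M hM] := freq_weight_bound 2 bounded_trace_array.
rewrite (derive1_trig (freq_weight1 R m) (freq_le R m) hM).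
have hT := weight_tderiv (freq_weight1 R m) (freq_le R m) hM.
have hL (s t : R) := trig_lipschitz (freq_weight1 R m) (freq_le R m) s t hT.
exact: (lipschitz_continuous hL).
Qed.

(** To first order the inward normal displacement of a boundary point is the
    image of the radial one: the difference is controlled by the small Lipschitz
    constant of the perturbation. *)
Lemma inward_normal t s : 0 < s < 1 -> V (f t + s *: perp (derive1 f t)).
Proof.
move=> /andP[s0 s1]; rewrite /core /= /radial -trace_circle trace_derive1.
set z := expi t; have z1 : normc z = 1 by exact: normc_expi.
have -> : complex_of (plane_of (Fm z) + s *: perp (plane_of ('i%C * (z * A t)))) =
    Fm z - s%:C%C * (z * A t).
  case: (Fm z) (z * A t) => a b [c d]; rewrite /complex_of /perp /plane_of.
  apply/eqP; rewrite eq_complex /=; apply/andP; split; apply/eqP.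
    by change (a + s * - (0 * d + 1 * c) = a - (s * c - 0 * d)); ring.
  by change (b + s * (0 * c - 1 * d) = b - (s * d + 0 * c)); ring.
set Y := Fm z - _; pose z' := (1 - s)%:C%C * z.
have nz' : normc z' = 1 - s by rewrite normcM z1 mulr1 normcr ger0_norm // subr_ge0 ltW.
have hz' : Y - Fm z' = (p (z^*)%C - p (z'^*)%C) - s%:C%C * z * ev (amp t) al.
  rewrite /Y /Phi /fold z1 lexx nz' ifT; last by lra.
  have key (w q a b c : R[i]) : w + a - q * (w * (1 + c)) - ((1 - q) * w + b) =
      a - b - q * w * c by ring.
  by rewrite -key /z' rmorphB rmorph1.
have zz : (z^*)%C - (z'^*)%C = s%:C%C * (z^*)%C.
  have key (w q : R[i]) : w - (1 - q) * w = q * w by ring.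
  by rewrite -key /z' conjcM conjc_real rmorphB rmorph1.
have h1 : normc (Y - Fm z') <= s * cr + s * cr.
  rewrite hz'; apply: le_trans (normcD _ _) _; rewrite normcN; apply: lerD.
    apply: le_trans (perturbation_lipschitz _ _) _; rewrite ?normc_conj ?z1 ?nz' //; first lra.
    by rewrite zz normcM normcr normc_conj z1 mulr1 gtr0_norm // mulrC.
  by rewrite !normcM z1 mulr1 normcr gtr0_norm // ler_wpM2l ?ev_al_le // ltW.
have := Psi_lipschitz perturbation_half_lipschitz Y (Fm z'); rewrite (PsiK perturbation_half_lipschitz) => h2.
have := normcD (Gm Y - z') z'; rewrite subrK nz' => h3.
have := cr_small; move: h1 h2 h3 s0; clear; nra.
Qed.

Lemma trace_regular : [/\ forall t, f (t + 2 * pi) = f t,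
  forall t, derivable f t 1, continuous (derive1 f) & forall t, derive1 f t != 0].
Proof.
split.
- by move=> t; rewrite -!trace_circle expiD expi_2pi mulr1.
- by move=> t; case: (trace_derive t).
- exact: trace_derive1_continuous.
- move=> t; rewrite trace_derive1; apply/eqP => /(congr1 (@complex_of R)); rewrite plane_ofK.
  have -> : complex_of (0 : R * R) = 0 by [].
  move/eqP; rewrite !mulf_eq0 (negbTE (slope_circle_neq0 t)) (negbTE (expi_neq0 t)) !orbF.
  by rewrite eq_complex /= oner_eq0 andbF.
Qed.

Lemma frontier_trace : frontier V = range f.
Proof.
rewrite (frontier_core perturbation_half_lipschitz); apply/seteqP; split => x /=.
  move=> /expi_surj[t _ ht]; exists t => //.
  by rewrite -trace_circle -ht (PhiK perturbation_half_lipschitz) complex_ofK.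
by move=> [t _ <-]; rewrite -trace_circle /radial plane_ofK (PsiK perturbation_half_lipschitz) normc_expi.
Qed.

Lemma trace_ccw : ccw_parametrization V f.
Proof.
split; first exact: trace_regular.
split; last first.
- move=> t; near=> s; apply: inward_normal; apply/andP; split; near: s.
    exact: nbhs_right_gt.
  exact: nbhs_right_lt.
- exact/esym/frontier_trace.
- move=> s t /set_mem; rewrite /= in_itv /= => hs /set_mem; rewrite /= in_itv /= => ht.
  move=> h; apply: (expi_inj hs ht); apply: (Phi_inj perturbation_half_lipschitz).
  have hz (v : R) : Fm (expi v) = complex_of (f v) by rewrite -trace_circle plane_ofK.
  by rewrite (hz s) (hz t) h.
Unshelve. all: by end_near. Qed.

Local Notation S := (spin m tau e).
Local Notation M t := (mean_flow m sol (amp t)).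

Lemma real_complexM (a b : R) : ((a * b)%:C)%C = (a%:C)%C * (b%:C)%C :> R[i].
Proof. exact: (rmorphM (real_complex R)). Qed.

Lemma real_complexB (a b : R) : ((a - b)%:C)%C = (a%:C)%C - (b%:C)%C :> R[i].
Proof. exact: (rmorphB (real_complex R)). Qed.

Lemma bounded_kap : bounded_array r (inverse_tail sol).
Proof. by have [] := solution_bounds. Qed.

Lemma bounded_delta : bounded_array r (omega_tail sol).
Proof. by have [] := solution_bounds. Qed.

Lemma slope_inverse t : K t * A t = 1.
Proof.
exact: (ev_inverse r0 (inverse_fixed m tau) bounded_g bounded_h bounded_kap (amplitude_le t)).
Qed.

Lemma mean_flow_real t : ((M t)^*)%C = M t.
Proof. exact: (mean_flow_conj r0 bounded_g bounded_h (amplitude_le t)). Qed.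

Lemma mean_flow_complement t : M t + ev (amp t) (flow_part m sol) = A t * ((B t)^*)%C.
Proof. exact: (mean_flow_split r0 bounded_g bounded_h (amplitude_le t)). Qed.

(** A diagonal array depends on the modulus of the amplitude variable alone, which
    is constant along the circle. *)
Lemma ev_delta t : ev (amp t) (omega_tail sol) =
  (scalar_sum (power_coef (complexify (omega_tail sol)) e))%:C%C.
Proof.
have [Md hd] := bounded_delta.
rewrite (ev_diag _ (@delta_diag _ m tau)).
have E2 : power_coef (complexify (omega_tail sol)) e =
    fun i j => (omega_tail sol i j * e ^+ (i + j))%:C%C.
  by apply/funext => i; apply/funext => j; rewrite /power_coef /complexify -rmorphM.
rewrite E2 (_ : (fun i j => _) = fun i j => (omega_tail sol i j * e ^+ (i + j))%:C%C); last first.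
  apply/funext => i; apply/funext => j; congr (_%:C%C).
  case: (eqVneq i j) => [->|ij]; last by rewrite delta_diag // !mul0r.
  by rewrite normc_amplitude addnn -mul2n !exprM real_normK ?num_real.
apply: (@csum_real _ _ Md) => N; apply: le_trans (hd N); apply: square_sum_le => i j.
have := power_coef_le (omega_tail sol) i j.
by rewrite /power_coef /complexify -rmorphM.
Qed.

Lemma ev_spin t : ev (amp t) (omser tau sol) = S%:C%C.
Proof.
rewrite (ev_omser tau r0 bounded_delta (amplitude_le t)) ev_delta.
by rewrite /spin !rmorphD rmorph1.
Qed.

(** The part of [F' conj(1 + g)] that is not real cancels between the lab flow and
    the rotation of the frame. *)
Lemma velocity_circle t : complex_of (U (f t)) =
  'i%C * kappa%:C%C * expi t * (((K t)^*)%C * (1 - S%:C%C * M t)).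
Proof.
rewrite velocity_complex -trace_circle plane_ofK /flow (PsiK perturbation_half_lipschitz) fold_circle.
rewrite /lab_flow swirl_circle slope_circle Phi_circle.
have AE : (A t)^-1 = K t by apply: (mulIf (slope_circle_neq0 t)); rewrite mulVf ?slope_circle_neq0 // slope_inverse.
rewrite AE expiN !conjcM conjcK conjcN conjcM conjc_real.
have -> : ('i^*)%C = - 'i%C :> R[i] by apply/eqP; rewrite eq_complex /= oppr0 !eqxx.
have -> : ((1 + S%:C%C * ev (amp t) (flow_part m sol))^*)%C =
    1 + S%:C%C * ((ev (amp t) (flow_part m sol))^*)%C.
  by rewrite conjcD conjc1 conjcM conjc_real.
have BE : B t = ((K t)^*)%C * (M t + ((ev (amp t) (flow_part m sol))^*)%C).
  rewrite -{1}(mean_flow_real t) -conjcD mean_flow_complement -conjcM mulrA slope_inverse mul1r conjcK //.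
rewrite BE real_complexM; move: ((K t)^*)%C (M t) ((ev _ (flow_part _ _))^*)%C (expi t).
by move=> a b c d; move: S%:C%C kappa%:C%C => u v; ring.
Qed.

Lemma dotp_plane (z w : R[i]) : dotp (plane_of z) (plane_of w) = cRe ((z^*)%C * w).
Proof. by case: z w => a b [c d]; rewrite /dotp /=; ring. Qed.

(** Tangency and speed at once: this product is real because [F'] and its inverse
    cancel and the mean flow is real. *)
Lemma tangential_product t :
  ('i%C * (expi t * A t))^*%C * complex_of (U (f t)) =
  (kappa * (1 - S * cRe (M t)))%:C%C.
Proof.
rewrite velocity_circle !conjcM.
have -> : ('i^*)%C = - 'i%C :> R[i] by apply/eqP; rewrite eq_complex /= oppr0 !eqxx.
have Mr : M t = (cRe (M t))%:C%C.
  have := mean_flow_real t; case: (M t) => a b [hb]; apply/eqP; rewrite eq_complex /= eqxx.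
  by apply/eqP; lra.
have ai : ((A t)^*)%C * ((K t)^*)%C = 1 by rewrite -conjcM mulrC slope_inverse conjc1.
have ee := expi_conjM t.
have ii : 'i%C * 'i%C = -1 :> R[i] by apply/eqP; rewrite eq_complex /=; apply/andP; split; apply/eqP; ring.
rewrite {1}Mr !(real_complexM, real_complexB) -[(1%:C)%C]/(1 : R[i]).
transitivity (- ('i%C * 'i%C) * (expi t * ((expi t)^*)%C) * (((A t)^*)%C * ((K t)^*)%C) *
   (kappa%:C%C * (1 - S%:C%C * (cRe (M t))%:C%C))); last by rewrite ii ee ai opprK !mul1r.
move: ((A t)^*)%C ((K t)^*)%C (expi t) ((expi t)^*)%C => a k q q'.
by move: S%:C%C kappa%:C%C (cRe (M t))%:C%C => u v c; ring.
Qed.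

Lemma velocity_tangential t : dotp (derive1 f t) (U (f t)) = kappa * (1 - S * cRe (M t)).
Proof. by rewrite trace_derive1 -(complex_ofK (U (f t))) dotp_plane tangential_product. Qed.

Lemma velocity_normal t : dotp (perp (derive1 f t)) (U (f t)) = 0.
Proof.
rewrite trace_derive1.
have := tangential_product t; move: ('i%C * _) (U (f t)) => [a b] [c d].
by rewrite /dotp /perp /complex_of /= => -[_]; lra.
Qed.

Lemma dotp_normc x : dotp x x = normc (complex_of x) ^+ 2.
Proof. by rewrite sqr_normc_sum; case: x => a b; rewrite /dotp /= !expr2. Qed.

(** The defect is diagonal, hence constant along the circle. *)
Lemma pressure_boundary : exists c, forall t,
  bernoulli_pressure (flow m tau kappa e) Om (f t) = c.
Proof.
pose cst : R[i] := (tau%:C%C + (scalar_sum (power_coef (complexify (omega_tail sol)) e))%:C%C) ^+ 2 -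
   (1 + tau%:C%C + (scalar_sum (power_coef (complexify (omega_tail sol)) e))%:C%C) ^+ 2 +
   csum (fun i j => (defect m tau i j * `|e| ^+ (i + j))%:C%C).
exists (- (kappa ^+ 2 / 2) * cRe cst) => t.
have nk := bounded_kap.
have bern := bernoulli tau r0 (inverse_fixed m tau) bounded_g bounded_h nk bounded_delta (amplitude_le t).
rewrite ev_spin ev_delta in bern.
have dE : ev (amp t) (defect_of m tau sol) = csum (fun i j => (defect m tau i j * `|e| ^+ (i + j))%:C%C).
  by rewrite -(normc_amplitude m e t) -ev_diag // => i j; exact: (defect_diag hm htau).
rewrite dE -/cst in bern.
have Mr : M t = (cRe (M t))%:C%C.
  have := mean_flow_real t; case: (M t) => a b [hb]; apply/eqP; rewrite eq_complex /= eqxx.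
  by apply/eqP; lra.
have i1 : normc ('i%C : R[i]) = 1 by rewrite /= expr0n expr1n add0r sqrtr1.
pose q := 1 - S * cRe (M t).
have qE : 1 - S%:C%C * M t = q%:C%C by rewrite Mr -real_complexM -[1 - _]real_complexB.
have reE (a : R) : cRe (a%:C)%C = a by [].
have b2 : q ^+ 2 * normc (K t) ^+ 2 - S ^+ 2 * normc (B t) ^+ 2 = cRe cst.
  rewrite -bern qE !mulr_conjc (expr2 (q%:C)%C) (expr2 (S%:C)%C).
  by rewrite -!real_complexM -real_complexB reE !expr2.
rewrite /bernoulli_pressure -/(vortex_velocity m tau kappa e) !dotp_normc velocity_circle.
rewrite -trace_circle plane_ofK Phi_circle qE !normcM normc_expi i1 normc_conj !mul1r mulr1.
rewrite -b2 !normcr !exprMn !real_normK ?num_real //.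
by field.
Qed.

Section SmallAmplitude.
Hypothesis small_g :
  weight_bound (freq_weight R m) (power_coef (complexify g) e) 1 2^-1.
Hypothesis small_al :
  weight_bound (freq_weight R m) (power_coef (complexify al) e) 1 2^-1.

Local Notation x t := ((f t).1).
Local Notation y t := ((f t).2).
Local Notation x' t := (- cIm (expi t * A t)).
Local Notation y' t := (cRe (expi t * A t)).

Let sin_pos (t : R) : 0 < t < pi -> 0 < sin t.
Proof. exact: sin_gt0_pi. Qed.

Lemma plane_of_imaginary_mul (z : R[i]) : plane_of ('i%C * z) = (- cIm z, cRe z).
Proof. by case: z => a b; rewrite /plane_of /=; congr (_, _); ring. Qed.

Lemma components_derive t : is_derive t 1 (fun t => x t) (x' t) /\
  is_derive t 1 (fun t => y t) (y' t).
Proof. by have := is_derive_components (trace_derive t); rewrite plane_of_imaginary_mul. Qed.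

Lemma sine_dominated a t : bounded_array r a ->
  weight_bound (freq_weight R m) (power_coef (complexify a) e) 1 2^-1 ->
  0 < t < pi -> 0 < cIm (expi t * (1 + ev (amp t) a)).
Proof.
move=> ba ha ht; have st := sin_pos ht.
have hI : (trig (freq R m) (power_coef (complexify a) e) t).2 = cIm (expi t * ev (amp t) a).
  by rewrite (trig_ev m r0 t ba (ltW er)).
have := sine_series_le t ha; rewrite (gtr0_norm st) hI mulrDr mulr1.
have -> : cIm (expi t + expi t * ev (amp t) a) = sin t + cIm (expi t * ev (amp t) a).
  by case: (expi t * _).
by rewrite ler_norml => /andP[h1 h2]; lra.
Qed.

Lemma y_positive t : 0 < t < pi -> 0 < y t.
Proof.
move=> ht; have := sine_dominated bounded_g small_g ht.
by rewrite -Phi_circle -trace_circle.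
Qed.

Lemma x_continuous : continuous (fun t => x t).
Proof.
move=> t; apply/differentiable_continuous/derivable1_diffP.
by have [[h _] _] := components_derive t.
Qed.

Lemma y_continuous : continuous (fun t => y t).
Proof.
move=> t; apply/differentiable_continuous/derivable1_diffP.
by have [_ [h _]] := components_derive t.
Qed.

Lemma x'_continuous : continuous (fun t => x' t).
Proof.
have -> : (fun t => x' t) = (fun t => (derive1 f t).1).
  by apply/funext => t; rewrite trace_derive1 plane_of_imaginary_mul.
move=> t; apply: continuous_comp; first exact: trace_derive1_continuous.
by apply: (@lipschitz_continuous _ _ _ fst 1) => u v; rewrite mul1r prod_normE le_max lexx.
Qed.

Lemma x_decreasing : {in `[0, pi] &, {homo (fun t => x t) : s t /~ s < t}}.
Proof.
apply: ltr0_derive1_lt_cc.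
- move=> t _; by have [[h _] _] := components_derive t.
- move=> t ht; rewrite derive1E; have [[_ ->] _] := components_derive t.
  by rewrite oppr_lt0; apply: (sine_dominated bounded_al small_al); rewrite in_itv in ht.
- exact: (continuous_subspaceT x_continuous).
Qed.

Local Notation T := (cauchy (cnst 1 + al) (flip (cnst 1 + g))).
Local Notation Mean := (cnst 1 + g + flip g + sigser m sol).

Lemma bounded_area_array : bounded_array r T.
Proof. exact: (bounded_array_cauchy r0 bounded_slope_array (bounded_array_flip bounded_trace_array)). Qed.

Lemma bounded_mean_array : bounded_array r Mean.
Proof.
apply: (bounded_arrayD r0 (bounded_arrayD r0 bounded_trace_array (bounded_array_flip bounded_g))).
exact: (bounded_sigser r0 bounded_g bounded_h).
Qed.

Lemma ev_mean_array t : ev (amp t) Mean = M t.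
Proof.
have am := amplitude_le t; have bf := bounded_array_flip bounded_g.
rewrite (evD r0 am (bounded_arrayD r0 bounded_trace_array bf) (bounded_sigser r0 bounded_g bounded_h)).
by rewrite (evD r0 am bounded_trace_array bf) (ev_flip r0 am bounded_g) ev_1_add //; exact: bounded_g.
Qed.

Lemma ev_area_array t : ev (amp t) T = A t * ((B t)^*)%C.
Proof.
have am := amplitude_le t; have bf := bounded_array_flip bounded_trace_array.
rewrite (ev_cauchy r0 am bounded_slope_array bf) (ev_flip r0 am bounded_trace_array) !ev_1_add //.
  exact: bounded_g.
exact: bounded_al.
Qed.

(** The flow part carries only nonzero frequencies. *)
Lemma mean_area_array : mean_value T e = mean_value Mean e.
Proof.
rewrite /mean_value; congr (scalar_sum _); apply/funext => i; apply/funext => j.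
case: eqVneq => // ->; congr (_%:C%C * _).
have TE : T = Mean + flow_part m sol.
  have c1 (a : nat -> nat -> R) : cauchy (cnst 1) a = a.
    by apply/funext => k; apply/funext => l; rewrite cauchy_cnstl mul1r.
  have fE : flip (cnst 1 + g) = cnst 1 + flip g.
    by rewrite -[LHS]/(flip (cnst 1) + flip g) flip_cnst.
  rewrite fE cauchyDl c1 [cauchy al _]cauchyDr [cauchy al (cnst 1)]cauchyC c1.
  apply/funext => k; apply/funext => l.
  change (cnst 1 k l + flip g k l + (g k l + hser m sol k l + cauchy al (flip g) k l) =
    cnst 1 k l + g k l + flip g k l + sigser m sol k l +
    (hser m sol k l + cauchy al (flip g) k l - sigser m sol k l)).
  by ring.
by rewrite TE !fctE flow_part_support // addr0.
Qed.

(** [x y' - y x'] is the real part of [F' conj(1 + g)], and it differs from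
    [- 2 y x'] by the derivative of [x y], which vanishes at the ends. *)
Lemma area_primitive t :
  is_derive t 1 (fun s => mean_primitive m T e s - x s * y s) (- 2 * (y t * x' t)).
Proof.
have [dx dy] := components_derive t.
have dP := mean_primitive_derive (ltnW hm) t bounded_area_array er.
have := is_deriveB dP (is_deriveM dx dy).
suff -> : cRe (ev (amp t) T) - (x t *: y' t + y t *: x' t) = - 2 * (y t * x' t) by [].
have e1 : cRe (ev (amp t) T) = x t * y' t - y t * x' t.
  rewrite ev_area_array -trace_circle Phi_circle.
  have -> : A t * ((B t)^*)%C = ((expi t * B t)^*)%C * (expi t * A t).
    rewrite conjcM -[LHS]mul1r -(expi_conjM t).
    by move: (expi t) ((expi t)^*)%C (A t) ((B t)^*)%C => q q' a b; ring.
  by case: (expi t * B t) (expi t * A t) => a b [c d] /=; ring.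
have key (a b c d : R) : a * b - c * d - (a *: b + c *: d) = - 2 * (c * d).
  by rewrite /GRing.scale /=; ring.
by rewrite e1 key.
Qed.

Lemma area_core_mean : area V = (mean_value Mean e * pi)%:E.
Proof.
have ht t : plane_of (Fm (expi t)) = (x t, y t) by rewrite trace_circle; case: (f t).
have hx t : is_derive t 1 (fun t => x t) (x' t) by have [] := components_derive t.
rewrite (area_core perturbation_half_lipschitz perturbation_conj ht x_decreasing y_positive hx x'_continuous y_continuous).
have [P0 Pp _] := mean_primitive_values r0 (ltnW hm) bounded_area_array (ltW er).
have p0' : (0 : R) < pi by exact: pi_gt0.
have cF : continuous (fun s => mean_primitive m T e s - x s * y s).
  move=> t; apply/differentiable_continuous/derivable1_diffP.
  by have [h _] := area_primitive t.
have [y0 yp] := y_ends perturbation_conj ht.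
rewrite (@continuous_FTC2 R _ (fun s => mean_primitive m T e s - x s * y s) 0 pi p0').
- by rewrite y0 yp P0 Pp !mulr0 !subr0 mean_area_array -EFinB subr0.
- apply: continuous_subspaceT => t; apply: cvgM; first exact: cvg_cst.
  by apply: cvgM; [exact: y_continuous|exact: x'_continuous].
- split; first by move=> t _; have [h _] := area_primitive t.
    by apply: cvg_at_right_filter; exact: cF.
  by apply: cvg_at_left_filter; exact: cF.
- by move=> t _; rewrite derive1E; have [_ ->] := area_primitive t.
Qed.

Lemma Re_ev_continuous a : bounded_array r a -> continuous (fun t => cRe (ev (amp t) a)).
Proof.
move=> ba; have [N hN] := freq_weight_bound 1 ba.
have E t : cRe (ev (amp t) a) = (trig (oscillation R m) (power_coef (complexify a) e) t).1.
  apply: (congr1 (fun z => cRe z)); congr csum.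
  by apply/funext => i; apply/funext => j; rewrite monomials_amplitude.
have hL (s t : R) : `|(trig (oscillation R m) (power_coef (complexify a) e) s).1 -
    (trig (oscillation R m) (power_coef (complexify a) e) t).1| <= 2 * N * `|s - t|.
  apply: le_trans (trig_lipschitz (freq_weight1 R m) (@oscillation_le R m) s t hN).
  by rewrite [leRHS]prod_normE le_max lexx.
rewrite (_ : (fun t => _) = fun t => (trig (oscillation R m) (power_coef (complexify a) e) t).1).
  exact: (lipschitz_continuous hL).
by apply/funext => t; exact: E.
Qed.

(** The mean flow contributes its mean, which is the area up to a factor, and the
    rest of the speed is constant. *)
Lemma circulation_mean :
  (\int[lebesgue_measure]_(t in `[0%R, (2 * pi)%R]) dotp (derive1 f t) (U (f t)))%R =
  kappa * (2 * pi) - 2 * Om * (mean_value Mean e * pi).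
Proof.
have [P0 _ P2] := mean_primitive_values r0 (ltnW hm) bounded_mean_array (ltW er).
pose Q s := kappa * (s - S * mean_primitive m Mean e s).
have dQ t : is_derive t 1 Q (kappa * (1 - S * cRe (M t))).
  have dP := mean_primitive_derive (ltnW hm) t bounded_mean_array er.
  rewrite ev_mean_array in dP.
  exact: (is_deriveZ _ (is_deriveB (is_derive_id t 1) (is_deriveZ S dP))).
have cQ : continuous Q.
  move=> t; apply/differentiable_continuous/derivable1_diffP.
  by have [h _] := dQ t.
have cM : continuous (fun t : R => cRe (M t)).
  rewrite (_ : (fun t => _) = fun t => cRe (ev (amp t) Mean)).
    exact: Re_ev_continuous bounded_mean_array.
  by apply/funext => t; rewrite ev_mean_array.
have p2 : (0 : R) < 2 * pi by rewrite mulr_gt0 ?pi_gt0.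
rewrite /Rintegral.
under eq_integral => t _ do rewrite velocity_tangential.
rewrite (@continuous_FTC2 R _ Q 0 (2 * pi) p2).
- by rewrite -EFinB /= /Q P0 P2; ring.
- apply: continuous_subspaceT => t; apply: cvgM; first exact: cvg_cst.
  apply: cvgB; first exact: cvg_cst.
  apply: cvgM; first exact: cvg_cst.
  exact: cM.
- split; first by move=> t _; have [h _] := dQ t.
    by apply: cvg_at_right_filter; exact: cQ.
  by apply: cvg_at_left_filter; exact: cQ.
- by move=> t _; rewrite derive1E; have [_ ->] := dQ t.
Qed.

Theorem vortex_solution : rotating_hollow_vortex (2 * pi * kappa) Om V U
  (bernoulli_pressure (flow m tau kappa e) Om).
Proof.
have [w' hw] := flow_C11.
split.
  split; [exact: (core_open perturbation_half_lipschitz)|exact: (core_connected perturbation_half_lipschitz)|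
    exact: (core_nonempty perturbation_half_lipschitz)|exact: (core_bounded perturbation_half_lipschitz)].
split.
  have [h1 h2] := flow_C1 Om domain_open hw.
  split => //; apply: continuous_subspaceT; [exact: velocity_continuous|exact: pressure_continuous].
split; first by move=> x; exact: (flow_equations Om hw).
split.
  exists f; split; first exact: trace_ccw.
  split; last exact: velocity_normal.
  by rewrite circulation_mean area_core_mean /=; congr (_ - _); ring.
have [c hc] := pressure_boundary; exists c => x.
by rewrite frontier_trace => -[t _ <-].
Qed.

End SmallAmplitude.

(** The boundary values of the velocity are [i zeta] times the values of this array,
    so that they have the frequencies of the trace. *)
Definition speed_array : nat -> nat -> R := kappa *: cauchy (flip (cnst 1 + kser m sol))
  (cnst 1 - cauchy (omser tau sol) (cnst 1 + g + flip g + sigser m sol)).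

Lemma bounded_speed_array : bounded_array r speed_array.
Proof.
have b1 := bounded_array_cnst r (1 : R).
have bk := bounded_kser r0 bounded_g bounded_h bounded_kap.
apply: bounded_arrayZ; apply: (bounded_array_cauchy r0).
  exact: (bounded_array_flip (bounded_arrayD r0 b1 bk)).
apply: (bounded_arrayD r0 b1); apply: bounded_arrayN; apply: (bounded_array_cauchy r0).
  exact: (bounded_omser tau r0 bounded_delta).
exact: bounded_mean_array.
Qed.

Lemma ev_speed_array t : ev (amp t) speed_array =
  kappa%:C%C * (((K t)^*)%C * (1 - S%:C%C * M t)).
Proof.
have am := amplitude_le t.
have b1 := bounded_array_cnst r (1 : R).
have bk := bounded_kser r0 bounded_g bounded_h bounded_kap.
have bo := bounded_omser tau r0 bounded_delta.
have bm := bounded_array_cauchy r0 bo bounded_mean_array.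
have b1k := bounded_arrayD r0 b1 bk.
have bf := bounded_array_flip b1k.
have bd := bounded_arrayD r0 b1 (bounded_arrayN bm).
rewrite (evZ r0 am kappa (bounded_array_cauchy r0 bf bd)) (ev_cauchy r0 am bf bd).
rewrite (ev_flip r0 am b1k) (ev_1_add _ bk) (evB r0 am b1 bm) (ev_cnst r0 am).
by rewrite (ev_cauchy r0 am bo bounded_mean_array) ev_spin ev_mean_array -[(1%:C)%C]/(1 : R[i]).
Qed.

Lemma velocity_trace t : U (f t) =
  trig (freq R m) (power_coef (fun i j => 'i%C * complexify speed_array i j) e) t.
Proof.
rewrite -[LHS]complex_ofK velocity_circle /trig.
have [N hN] := freq_weight_bound 0 bounded_speed_array.
have hs := summable_trig (freq R m) t hN.
rewrite (_ : (fun i j => _) = fun i j => 'i%C *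
  (power_coef (complexify speed_array) e i j * expi (freq R m i j * t))); last first.
  by apply/funext => i; apply/funext => j; rewrite /power_coef !mulrA.
rewrite (csumZ _ hs) (csum_freq_ev _ bounded_speed_array) ev_speed_array.
congr plane_of; move: (expi t) (kappa%:C)%C ((K t)^*)%C (1 - _) => a b c q.
by ring.
Qed.

End Vortex.

(** * The circular vortex and the expansions at it *)

Section TrivialSolution.
Variables (R : realType) (m : nat) (tau kappa : R).

Local Notation sol := (solution m tau).

Lemma power_coef0 (a : nat -> nat -> R) : a 0%N 0%N = 0 ->
  power_coef (complexify a) 0 = fun _ _ => 0.
Proof.
move=> a0; apply/funext => i; apply/funext => j; rewrite /power_coef /complexify expr0n.
case: eqP => [|_]; last by rewrite mulr0.
by move/eqP; rewrite addn_eq0 => /andP[/eqP -> /eqP ->]; rewrite a0 mul0r.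
Qed.

Lemma csum0 : csum (fun _ _ => 0 : R[i]) = 0.
Proof.
have [_ ->] := @csum_support R (fun _ _ => 0) 0 (fun _ _ _ => erefl).
by rewrite /square_sum big_ord0.
Qed.

Lemma hol0 (a : nat -> nat -> R) n u : a 0%N 0%N = 0 ->
  hol (power_coef (complexify a) 0) n u = 0.
Proof.
move=> a0; rewrite /hol power_coef0 // -[RHS]csum0; congr csum.
by apply/funext => i; apply/funext => j; rewrite mul0r.
Qed.

Lemma perturbation0 : perturbation m tau 0 = fun=> 0.
Proof. by apply/funext => u; rewrite /perturbation hol0 // gser_support. Qed.

Lemma spin0 : spin m tau 0 = 1 + tau.
Proof. by rewrite /spin power_coef0 ?delta00 // /scalar_sum csum0 addr0. Qed.

Let zero_lip (u v : R[i]) : normc u <= 1 -> normc v <= 1 ->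
  normc (0 - 0 : R[i]) <= 2^-1 * normc (u - v).
Proof. by move=> _ _; rewrite subrr ComplexField.Normc.normc0 mulr_ge0 ?normc_ge0. Qed.

Lemma Psi0 z : Psi (perturbation m tau 0) z = z.
Proof. by rewrite perturbation0; have := PsiK zero_lip z; rewrite /Phi addr0. Qed.

Lemma core0 : core (perturbation m tau 0) = @unit_disk R.
Proof.
apply/seteqP; split => x; rewrite /core /radial /unit_disk /= Psi0 dotp_normc => h.
  by rewrite expr_lt1 // normc_ge0.
by rewrite -(@expr_lt1 _ 2) // normc_ge0.
Qed.

Lemma velocity0 x : 1 <= normc (complex_of x) -> vortex_velocity m tau kappa 0 x =
  (kappa / dotp x x) *: perp x - (kappa * (1 + tau)) *: perp x.
Proof.
move=> x1; rewrite /vortex_velocity /relative_velocity spin0; congr (_ - _).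
have z0 : complex_of x != 0 by rewrite -normc_eq0 gt_eqF // (lt_le_trans ltr01).
rewrite /flow Psi0 fold_ge1 // /lab_flow /swirl /slope !hol0 ?flow_part_support //; last first.
  have -> : aser m sol = gser sol + hser m sol by [].
  by rewrite !fctE gser_support // h_support // addr0.
rewrite mulr0 !addr0 invr1 !mulr1.
have zc : complex_of x * ((complex_of x)^*)%C = (dotp x x)%:C%C.
  by rewrite mulr_conjc dotp_normc.
have d0 : dotp x x != 0.
  by rewrite dotp_normc expf_neq0 // normc_eq0.
have -> : (complex_of x)^-1 = ((complex_of x)^*)%C * ((dotp x x)^-1)%:C%C.
  apply: (mulfI z0); rewrite divff // mulrA zc -(@real_complexM R) divff //.
move: (dotp x x)^-1 => q; case: x {x1 z0 zc d0} => a b.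
rewrite /complex_of /perp /plane_of; congr (_, _).
  change (- (0 * kappa - 1 * 0) * (a * q - (- b) * 0) - - (0 * 0 + 1 * kappa) * (a * 0 + (- b) * q)
    = kappa * q * - b).
  by ring.
change (- (- (0 * kappa - 1 * 0) * (a * 0 + (- b) * q) + - (0 * 0 + 1 * kappa) * (a * q - (- b) * 0))
  = kappa * q * a).
by ring.
Qed.

End TrivialSolution.

Section Expansions.
Variables (R : realType) (m : nat) (tau kappa r : R).
Hypothesis hm : (2 <= m)%N.
Hypothesis htau : tau ^+ 2 * m%:R = 1.
Hypothesis r0 : 0 < r.
Hypothesis hr : 12000 * m%:R * ball_cst R m ^+ 2 * r <= 1.
Implicit Types (a : nat -> nat -> R) (e t : R).

Local Notation sol := (solution m tau).

Definition high n a : nat -> nat -> R := fun i j => if (i + j < n)%N then 0 else a i j.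
Definition low n a : nat -> nat -> R := fun i j => if (i + j < n)%N then a i j else 0.

Lemma low_add_high n a : a = low n a + high n a.
Proof.
apply/funext => i; apply/funext => j; rewrite !fctE /low /high.
by case: ifP => _; rewrite ?addr0 ?add0r.
Qed.

Lemma norm_bound_high n a N : norm_bound r a N -> norm_bound r (high n a) N.
Proof.
move=> h; apply: (norm_bound_le r0 h) => // i j; rewrite /high.
by case: ifP => // _; rewrite normr0.
Qed.

Lemma low_support n a e (u : nat -> nat -> R[i]) :
  forall i j, (n <= i)%N || (n <= j)%N ->
  power_coef (complexify (low n a)) e i j * u i j = 0.
Proof.
move=> i j h; rewrite /power_coef /complexify /low ifF ?mul0r //.
apply/negbTE; rewrite -leqNgt; case/orP: h => h; apply: leq_trans h _.
  exact: leq_addr.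
exact: leq_addl.
Qed.

Lemma csum_low_high n a N e (u : nat -> nat -> R[i]) : norm_bound r a N -> `|e| <= r ->
  (forall i j, normc (u i j) = 1) ->
  csum (fun i j => power_coef (complexify a) e i j * u i j) =
  square_sum (fun i j => power_coef (complexify (low n a)) e i j * u i j) n +
  csum (fun i j => power_coef (complexify (high n a)) e i j * u i j).
Proof.
move=> ha er hu.
have hs b N' : norm_bound r b N' ->
    summable_by (fun i j => power_coef (complexify b) e i j * u i j) N'.
  move=> hb k; apply: le_trans (hb k); apply: square_sum_le => i j.
  rewrite normcM hu mulr1 /power_coef normcM !normcr normrX ler_wpM2l //.
  by rewrite lerXn2r ?nnegrE // ltW.
have [[N1 h1] <-] := csum_support (@low_support n a e u).
rewrite -(csumD h1 (hs _ _ (norm_bound_high n ha))); congr csum.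
apply/funext => i; apply/funext => j; rewrite {1}(low_add_high n a) !fctE.
by rewrite /power_coef /complexify !fctE rmorphD /= !mulrDl.
Qed.

Lemma plane_of_expi t : plane_of (expi t) = unit_circle t.
Proof. by []. Qed.

Lemma trace_remainder e t : `|e| < r ->
  boundary_trace (Phi (perturbation m tau e)) t -
    (unit_circle t + e *: unit_circle ((1 - m%:R) * t)
      - (- (e ^+ 2 * shape_tail sol 2 0)) *: unit_circle ((1 - 2 * m%:R) * t)) =
  trig (freq R m) (power_coef (complexify (high 3 (cnst 1 + gser sol))) e) t.
Proof.
move=> er; have [Nb hb] := bounded_trace_array hm htau r0 hr.
rewrite /boundary_trace (trace_circle hm htau r0 hr er) /trig.
rewrite (@csum_low_high 3 _ Nb) //; last 2 first.
- exact: ltW.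
- by move=> i j; exact: normc_expi.
rewrite plane_ofD [X in X + _ - _](_ : _ = unit_circle t + e *: unit_circle ((1 - m%:R) * t)
      - (- (e ^+ 2 * shape_tail sol 2 0)) *: unit_circle ((1 - 2 * m%:R) * t)).
  by rewrite addrC addKr.
rewrite -!plane_of_expi -!plane_ofZ -plane_ofD -plane_ofB; congr plane_of.
have z (i j : nat) x : (i <= j)%N -> (0 < j)%N || (0 < i)%N ->
    power_coef (complexify (low 3 (cnst 1 + gser sol))) e i j * x = 0.
  move=> ij j0; rewrite /power_coef /complexify /low; case: ifP => _; last by rewrite !mul0r.
  rewrite !fctE gser_support // addr0 /cnst ifF ?mul0r //.
  by apply/negbTE; move: ij j0; clear; lia.
have cE (i j : nat) : (i + j < 3)%N -> power_coef (complexify (low 3 (cnst 1 + gser sol))) e i j =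
    ((cnst 1 i j + (xvar R i j + shape_tail sol i j)) * e ^+ (i + j))%:C%C.
  by move=> ij; rewrite /power_coef /complexify /low ij real_complexM.
have c00 : power_coef (complexify (low 3 (cnst 1 + gser sol))) e 0 0 = 1.
  by rewrite cE // (@shape_support _ m tau) // /cnst /xvar /= !addr0 expr0 mulr1.
have c10 : power_coef (complexify (low 3 (cnst 1 + gser sol))) e 1 0 = e%:C%C.
  by rewrite cE // (@shape_support _ m tau) // /cnst /xvar /= addr0 add0r expr1 mul1r.
have c20 : power_coef (complexify (low 3 (cnst 1 + gser sol))) e 2 0 =
    (e ^+ 2 * shape_tail sol 2 0)%:C%C.
  by rewrite cE // /cnst /xvar /= !add0r mulrC.
have c21 : power_coef (complexify (low 3 (cnst 1 + gser sol))) e 2 1 = 0.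
  by rewrite /power_coef /complexify /low /= mul0r.
rewrite /square_sum !big_ord_recr !big_ord0 /= ?big_ord_recr ?big_ord0 /=.
rewrite !add0r (z 0%N 1%N) // (z 0%N 2%N) // (z 1%N 1%N) // (z 1%N 2%N) // (z 2%N 2%N) //.
rewrite c00 c10 c20 c21 mul0r !addr0 mul1r.
have -> : freq R m 0 0 * t = t by rewrite /freq; ring.
have -> : freq R m 1 0 * t = (1 - m%:R) * t by rewrite /freq; ring.
have -> : freq R m 2 0 * t = (1 - 2 * m%:R) * t by rewrite /freq; ring.
by rewrite (rmorphN (real_complex R)) mulNr opprK.
Qed.

Lemma spin_remainder e : `|e| <= r ->
  kappa * spin m tau e - kappa * (1 + tau + e ^+ 2 * omega_tail sol 1 1) =
  scalar_sum (power_coef (complexify (high 4 (kappa *: omega_tail sol))) e).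
Proof.
move=> er; have [Nd hd] := bounded_delta hm htau r0 hr.
have hk := norm_boundZ kappa hd.
have low4 := @csum_low_high 4 _ _ e (fun _ _ => 1) hk er (fun _ _ => ComplexField.Normc.normc1 _).
have m1 (c : nat -> nat -> R[i]) : (fun i j => c i j * 1) = c.
  by apply/funext => i; apply/funext => j; rewrite mulr1.
rewrite !m1 in low4.
have kE : csum (power_coef (complexify (kappa *: omega_tail sol)) e) =
    kappa%:C%C * csum (power_coef (complexify (omega_tail sol)) e).
  have hs : summable_by (power_coef (complexify (omega_tail sol)) e) Nd.
    move=> k; apply: le_trans (hd k); apply: square_sum_le => i j.
    rewrite /power_coef normcM !normcr normrX ler_wpM2l //.
    by rewrite lerXn2r ?nnegrE // ltW.
  rewrite -(csumZ _ hs); congr csum; apply/funext => i; apply/funext => j.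
  by rewrite /power_coef mulrA; congr (_ * _); exact: real_complexM.
have sE : square_sum (power_coef (complexify (low 4 (kappa *: omega_tail sol))) e) 4 =
    (kappa * (e ^+ 2 * omega_tail sol 1 1))%:C%C.
  have z (i j : nat) : i != j -> power_coef (complexify (low 4 (kappa *: omega_tail sol))) e i j = 0.
    move=> ij; rewrite /power_coef /complexify /low !fctE delta_diag // scaler0.
    by case: ifP => _; rewrite mul0r.
  have z0 : power_coef (complexify (low 4 (kappa *: omega_tail sol))) e 0 0 = 0.
    by rewrite /power_coef /complexify /low !fctE delta00 // scaler0 mul0r.
  have zh (i j : nat) : (4 <= i + j)%N ->
      power_coef (complexify (low 4 (kappa *: omega_tail sol))) e i j = 0.
    by move=> ij; rewrite /power_coef /complexify /low ltnNge ij /= mul0r.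
  have o1 : power_coef (complexify (low 4 (kappa *: omega_tail sol))) e 1 1 =
      (kappa * (e ^+ 2 * omega_tail sol 1 1))%:C%C.
    rewrite /power_coef /complexify /low -real_complexM; congr (_%:C)%C.
    by rewrite -mulrA [X in _ * X]mulrC.
  rewrite -o1; move: (power_coef (complexify (low _ _)) e) z z0 zh => c z z0 zh.
  rewrite /square_sum !big_ord_recr !big_ord0 /= ?big_ord_recr ?big_ord0 /=.
  rewrite z0 (zh 2%N 2%N) // (zh 3%N 3%N) //.
  move: (c 1%N 1%N) => c11; by rewrite !z // !addr0 !add0r.
have := congr1 (fun w => cRe w) low4; rewrite kE sE.
have reM (k : R) w : cRe (k%:C%C * w) = k * cRe w by case: w => u v /=; ring.
have reD (k : R) w : cRe (k%:C%C + w) = k + cRe w by case: w.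
rewrite reM reD /spin /scalar_sum => h; rewrite !mulrDr h; ring.
Qed.

Lemma spin_scalar e : `|e| < r ->
  kappa * spin m tau e = scalar_sum (power_coef (complexify (kappa *: omser tau sol)) e).
Proof.
move=> er; have bo := bounded_omser tau r0 (bounded_delta hm htau r0 hr).
have E : csum (power_coef (complexify (kappa *: omser tau sol)) e) = (kappa * spin m tau e)%:C%C.
  rewrite real_complexM -(ev_spin hm htau r0 hr er 0).
  rewrite -(evZ r0 (amplitude_le m er 0) kappa bo) /ev; congr csum.
  apply/funext => i; apply/funext => j.
  by rewrite monomials_amplitude mulr0 expi0 mulr1.
by rewrite /scalar_sum E.
Qed.

End Expansions.

Lemma radius_exists (R : realType) (m : nat) : (2 <= m)%N ->
  exists r : R, 0 < r /\ 12000 * m%:R * ball_cst R m ^+ 2 * r <= 1.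
Proof.
move=> hm; have m0 : 0 < m%:R :> R by rewrite ltr0n ltnW.
have c0 : 0 < ball_cst R m ^+ 2 by rewrite exprn_gt0 // ltr_wpDr // ltW.
have n0 : (0 : R) < 12000 by rewrite ltr0n.
have k0 := mulr_gt0 (mulr_gt0 n0 m0) c0.
exists (12000 * m%:R * ball_cst R m ^+ 2)^-1; move: (12000 * _ * _) k0 => k k0.
by rewrite invr_gt0 k0 divff // gt_eqF.
Qed.

(** * The bifurcation theorem *)

Theorem theorem1p1 (R : realType) (gamma : R) (l : nat) (alpha : R)
    (hgamma : gamma != 0) (halpha : 0 < alpha < 1)
    (m : nat) (hm : (2 <= m)%N)
    (sg : R) (hsg : sg = 1 \/ sg = -1) :
  let sm := Num.sqrt (m%:R : R) in
  let Omega0 := gamma / (2 * pi) * (1 + sg / sm) in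
  exists (d : R) (U : R -> R * R -> R * R) (V : R -> set (R * R))
         (Omega : R -> R) (F : R -> R[i] -> R[i]),
    let f := fun e => boundary_trace (F e) in
    0 < d /\
    (forall e, `|e| < d ->
      [/\ exists P, rotating_hollow_vortex gamma (Omega e) (V e) (U e) P,
          mfold_symmetric m (V e) (U e)
        & exterior_conformal_map (F e) (fluid_domain (V e))] /\
      [/\ holder_space l.+1 alpha (f e),
          frontier (V e) = range (f e)
        & even_about_real_axis (frontier (V e))]) /\
    (forall e, `|e| < d ->
      [/\ scalar_analytic_at Omega e,
          holder_analytic_at l.+1 alpha f e
        & holder_analytic_at l alpha (fun e' t => U e' (f e' t)) e]) /\
    [/\ forall x, closure (fluid_domain (V 0)) x ->
          U 0 x = (gamma / (2 * pi) / dotp x x) *: perp x - Omega0 *: perp x,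
        V 0 = @unit_disk R
      & Omega 0 = Omega0] /\
    (let remainder := fun e t =>
       f e t - (unit_circle t + e *: unit_circle ((1 - m%:R) * t)
                - (e ^+ 2 * (sm + sg) ^+ 2) *:
                    unit_circle ((1 - 2 * m%:R) * t)) in
     exists C : R, \forall e \near (0 : R),
       (holder_norm l.+1 alpha (remainder e) <= (C * `|e| ^+ 3)%:E)%E) /\
    (exists C : R, \forall e \near (0 : R),
      `|Omega e - (Omega0 + sg * e ^+ 2 * gamma *
          ((sm + sg) ^+ 3 * (sm + 3 * sg) / (4 * pi * sm)))|
      <= C * e ^+ 4).

Proof.
move=> sm Omega0.
have m0 : (0 : R) < m%:R by rewrite ltr0n ltnW.
have s0 : 0 < sm by rewrite sqrtr_gt0.
have sm2 : sm ^+ 2 = m%:R by rewrite sqr_sqrtr // ltW.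
have sg2 : sg ^+ 2 = 1 by case: hsg => ->; ring.
pose tau := sg / sm; pose kappa := gamma / (2 * pi).
have pi0 : pi != 0 :> R by rewrite gt_eqF // pi_gt0.
have htau : tau ^+ 2 * m%:R = 1.
  by rewrite /tau expr_div_n sg2 sm2 mul1r mulVf // gt_eqF.
have [r [r0 hr]] := @radius_exists R m hm.
have q0 : 0 < r / 2 < r by lra.
have W0 i j : 0 <= freq_weight R m i j <= m.+1%:R * (i + j).+1%:R.
  by rewrite freq_weight_linear (le_trans ler01) // freq_weight1.
have hal : aser m (solution m tau) 0%N 0%N = 0.
  have -> : aser m (solution m tau) = gser (solution m tau) + hser m (solution m tau) by [].
  by rewrite !fctE gser_support // h_support // addr0.
have half0 : (0 : R) < 2^-1 by rewrite invr_gt0.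
have [d1 d10 hd1] := weight_small 1 (ler0n _ _) W0 (bounded_g hm htau r0 hr) q0
  (@gser_support _ m tau 0 0 isT) half0.
have [d2 d20 hd2] := weight_small 1 (ler0n _ _) W0 (bounded_al hm htau r0 hr) q0 hal half0.
(* All series converge below [r]; the bounds [d1] and [d2] make the upper half of
   the boundary a graph. *)
pose d := Num.min (r / 2) (Num.min d1 d2).
have [lowG lowD] := shape_omega_low hm s0 sm2 hsg.
rewrite -/tau in lowG lowD.
exists d, (vortex_velocity m tau kappa), (fun e => core (perturbation m tau e)),
  (fun e => kappa * spin m tau e), (fun e => Phi (perturbation m tau e)).
move=> f.
have rd (e : R) : `|e| < d -> `|e| < r.
  by rewrite lt_min => /andP[h _]; have := andP q0 => -[_]; exact: lt_trans.
have fE e : `|e| < r -> f e = trig (freq R m) (power_coef (complexify (cnst 1 + gser (solution m tau))) e).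
  by move=> er; apply/funext => t; rewrite /f /boundary_trace (trace_circle hm htau r0 hr er).
have [NB hB] := bounded_trace_array hm htau r0 hr.
have W1 := freq_weight1 R m; have wW := freq_le R m; have WC := freq_weight_linear R m.
have C0 : 0 <= m.+1%:R :> R by exact: ler0n.
have wp := @expi_period R m.
have gE : gamma = 2 * pi * kappa by rewrite /kappa mulrC divfK // mulf_neq0 // pnatr_eq0.
split; first by rewrite !lt_min d10 d20 divr_gt0.
split.
  move=> e ed; have er := rd e ed.
  have [e1 e2] : `|e| <= d1 /\ `|e| <= d2.
    by move: ed; rewrite !lt_min => /and3P[_ h1 h2]; split; exact: ltW.
  have fr : frontier (core (perturbation m tau e)) = range (f e).
    by rewrite (frontier_trace hm htau r0 hr er) fE.
  split; split.
  - exists (bernoulli_pressure (flow m tau kappa e) (kappa * spin m tau e)).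
    rewrite gE; exact: (vortex_solution kappa hm htau r0 hr er (hd1 e e1) (hd2 e e2)).
  - exact: (vortex_mfold kappa hm htau r0 hr er).
  - exact: (Phi_exterior hm htau r0 hr er).
  - have [N hN] := freq_weight_bound m er l.+3 (bounded_trace_array hm htau r0 hr).
    rewrite (fE e er).
    by have [] := trig_holder W1 wW wp halpha hN.
  - exact: fr.
  - move=> x; rewrite (frontier_core (perturbation_half_lipschitz hm htau r0 hr er)) /=.
    rewrite -[in X in _ -> X](radial_opp (perturbation_half_lipschitz hm htau r0 hr er) (perturbation_conj hm htau r0 hr er)) opprK.
    by case: x.
split.
  move=> e ed; have er := rd e ed; split.
  - have [ND hD] : exists N, norm_bound r (kappa *: omser tau (solution m tau)) N.
      exact: (bounded_arrayZ kappa (bounded_omser tau r0 (bounded_delta hm htau r0 hr))).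
    apply: (scalar_analytic_powers (fun n => complexify_bound n hD) er) => e' er'.
    exact: (spin_scalar kappa hm htau r0 hr er').
  - exact: (holder_analytic_powers l.+1 W1 wW C0 WC wp halpha
      (fun n => complexify_bound n hB) er fE).
  - have [NS hS] := bounded_speed_array kappa hm htau r0 hr.
    have hS' n : square_sum (fun i j => normc ('i%C * complexify (speed_array m tau kappa) i j) *
        r ^+ (i + j)) n <= NS.
      apply: le_trans (complexify_bound n hS); apply: square_sum_le => i j.
      by rewrite normcM [normc 'i%C](_ : _ = 1) ?mul1r //= expr0n expr1n add0r sqrtr1.
    have UE e' : `|e'| < r -> (fun t => vortex_velocity m tau kappa e' (f e' t)) =
        trig (freq R m) (power_coef (fun i j =>
          'i%C * complexify (speed_array m tau kappa) i j) e').
      move=> er'; apply/funext => t; rewrite (fE e' er').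
      exact: (velocity_trace kappa hm htau r0 hr er').
    exact: (holder_analytic_powers l (f := fun e' t =>
      vortex_velocity m tau kappa e' (f e' t)) W1 wW C0 WC wp halpha hS' er UE).
have r1 : `|0 : R| < r by rewrite normr0.
split.
  split.
  - move=> x hx; have x1 : 1 <= radial (perturbation m tau 0) x.
      exact: (closure_fluid_sub (perturbation_half_lipschitz hm htau r0 hr r1) hx).
    rewrite /radial Psi0 in x1.
    by rewrite (velocity0 m tau kappa x1).
  - exact: core0.
  - by rewrite spin0.
split.
  move=> remainder.
  have hH n := complexify_bound n (norm_bound_high r0 3 hB).
  have [|C hC] := holder_remainder l.+1 W1 wW C0 WC wp halpha (n := 3) hH _ q0.
    by move=> i j ij; rewrite /complexify /high ij.
  exists C; apply/nbhs_ballP; exists (r / 2) => /=; first by case/andP: q0.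
  move=> e; rewrite /ball /= sub0r normrN => er2.
  have er : `|e| < r by apply: lt_trans er2 _; case/andP: q0.
  have -> : remainder e = trig (freq R m)
      (power_coef (complexify (high 3 (cnst 1 + gser (solution m tau)))) e).
    apply/funext => t; rewrite -(trace_remainder hm htau r0 hr t er) /remainder /f lowG.
    by rewrite mulrN opprK.
  exact: hC.
have [ND hD] := bounded_delta hm htau r0 hr.
have hH n := complexify_bound n (norm_bound_high r0 4 (norm_boundZ kappa hD)).
have [|C hC] := scalar_remainder (n := 4) r0 hH.
  by move=> i j ij; rewrite /complexify /high ij.
exists C; apply/nbhs_ballP; exists r => //= e; rewrite /ball /= sub0r normrN => er.
have -> : kappa * spin m tau e - (Omega0 + sg * e ^+ 2 * gamma *
    ((sm + sg) ^+ 3 * (sm + 3 * sg) / (4 * pi * sm))) =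
    kappa * spin m tau e - kappa * (1 + tau + e ^+ 2 * omega_tail (solution m tau) 1 1).
  congr (_ - _); rewrite lowD /Omega0 /kappa /tau; move: (@pi R) pi0 => w w0; field.
  by rewrite w0 gt_eqF.
rewrite (spin_remainder kappa hm htau r0 hr (ltW er)).
have -> : e ^+ 4 = `|e| ^+ 4 by rewrite -normrX ger0_norm // (exprM e 2 2) sqr_ge0.
exact: hC.
Qed.
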